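(* Let $N\ge 3$, let $\Omega\subset\mathbb{R}^N$ be an open set, let $1<p<\infty$ and let $f\in W^{-1,2}(\Omega)\setminus\{0\}$. Let $v_0$ be the unique minimizer of $G_{p,f}$, let $c_1=\|v_0\|_{L^{2p/(p-1)}(\Omega)}$, and let $$V_0=\left(\int_\Omega|v_0|^{2p/(p-1)}\,dx\right)^{-1/p}|v_0|^{2/(p-1)}$$ (this is the unique maximizer of $\mathcal{E}_f(V)$ among $V\in\mathcal{V}$ with $\int_\Omega|V|^p\,dx\le 1$). Then there exists a constant $\sigma_1>0$, depending only on $p$ and $c_1$, such that for every $V\in\mathcal{V}$ with $\int_\Omega |V|^p\,dx\le 1$ we have $$\mathcal{E}_f(V)\le \mathcal{E}_f(V_0)-\sigma_1\,\Big\||V|^{p-2}V-V_0^{p-1}\Big\|^2_{L^{p'}(\Omega)}\qquad\text{if } p\ge 2,$$ and $$\mathcal{E}_f(V)\le \mathcal{E}_f(V_0)-\sigma_1\,\|V-V_0\|^2_{L^{p}(\Omega)}\qquad\text{if } 1<p<2,$$ where $p'=p/(p-1)$.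
   Context: $W^{1,2}_0(\Omega)$ is the homogeneous Sobolev space, i.e. the closure (completion) of $C^\infty_0(\Omega)$ with respect to the norm $\|u\|_{W^{1,2}_0(\Omega)}=(\int_\Omega|\nabla u|^2\,dx)^{1/2}$; $W^{-1,2}(\Omega)$ is its dual and $\langle\cdot,\cdot\rangle$ the duality pairing. For $N\ge3$ put $2^*=2N/(N-2)$ and $T_N=\inf\{\int_{\mathbb{R}^N}|\nabla v|^2\,dx : v\in W^{1,2}_0(\mathbb{R}^N),\ \|v\|_{L^{2^*}(\mathbb{R}^N)}=1\}$. The class of admissible potentials is $$\mathcal{V}=\{V:\Omega\to(-\infty,+\infty]\ :\ V\text{ Borel measurable},\ \|V_-\|_{L^{N/2}(\Omega)}<T_N\},$$ with $V_-$ the negative part of $V$. For $V\in\mathcal{V}$ the energy is $$\mathcal{E}_f(V)=\min_{u\in W^{1,2}_0(\Omega)}\ \frac12\int_\Omega|\nabla u|^2\,dx+\frac12\int_\Omega Vu^2\,dx-\langle f,u\rangle$$ (the functional may take the value $+\infty$). Define for $u\in W^{1,2}_0(\Omega)$ $$G_{p,f}(u)=\frac12\int_\Omega|\nabla u|^2\,dx+\frac12\left(\int_\Omega|u|^{2p/(p-1)}\,dx\right)^{(p-1)/p}-\langle f,u\rangle,$$ with $G_{p,f}(u)=+\infty$ if $u\notin L^{2p/(p-1)}(\Omega)$; it is strictly convex and has a unique minimizer. *)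

(* Defs.v *)
From HB Require Import structures.
From mathcomp Require Import all_boot all_order all_algebra.
From mathcomp Require Import all_classical all_reals all_analysis.
From mathcomp Require Import measurable_realfun.
Set Implicit Arguments.
Unset Strict Implicit.
Unset Printing Implicit Defensive.
Import Order.TTheory GRing.Theory Num.Theory.
Import numFieldNormedType.Exports.
Local Open Scope classical_set_scope.
Local Open Scope ring_scope.

Section borel_rV.
Context (R : realType) (n : nat).

Definition borel_rV : set (set 'rV[R]_n) := <<s [set U | open U] >>.

HB.instance Definition _ :=
  @isMeasurable.Build (sigma_display [set U : set 'rV[R]_n | open U])
    'rV[R]_n borel_rV
    (@sigma_algebra0 _ setT _) (@sigma_algebraC _ _)
    (@sigma_algebra_bigcup _ setT _).

Lemma open_measurable_rV (U : set 'rV[R]_n) : open U -> measurable U.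
Proof. by move=> oU; exact: sub_sigma_algebra. Qed.

Lemma open_rV_bigcup (U : set 'rV[R]_n) : open U ->
  exists c : nat -> 'rV[R]_n * R, exists P : set nat,
    U = \bigcup_(k in P) ball (c k).1 (c k).2.
Proof.
move=> oU.
pose c (k : nat) : 'rV[R]_n * R :=
  if (unpickle k : option ('rV[rat]_n * nat)) is Some qk
  then (map_mx ratr qk.1, qk.2.+1%:R^-1) else (0, 0).
exists c, [set k | ball (c k).1 (c k).2 `<=` U].
apply/seteqP; split; last by move=> x [k /= kU]; exact: kU.
move=> x Ux.
have /nbhs_ballP[e /= e0 eU] : nbhs x U by exact: open_nbhs_nbhs.
have [k ke] : exists k : nat, k.+1%:R^-1 < e / 2.
  have := near_infty_natSinv_lt (PosNum (divr_gt0 e0 (@ltr0n R 2))).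
  by case=> N _ /(_ N (leqnn N)) /= ?; exists N.
have k0 : (0 : R) < k.+1%:R^-1 by rewrite invr_gt0.
have /choice[q qP] : forall j : 'I_n, exists q : rat,
    `|x ord0 j - ratr q| < k.+1%:R^-1.
  move=> j.
  have /rat_in_itvoo[q] : x ord0 j - k.+1%:R^-1 < x ord0 j + k.+1%:R^-1.
    by rewrite ltrD2l gtrN.
  by move=> qx; exists q; rewrite distrC ltr_distl; move: qx; rewrite in_itv.
exists (pickle ((\row_j q j : 'rV[rat]_n), k)) => /=; rewrite /c pickleK /=.
- move=> y [_ qy]; apply: eU; split => // i j; rewrite ord1.
  change (`|x ord0 j - y ord0 j| < e).
  have : `|ratr (q j) - y ord0 j| < k.+1%:R^-1.
    by have := qy ord0 j; rewrite !mxE.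
  rewrite (splitr e) => /lt_trans/(_ ke) yq.
  rewrite -(subrKA (ratr (q j))); apply: (le_lt_trans (ler_normD _ _)).
  by rewrite ltrD// (lt_trans (qP j)).
- split => // i j; rewrite ord1 !mxE.
  change (`|ratr (q j) - x ord0 j| < k.+1%:R^-1).
  by rewrite distrC.
Qed.

Lemma measurable_coord_rV (i : 'I_n) :
  measurable_fun setT (fun x : 'rV[R]_n => x ord0 i).
Proof.
apply: (measurability _ (RGenOpens.measurableE R)).
move=> _ [_ [a [b ->] <-]]; rewrite setTI; apply: open_measurable_rV.
apply: open_comp; last exact: interval_open.
by move=> x _; exact: coord_continuous.
Qed.

End borel_rV.

Section lebesgue_step.
Context (R : realType) (n : nat).
Variable m : {sigma_finite_measure set 'rV[R]_n -> \bar R}.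

Definition rV_cons (p : measurableTypeR R * 'rV[R]_n) : 'rV[R]_n.+1 :=
  \row_i if unlift ord0 i is Some j then p.2 ord0 j else p.1.

Lemma rV_cons0 p : rV_cons p ord0 ord0 = p.1.
Proof. by rewrite mxE unlift_none. Qed.

Lemma rV_consS p j : rV_cons p ord0 (lift ord0 j) = p.2 ord0 j.
Proof. by rewrite mxE liftK. Qed.

Lemma measurable_rV_cons : measurable_fun setT rV_cons.
Proof.
apply: (@measurability _ _ _ _ _ _ [set U : set 'rV[R]_n.+1 | open U]) => //.
move=> _ [U oU <-]; rewrite setTI.
have [c [P ->]] := open_rV_bigcup oU.
rewrite preimage_bigcup; apply: bigcup_measurable => k _.
have [e0|e0] := ltP 0 (c k).2; last first.
  rewrite (_ : _ @^-1` _ = set0)//; apply/seteqP; split => // p /= [].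
  by rewrite ltNge e0.
rewrite (_ : _ @^-1` _ = ball ((c k).1 ord0 ord0) (c k).2 `*`
   ball (col' ord0 (c k).1) (c k).2).
  apply: measurableX; first by rewrite ball_itv; exact: measurable_itv.
  by apply: open_measurable_rV; exact: ball_open.
apply/seteqP; split => [p /= [_ cp]|p /= [p1 [_ p2]]].
  split; first by have := cp ord0 ord0; rewrite rV_cons0.
  split => // i j; rewrite ord1 mxE.
  by have := cp ord0 (lift ord0 j); rewrite rV_consS.
split => // i j; rewrite ord1.
case: (unliftP ord0 j) => [j' ->|->]; last by rewrite rV_cons0.
by rewrite rV_consS; have := p2 ord0 j'; rewrite mxE.
Qed.

Definition lebesgue_rVS : set 'rV[R]_n.+1 -> \bar R :=
  pushforward (lebesgue_measure \x m)%E rV_cons.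

Let lebesgue_rVS0 : lebesgue_rVS set0 = 0%E.
Proof. by rewrite /lebesgue_rVS /pushforward preimage_set0 measure0. Qed.

Let lebesgue_rVS_ge0 A : (0 <= lebesgue_rVS A)%E.
Proof. exact: (measure_ge0 (lebesgue_measure \x m)%E). Qed.

Let lebesgue_rVS_sigma_additive : semi_sigma_additive lebesgue_rVS.
Proof.
move=> F mF tF mUF; rewrite /lebesgue_rVS /pushforward preimage_bigcup.
have mcons A : measurable A -> measurable (rV_cons @^-1` A).
  by move=> mA; rewrite -[X in measurable X]setTI; exact: measurable_rV_cons.
apply: measure_semi_sigma_additive => [k||]; first exact: mcons.
- apply/trivIsetP => i j _ _ ij; rewrite -preimage_setI.
  by move/trivIsetP : tF => /(_ _ _ _ _ ij) ->//; rewrite preimage_set0.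
- by rewrite -preimage_bigcup; exact: mcons.
Qed.

HB.instance Definition _ := isMeasure.Build _ _ _ lebesgue_rVS
  lebesgue_rVS0 lebesgue_rVS_ge0 lebesgue_rVS_sigma_additive.

Lemma lebesgue_rVSE (A : set R) (B : set 'rV[R]_n) :
  measurable A -> measurable B ->
  lebesgue_rVS [set x : 'rV[R]_n.+1 | A (x ord0 ord0) /\ B (col' ord0 x)] =
  (lebesgue_measure A * m B)%E.
Proof.
move=> mA mB.
rewrite -product_measure1E//; congr product_measure1; apply/seteqP.
have colK p : col' ord0 (rV_cons p) = p.2.
  by apply/rowP => j; rewrite mxE rV_consS.
by split => -[x y] /=; rewrite colK rV_cons0.
Qed.

Let lebesgue_rVS_sigma_finite : sigma_finite setT lebesgue_rVS.
Proof.
have /sigma_finiteP[F [FT ndF Foo]] := sigma_finiteT (@lebesgue_measure R).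
have /sigma_finiteP[G [GT ndG Goo]] := sigma_finiteT m.
exists (fun k => [set x : 'rV[R]_n.+1 | F k (x ord0 ord0) /\ G k (col' ord0 x)]).
  apply/esym; rewrite -subTset => x _.
  have [i _ Fi] : (\bigcup_i F i) (x ord0 ord0) by rewrite -FT.
  have [j _ Gj] : (\bigcup_i G i) (col' ord0 x) by rewrite -GT.
  exists (maxn i j) => //; split.
  - by move: Fi; exact/subsetPset/ndF/leq_maxl.
  - by move: Gj; exact/subsetPset/ndG/leq_maxr.
move=> k; have [mF Fk] := Foo k; have [mG Gk] := Goo k; split; last first.
  by rewrite lebesgue_rVSE// lte_mul_pinfty// ge0_fin_numE.
apply: measurableI.
- have := @measurable_coord_rV R n.+1 ord0.
  by move=> /(_ measurableT _ mF); rewrite setTI.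
- have : measurable_fun setT (fun x : 'rV[R]_n.+1 => col' ord0 x).
    apply: (@measurability _ _ _ _ _ _ [set U : set 'rV[R]_n | open U]) => //.
    move=> _ [U oU <-]; rewrite setTI; apply: open_measurable_rV.
    apply: open_comp => // x _ V /nbhs_ballP[e /= e0 eV].
    apply/nbhs_ballP; exists e => // y [_ xy]; apply: eV; split => // i j.
    by rewrite !mxE; exact: xy.
  by move=> /(_ measurableT _ mG); rewrite setTI.
Qed.

HB.instance Definition _ := Measure_isSigmaFinite.Build _ _ _ lebesgue_rVS
  lebesgue_rVS_sigma_finite.

End lebesgue_step.

Fixpoint lebesgue_rV (R : realType) (n : nat) :
    {sigma_finite_measure set 'rV[R]_n -> \bar R} :=
  if n is k.+1 then lebesgue_rVS (lebesgue_rV R k) else dirac (0 : 'rV[R]_0).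

Lemma lebesgue_rV_box (R : realType) (n : nat) (a b : 'rV[R]_n) :
  (forall i, a ord0 i <= b ord0 i) ->
  lebesgue_rV R n [set x | forall i, a ord0 i <= x ord0 i <= b ord0 i] =
  (\prod_i (b ord0 i - a ord0 i))%:E.
Proof.
elim: n a b => [|n IHn] a b ab /=.
  rewrite big_ord0 diracE (_ : _ \in _)//; by apply/mem_set => -[].
rewrite big_ord_recl EFinM.
pose A := `[a ord0 ord0, b ord0 ord0]%classic.
pose B := [set x : 'rV[R]_n | forall i,
  col' ord0 a ord0 i <= x ord0 i <= col' ord0 b ord0 i].
have mB : measurable B.
  rewrite (_ : B = \bigcap_(i in [set: 'I_n])
      ((fun x : 'rV[R]_n => x ord0 i) @^-1`
        `[col' ord0 a ord0 i, col' ord0 b ord0 i])); last first.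
    apply/seteqP; split => x /= h i; last by have := h i Logic.I; rewrite /= in_itv.
    by move=> _; rewrite /= in_itv; exact: h.
  apply: fin_bigcap_measurable => // i _; rewrite -[X in measurable X]setTI.
  exact: (@measurable_coord_rV R n i measurableT _ (measurable_itv _)).
transitivity (lebesgue_measure A * lebesgue_rV R n B)%E; last first.
  rewrite IHn => [|i]; last by rewrite !mxE.
  rewrite lebesgue_measure_itv /= lte_fin; congr (_ * _)%E.
    have := ab ord0; rewrite le_eqVlt => /orP[/eqP ->|->//].
    by rewrite ltxx subrr.
  by under eq_bigr do rewrite !mxE.
have <- := @lebesgue_rVSE R n (lebesgue_rV R n) A B (measurable_itv _) mB.
congr (lebesgue_rVS _ _); apply/seteqP; split => x /= h.
  split; first by rewrite /A /= in_itv /=; exact: h.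
  by move=> i; rewrite !mxE.
move: h => [+ h] i; rewrite /A /= in_itv /= => h0.
case: (unliftP ord0 i) => [j ->|->//].
by have := h j; rewrite !mxE.
Qed.

Section homogeneous_sobolev.
Context (R : realType) (n : nat).
Local Notation E := 'rV[R]_n.
Implicit Types (Omega : set E) (u v phi : E -> R) (g : E -> E).

(* The L^q norm over Omega; the restriction operator extends by 0. *)
Definition Lnorm_on Omega (q : R) (h : E -> \bar R) : \bar R :=
  'N[lebesgue_rV R n]_(q%:E)[h \_ Omega]%E.

Definition partial (i : 'I_n) phi : E -> R :=
  fun x => 'D_(delta_mx ord0 i) phi x.

Definition gradient phi : E -> E := fun x => \row_i partial i phi x.

Fixpoint Ck (k : nat) phi : Prop :=
  continuous phi /\
  if k is k'.+1 then
    forall i : 'I_n, (forall x, derivable phi x (delta_mx ord0 i)) /\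
                     Ck k' (partial i phi)
  else True.

Definition test_function Omega phi : Prop :=
  (forall k, Ck k phi) /\
  exists K : set E, [/\ compact K, K `<=` Omega & forall x, ~ K x -> phi x = 0].

(* The matrix norm of the library is the sup norm, hence the explicit sum. *)
Definition sqnorm2 (x : E) : R := \sum_i (x ord0 i) ^+ 2.

Definition int_sqnorm Omega g : \bar R :=
  (\int[lebesgue_rV R n]_(x in Omega) (sqnorm2 (g x))%:E)%E.

Definition sobolev_exponent : R := 2 * n%:R / (n%:R - 2).

(* An element of the completion of the test functions for the norm
   |grad phi|_2 is the limit of a Cauchy sequence phi_k.  For n >= 3 it is
   identified, through the Sobolev inequality, with the limit u of phi_k in
   L^(2* ), and its gradient is the limit g of grad phi_k in L^2. *)
Definition sobolev_pair Omega u g : Prop :=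
  [/\ measurable_fun Omega u, measurable_fun Omega g &
   exists phi : nat -> E -> R,
    [/\ forall k, test_function Omega (phi k),
        Lnorm_on Omega sobolev_exponent (fun x => (phi k x - u x)%:E)
          @[k --> \oo] --> 0%E &
        int_sqnorm Omega (fun x => gradient (phi k) x - g x)
          @[k --> \oo] --> 0%E]].

Definition W012 Omega : set (E -> R) :=
  [set u | exists g, sobolev_pair Omega u g].

(* sobolev_pair determines the gradient up to a null set. *)
Definition weak_gradient Omega u : E -> E :=
  xget (fun=> 0) [set g | sobolev_pair Omega u g].

Definition dirichlet Omega u : \bar R := int_sqnorm Omega (weak_gradient Omega u).

(* Functions of W012 are representatives of classes modulo null sets;
   linearity and boundedness make f constant on each class. *)
Definition dual_W012 Omega (f : (E -> R) -> R) : Prop :=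
  (forall (a : R) u v, W012 Omega u -> W012 Omega v ->
     f (fun x => a * u x + v x) = a * f u + f v) /\
  exists C : R, forall u, W012 Omega u ->
    (`|f u|%:E <= C%:E * (dirichlet Omega u) `^ 2^-1)%E.

Definition nonzero_dual Omega (f : (E -> R) -> R) : Prop :=
  exists2 u, W012 Omega u & f u <> 0.

Definition sobolev_constant : \bar R :=
  ereal_inf [set dirichlet setT v | v in
    [set v | W012 setT v /\
             Lnorm_on setT sobolev_exponent (fun x => (v x)%:E) = 1%E]].

Definition admissible Omega (V : E -> \bar R) : Prop :=
  [/\ measurable_fun Omega V,
      forall x, Omega x -> V x <> -oo%E &
      (Lnorm_on Omega (n%:R / 2) (V^\-)%E < sobolev_constant)%E].

Definition energy_functional Omega f (V : E -> \bar R) u : \bar R :=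
  ((2^-1)%:E * dirichlet Omega u
   + (2^-1)%:E * \int[lebesgue_rV R n]_(x in Omega) (V x * ((u x) ^+ 2)%:E)
   - (f u)%:E)%E.

Definition energy Omega f (V : E -> \bar R) : \bar R :=
  ereal_inf [set energy_functional Omega f V u | u in W012 Omega].

Definition conj_power_int Omega (p : R) u : \bar R :=
  (\int[lebesgue_rV R n]_(x in Omega) (`|u x| `^ (2 * p / (p - 1)))%:E)%E.

(* The value is +oo when u is not in L^(2p/(p-1)). *)
Definition G_functional Omega (p : R) f u : \bar R :=
  ((2^-1)%:E * dirichlet Omega u
   + (2^-1)%:E * (conj_power_int Omega p u) `^ ((p - 1) / p)
   - (f u)%:E)%E.

Definition G_minimizer Omega (p : R) f u : Prop :=
  W012 Omega u /\
  forall w, W012 Omega w -> (G_functional Omega p f u <= G_functional Omega p f w)%E.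

Definition optimal_potential Omega (p : R) v (x : E) : R :=
  fine (conj_power_int Omega p v) `^ (- p^-1) * `|v x| `^ (2 / (p - 1)).

End homogeneous_sobolev.

(* Main.v *)
Require Import Defs.
From HB Require Import structures.
From mathcomp Require Import all_boot all_order all_algebra.
From mathcomp Require Import all_classical all_reals all_analysis.
From mathcomp Require Import measurable_realfun ring lra.
Set Implicit Arguments.
Unset Strict Implicit.
Unset Printing Implicit Defensive.
Import Order.TTheory GRing.Theory Num.Theory.
Import numFieldNormedType.Exports.
Local Open Scope classical_set_scope.
Local Open Scope ring_scope.

(* Write q = 2p/(p-1).  The Euler-Lagrange equation of G at
   v0 reads <grad v0, grad w> + int V0 v0 w = f(w), first for the w in W012 with
   |w|^q integrable; the q-th power of v0 + t w is expanded in t by a pointwise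
   inequality.  Comparing v0 with a competitor u such that int V0 u^2 is finite
   requires the equation for u, which need not be in L^q: it follows by
   approximating u in W012 by functions w_k with |w_k| <= 2|u| that are
   dominated by test functions.  Completing the square then gives
   energy V0 >= G(v0), whereas energy V is at most the value at v0 of the energy
   functional of V.  The difference of these bounds is half of |v0|_q^2 times
   the deficit 1 - int V g in Hoelder's inequality, for
   g = v0^2 / |v0|_q^2 = V0^(p-1).  This deficit dominates the integral of the
   Bregman divergence of |.|^r / r between V and V0 with r = p if p < 2, and
   between g and |V|^(p-2) V with r = p/(p-1) if p >= 2.  In both cases r <= 2,
   so that the divergence between s and t is at least a constant times
   (s - t)^2 (|s| + |t|)^(r-2), whose integral dominates |s - t|_r^2. *)

(** * Real inequalities *)

(** The exponent r is kept at most 2 because only then is |.|^r / r uniformly convex of power type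
    2, as a squared norm in the remainder requires. For p > 2 this fails for |.|^p, and the map V ->
    |V|^(p-2) V, which carries the unit ball of L^p into that of L^(p'), brings the deficit back to
    an exponent p' < 2. The obstacle in the Euler-Lagrange equation is that V0 vanishes wherever v0
    does: finiteness of the integral of V0 u^2 says nothing about |u|^q there, so G may be infinite
    along v0 + t u. The truncations of u are rational functions of u and of a test function, because
    these keep test functions smooth; that their gradients converge to that of u rests on the
    vanishing of the latter almost everywhere on {u = 0}. That f is nonzero excludes v0 = 0, for
    which V0 would be 0 and not of norm 1. The constant is sigma1 = c1^2 (r - 1) / 1296: c1^2 / 2
    multiplies the deficit and 648 = 8 * 81, with 8 from the pointwise Bregman bound and 81 from the
    passage to the L^r norm. *)

Section real_inequalities.
Context {R : realType}.
Implicit Types (a b c r s t x y q : R).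

Lemma ler_powRN a x y : a <= 0 -> 0 < x -> x <= y -> y `^ a <= x `^ a.
Proof.
move=> a0 x0 xy; have y0 := lt_le_trans x0 xy.
rewrite -[a]opprK !(powRN _ (- a)) lef_pV2 ?posrE ?powR_gt0//.
by apply: ge0_ler_powR; rewrite ?nnegrE ?oppr_ge0 // ltW.
Qed.

Lemma normr_powRM a x : 0 < a -> `|x| `^ (a - 1) * `|x| = `|x| `^ a.
Proof. by move=> a0; rewrite mulrC mulr_powRB1. Qed.

(** Concavity without derivatives: this is Young's inequality for (x / y)^r and 1 with the exponents
    1 / r and 1 / (1 - r). For r = 1, where the second exponent would be infinite, both sides are
    equal. *)
Lemma powR_le_tangent r x y : 0 < r -> r <= 1 -> 0 <= x -> 0 < y ->
  x `^ r <= y `^ r + r * y `^ (r - 1) * (x - y).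
Proof.
move=> r0 r1 x0 y0.
have -> : y `^ r = y `^ (r - 1) * y.
  by rewrite mulrC mulr_powRB1 ?ltW.
have [->|rn1] := eqVneq r 1.
  by rewrite subrr !powRr0 powRr1//; lra.
have r1' : r < 1 by rewrite lt_neqAle rn1.
have rV0 : 0 < r^-1 by rewrite invr_gt0.
have rV1 : 0 < (1 - r)^-1 by rewrite invr_gt0 subr_gt0.
have := @conjugate_powR R ((x / y) `^ r) 1 r^-1 (1 - r)^-1.
rewrite !powR_ge0 !invrK ler01 rV0 rV1 => /(_ isT isT isT isT).
have -> : r + (1 - r) = 1 by lra.
move=> /(_ erefl); rewrite powR1 -powRrM mulfV ?gt_eqF// powRr1; last first.
  by rewrite divr_ge0// ltW.
rewrite mulr1 powRM ?invr_ge0 ?(ltW y0)// -[y^-1]powR_inv1 ?(ltW y0)//.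
rewrite -powRrM mulN1r => h.
have yr : 0 < y `^ r by rewrite powR_gt0.
move: h; rewrite (powRN y r) (powRN y 1) powRr1 ?(ltW y0)// ler_pdivrMr// => h.
apply: (le_trans h); rewrite le_eqVlt; apply/orP; left; apply/eqP.
have -> : y `^ r = y `^ (r - 1) * y.
  by rewrite mulrC mulr_powRB1 ?ltW.
by field; rewrite gt_eqF.
Qed.

(** Strong monotonicity of the derivative of |.|^r / r. For equal signs it is the tangent inequality
    with exponent r - 1 at the larger modulus. For opposite signs |x - y| = |x| + |y|, and each
    modulus w satisfies w (|x| + |y|)^(r-2) <= w^(r-1) because r - 2 <= 0. *)
Lemma powR_sub_monotone r x y : 1 < r -> r <= 2 ->
  (r - 1) * ((x - y) ^+ 2 * (`|x| + `|y|) `^ (r - 2)) <=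
  (`|x| `^ (r - 2) * x - `|y| `^ (r - 2) * y) * (x - y).
Proof.
move=> r1 r2.
have r10 : 0 < r - 1 by lra.
have r11 : r - 1 <= 1 by lra.
have r20 : r - 2 <= 0 by lra.
have same u v : 0 <= u -> u <= v ->
  (r - 1) * ((v - u) ^+ 2 * (v + u) `^ (r - 2)) <=
  (v `^ (r - 2) * v - u `^ (r - 2) * u) * (v - u).
  move=> u0; rewrite le_eqVlt => /predU1P[->|uv]; first by rewrite subrr; lra.
  have v0 : 0 < v by exact: le_lt_trans uv.
  have := powR_le_tangent r10 r11 u0 v0.
  rewrite (_ : r - 1 - 1 = r - 2); last by lra.
  have E w : 0 <= w -> w `^ (r - 1) = w `^ (r - 2) * w.
    move=> w0; rewrite mulrC (_ : r - 2 = r - 1 - 1); last by lra.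
    by rewrite mulr_powRB1.
  rewrite !E ?(ltW v0)// => h.
  have h2 : (v + u) `^ (r - 2) <= v `^ (r - 2) by apply: ler_powRN => //; lra.
  have vu : 0 <= v - u by lra.
  have h3 : (r - 1) * (v - u) ^+ 2 * (v + u) `^ (r - 2) <=
            (r - 1) * (v - u) ^+ 2 * v `^ (r - 2).
    by rewrite ler_wpM2l// mulr_ge0 ?sqr_ge0// ltW.
  have h4 := ler_wpM2r vu h.
  lra.
have opp u v : 0 <= u -> 0 <= v ->
  (r - 1) * ((v + u) ^+ 2 * (v + u) `^ (r - 2)) <=
  (v `^ (r - 2) * v + u `^ (r - 2) * u) * (v + u).
  move=> u0 v0.
  have main w z : 0 <= w -> 0 <= z ->
      w * (w + z) `^ (r - 2) <= w `^ (r - 2) * w.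
    rewrite le_eqVlt => /predU1P[<-|w0 z0]; first by rewrite mul0r mulr0.
    by rewrite mulrC ler_wpM2r ?(ltW w0)//; apply: ler_powRN => //; lra.
  have h1 := main _ _ u0 v0; have h2 := main _ _ v0 u0.
  rewrite (addrC u) in h1.
  have uv : 0 <= v + u by lra.
  have h3 : (v + u) * (v + u) `^ (r - 2) <=
      v `^ (r - 2) * v + u `^ (r - 2) * u by lra.
  apply: le_trans (ler_wpM2r uv h3).
  have -> : (v + u) * (v + u) `^ (r - 2) * (v + u) =
            1 * ((v + u) ^+ 2 * (v + u) `^ (r - 2)) by ring.
  by rewrite ler_wpM2r// mulr_ge0 ?sqr_ge0 ?powR_ge0.
have [x0|x0] := leP 0 x; have [y0|y0] := leP 0 y.
- rewrite (ger0_norm x0) (ger0_norm y0).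
  have [xy|xy] := leP x y; last exact: same (ltW xy).
  by have := same _ _ x0 xy; rewrite (addrC y x); congr (_ <= _); ring.
- rewrite (ger0_norm x0) (ltr0_norm y0).
  have := opp (- y) x; rewrite oppr_ge0 (ltW y0) x0 => /(_ isT isT).
  by congr (_ <= _); ring.
- rewrite (ger0_norm y0) (ltr0_norm x0).
  have := opp (- x) y; rewrite oppr_ge0 (ltW x0) y0 => /(_ isT isT).
  by rewrite (addrC y (- x)); congr (_ <= _); ring.
- rewrite (ltr0_norm x0) (ltr0_norm y0).
  have [xy|xy] := leP x y.
    have := same (- y) (- x); rewrite oppr_ge0 lerN2 (ltW y0) xy => /(_ isT isT).
    by congr (_ <= _); ring.
  have := same (- x) (- y); rewrite oppr_ge0 lerN2 (ltW x0) (ltW xy).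
  by move=> /(_ isT isT); rewrite (addrC (- y) (- x)); congr (_ <= _); ring.
Qed.

(** Young's inequality for |s| and |t|^(r-1) with the exponents r and r / (r - 1). The difference of
    the two sides is the Bregman divergence of |.|^r / r from [t] to [s], since [t] times the
    derivative at [t] is |t|^r. *)
Lemma young_powR r s t : 1 < r ->
  `|t| `^ (r - 2) * t * s <= `|s| `^ r / r + `|t| `^ r * (1 - r^-1).
Proof.
move=> r1; have r0 : 0 < r by lra.
have r10 : 0 < r - 1 by lra.
have rr0 : 0 < 1 - r^-1.
  by rewrite subr_gt0 invf_lt1.
have := @conjugate_powR R `|s| (`|t| `^ (r - 1)) r (1 - r^-1)^-1.
rewrite !powR_ge0 !invrK invr_gt0 rr0 r0 normr_ge0 => /(_ isT isT isT isT).
have -> : r^-1 + (1 - r^-1) = 1 by lra.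
move=> /(_ erefl); rewrite -powRrM.
have -> : (r - 1) / (1 - r^-1) = r.
  by field; rewrite !gt_eqF.
apply: le_trans; rewrite -(@normr_powRM (r - 1))//.
have -> : r - 1 - 1 = r - 2 by lra.
apply: (le_trans (ler_norm _)).
by rewrite !normrM (ger0_norm (powR_ge0 _ _)) mulrC.
Qed.

(* The midpoint [m] of [s] and [t] makes a second-order Taylor expansion
   unnecessary: the divergence from [t] to [s] dominates
   [(phi' m - phi' t) (s - m)]. *)
Lemma bregman_powR r s t : 1 < r -> r <= 2 ->
  (r - 1) / 8 * ((s - t) ^+ 2 * (`|s| + `|t|) `^ (r - 2)) <=
  `|s| `^ r / r + `|t| `^ r * (1 - r^-1) - `|t| `^ (r - 2) * t * s.
Proof.
move=> r1 r2; have [->|st] := eqVneq s t.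
  by have := young_powR t t r1; rewrite subrr; lra.
pose m := (s + t) / 2.
have r0 : 0 < r by lra.
have E (w : R) : `|w| `^ r = `|w| `^ (r - 2) * w * w.
  rewrite -mulrA -expr2 -real_normK ?num_real// -normr_powRM//.
  rewrite -(@normr_powRM (r - 1)); last by lra.
  by rewrite (_ : r - 1 - 1 = r - 2) ?expr2 ?mulrA//; lra.
(* Three-point identity: the divergence from [t] to [s] is that from [m] to [s], plus that from [t]
   to [m], plus the monotonicity term of [h3], as s - m = m - t. By [h1] and [h2] the first two are
   nonnegative. *)
have h1 := young_powR s m r1; have h2 := young_powR m t r1.
have h3 := powR_sub_monotone m t r1 r2.
rewrite (_ : m - t = (s - t) / 2) in h3; last by rewrite /m; lra.
have ts : 0 < `|s| + `|t|.
  rewrite lt_neqAle addr_ge0// andbT eq_sym; apply: contra st.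
  by rewrite paddr_eq0// !normr_eq0 => /andP[/eqP-> /eqP->].
have mt : 0 < `|m| + `|t|.
  rewrite lt_neqAle addr_ge0// andbT eq_sym; apply: contra st.
  rewrite paddr_eq0// !normr_eq0 => /andP[/eqP m0 /eqP t0].
  by rewrite /m in m0; apply/eqP; lra.
have mst : `|m| + `|t| <= 2 * (`|s| + `|t|).
  have : `|m| <= (`|s| + `|t|) / 2.
    by rewrite /m normrM [`|2^-1|]ger0_norm// ler_wpM2r// ler_normD.
  have := normr_ge0 s; have := normr_ge0 t; lra.
(* The factor 2^(r-2) is at least 1/2 since r > 1. Together with (m - t)^2 = (s - t)^2 / 4 this
   gives the 8 of the statement. *)
have h4 : 2^-1 * (`|s| + `|t|) `^ (r - 2) <= (`|m| + `|t|) `^ (r - 2).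
  apply: (@le_trans _ _ ((2 * (`|s| + `|t|)) `^ (r - 2))); last first.
    by apply: ler_powRN => //; lra.
  rewrite powRM ?(ltW ts)// ler_wpM2r ?powR_ge0// -[2^-1]powR_inv1//.
  by apply: ler_powR; [rewrite ler1n|lra].
have h5 : (r - 1) * ((s - t) / 2) ^+ 2 * (2^-1 * (`|s| + `|t|) `^ (r - 2)) <=
    (r - 1) * ((s - t) / 2) ^+ 2 * (`|m| + `|t|) `^ (r - 2).
  by rewrite ler_wpM2l// mulr_ge0 ?sqr_ge0//; lra.
move: h1 h2 h3 h5; rewrite !E.
have ms : s = 2 * m - t by rewrite /m; lra.
rewrite ms; set A := `|m| `^ _; set B := `|t| `^ _; set C := `|_ - t| `^ _.
nra.
Qed.

(* [(1 + x) `^ (- q) = expR (- q * ln (1 + x)) >= 1 - q * x]. *)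
Lemma powR_add1_le q x : 0 < q -> `|x| <= (2 * q)^-1 -> -1 < x ->
  (1 + x) `^ q <= 1 + q * x + 2 * q ^+ 2 * x ^+ 2.
Proof.
move=> q0 xq x1.
have qx : `|q * x| <= 2^-1.
  rewrite normrM gtr0_norm//; move: xq; rewrite invfM => xq.
  have := ler_wpM2l (ltW q0) xq; rewrite mulrCA mulfV ?gt_eqF// mulr1.
  by [].
have [qx1 qx2] : -2^-1 <= q * x /\ q * x <= 2^-1 by apply/andP; rewrite -ler_norml.
have x10 : 0 < 1 + x by lra.
have h : 1 - q * x <= (1 + x) `^ (- q).
  rewrite /powR gt_eqF// mulNr.
  have := expR_ge1Dx (- (q * ln (1 + x))); apply: le_trans.
  have := le_ln1Dx x1 => /(ler_wpM2l (ltW q0)); lra.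
have h2 : (1 + x) `^ q <= (1 - q * x)^-1.
  rewrite -[leLHS]invrK -powRN lef_pV2// ?posrE ?powR_gt0//; lra.
apply: (le_trans h2); rewrite -[leLHS]mul1r ler_pdivrMr; last by lra.
(* What remains is 1 <= (1 - z) (1 + z + 2 z^2) = 1 + z^2 (1 - 2 z). *)
set z := q * x in qx qx1 qx2 *.
have -> : 2 * q ^+ 2 * x ^+ 2 = 2 * z ^+ 2 by rewrite /z; ring.
nra.
Qed.

Lemma powR_split2 q x : 2 < q -> `|x| `^ q = `|x| `^ (q - 2) * x ^+ 2.
Proof.
move=> q2; rewrite -(@normr_powRM q); last by lra.
rewrite -(@normr_powRM (q - 1)); last by lra.
rewrite (_ : q - 1 - 1 = q - 2); last by lra.
by rewrite -mulrA -expr2 real_normK ?num_real.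
Qed.

(** The first term serves the regime 2 q |b| <= |a|. In the opposite regime |a + b|^q and the linear
    term are both absorbed by |b|^q, at the cost of the second and third terms. *)
Definition taylor_const q : R :=
  2 * q ^+ 2 + (2 * q + 1) `^ q + q * (2 * q) `^ (q - 1).

(** The remainder has the form |a|^(q-2) b^2 + |b|^q so that it is integrable for a and b in L^q,
    and is O(t^2) when b is replaced by t b with |t| <= 1. *)
Lemma powR_taylor q a b : 2 < q ->
  `|a + b| `^ q <= `|a| `^ q + q * (`|a| `^ (q - 2) * a * b) +
     taylor_const q * (`|a| `^ (q - 2) * b ^+ 2 + `|b| `^ q).
Proof.
move=> q2; have q0 : 0 < q by lra.
set A := `|a| `^ (q - 2) * b ^+ 2; set B := `|b| `^ q.
have A0 : 0 <= A by rewrite mulr_ge0 ?powR_ge0 ?sqr_ge0.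
have B0 : 0 <= B by rewrite powR_ge0.
have C1 : 0 <= (2 * q + 1) `^ q by rewrite powR_ge0.
have C2 : 0 <= q * (2 * q) `^ (q - 1) by rewrite mulr_ge0 ?powR_ge0 ?ltW.
have [ab|ab] := boolP ((a != 0) && (2 * q * `|b| <= `|a|)).
  have /andP[a0 {}ab] := ab.
  have na0 : 0 < `|a| by rewrite normr_gt0.
  have xq : `|b / a| <= (2 * q)^-1.
    rewrite normrM normfV ler_pdivrMr// mulrC ler_pdivlMr; last by lra.
    by rewrite mulrC.
  have q21 : (2 * q)^-1 < 1 by rewrite invf_lt1; lra.
  have x1 : -1 < b / a.
    by have := le_lt_trans xq q21; rewrite ltr_norml => /andP[].
  have := powR_add1_le q0 xq x1 => /(ler_wpM2l (powR_ge0 `|a| q)).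
  have -> : `|a + b| `^ q = `|a| `^ q * (1 + b / a) `^ q.
    rewrite -powRM//; last by lra.
    congr (_ `^ _); rewrite -[X in _ * X]ger0_norm; last by lra.
    by rewrite -normrM mulrDr mulr1 mulrCA mulfV// mulr1.
  move=> /le_trans; apply.
  rewrite powR_split2//.
  have -> : `|a| `^ (q - 2) * a ^+ 2 *
      (1 + q * (b / a) + 2 * q ^+ 2 * (b / a) ^+ 2) =
      `|a| `^ (q - 2) * a ^+ 2 + q * (`|a| `^ (q - 2) * a * b) + 2 * q ^+ 2 * A.
    by rewrite /A; field.
  rewrite lerD2l /taylor_const.
  have : 0 <= q ^+ 2 by rewrite sqr_ge0.
  nra.
have {}ab : `|a| <= 2 * q * `|b|.
  move: ab; rewrite negb_and negbK => /orP[/eqP->|]; last by rewrite -ltNge => /ltW.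
  by rewrite normr0 mulr_ge0// ltW// mulr_gt0.
have h1 : `|a + b| `^ q <= (2 * q + 1) `^ q * B.
  rewrite -powRM ?normr_ge0//; last by lra.
  apply: ge0_ler_powR; rewrite ?nnegrE ?mulr_ge0//; [by lra|by lra|].
  by have := ler_normD a b; lra.
have h2 : Num.norm (`|a| `^ (q - 2) * a * b) <= (2 * q) `^ (q - 1) * B.
  rewrite !normrM (ger0_norm (powR_ge0 _ _)).
  have -> : q - 2 = q - 1 - 1 by lra.
  rewrite normr_powRM; last by lra.
  rewrite /B -(@normr_powRM q)// mulrA ler_wpM2r//.
  rewrite -powRM//; last by lra.
  by apply: ge0_ler_powR; rewrite ?nnegrE ?mulr_ge0//; lra.
have h3 : 0 <= `|a| `^ q by rewrite powR_ge0.
have := lerNnormlW h2 => /(ler_wpM2l (ltW q0)).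
rewrite /taylor_const.
have : 0 <= q ^+ 2 by rewrite sqr_ge0.
nra.
Qed.

Lemma powRD_le r a b : 0 <= r -> 0 <= a -> 0 <= b ->
  (a + b) `^ r <= 2 `^ r * (a `^ r + b `^ r).
Proof.
move=> r0 a0 b0.
have : (a + b) `^ r <= (2 * Num.max a b) `^ r.
  apply: ge0_ler_powR; rewrite ?nnegrE ?mulr_ge0 ?addr_ge0// ?le_max ?a0//.
  by case: (leP a b) => h; lra.
move=> /le_trans; apply; rewrite powRM ?le_max ?a0//.
rewrite ler_wpM2l ?powR_ge0//.
have := powR_ge0 a r; have := powR_ge0 b r; case: (leP a b); lra.
Qed.

(* The two terms are for [d > e * m] and [d <= e * m] respectively. *)
Lemma powR_interpolate r d m e : 0 < r -> r <= 2 -> 0 <= d -> d <= m -> 0 < e ->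
  d `^ r <= e `^ (r - 2) * (d ^+ 2 * m `^ (r - 2)) + e `^ r * m `^ r.
Proof.
move=> r0 r2 d0 dm e0; have m0 := le_trans d0 dm.
have [dem|dem] := leP d (e * m).
  rewrite -[leLHS]add0r lerD//.
    by rewrite !mulr_ge0 ?powR_ge0 ?sqr_ge0.
  by rewrite -powRM ?(ltW e0)//; apply: ge0_ler_powR; rewrite ?nnegrE ?mulr_ge0 ?(ltW e0) ?(ltW r0).
have {}d0 : 0 < d by rewrite (le_lt_trans _ dem)// mulr_ge0// ltW.
have {}m0 : 0 < m by exact: lt_le_trans dm.
rewrite -[leLHS]addr0 lerD ?mulr_ge0 ?powR_ge0//.
rewrite mulrCA -powRM ?(ltW e0) ?(ltW m0)// -powR_mulrn ?(ltW d0)//.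
have -> : d `^ r = d `^ 2%:R * d `^ (r - 2).
  rewrite -powRD; first by congr (_ `^ _); lra.
  by rewrite (gt_eqF d0) implybT.
rewrite ler_wpM2l ?powR_ge0// ler_powRN ?mulr_gt0//; last exact: ltW.
by lra.
Qed.

End real_inequalities.

(** * Smooth functions *)

Section smooth_functions.
Context {R : realType} {n : nat}.
Local Notation E := 'rV[R]_n.
Implicit Types (f g : E -> R) (i : 'I_n) (k : nat).

Lemma CkS k f : Ck k.+1 f -> Ck k f.
Proof.
elim: k f => [|k IH] f [cf h]; first by split.
by split => // i; have [dfi Cfi] := h i; split => //; exact: IH.
Qed.

Lemma Ck_partial k i f : Ck k.+1 f -> Ck k (partial i f).
Proof. by case=> _ /(_ i)[]. Qed.

Lemma Ck_derivable k i f x : Ck k.+1 f -> derivable f x (delta_mx ord0 i).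
Proof. by case=> _ /(_ i)[]. Qed.

Lemma derivable_addf f g (x v : E) : derivable f x v -> derivable g x v ->
  derivable (fun y => f y + g y) x v.
Proof. by move=> df dg; exact: (derivableD df dg). Qed.

Lemma derivable_mulf f g (x v : E) : derivable f x v -> derivable g x v ->
  derivable (fun y => f y * g y) x v.
Proof. by move=> df dg; exact: (derivableM df dg). Qed.

Lemma partialD i f g x : derivable f x (delta_mx ord0 i) ->
  derivable g x (delta_mx ord0 i) ->
  partial i (fun y => f y + g y) x = partial i f x + partial i g x.
Proof. by move=> df dg; rewrite /partial (deriveD df dg). Qed.

Lemma partialM i f g x : derivable f x (delta_mx ord0 i) ->
  derivable g x (delta_mx ord0 i) ->
  partial i (fun y => f y * g y) x = f x * partial i g x + g x * partial i f x.
Proof. by move=> df dg; rewrite /partial (deriveM df dg). Qed.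

Lemma partialV i f x : f x != 0 -> derivable f x (delta_mx ord0 i) ->
  partial i (fun y => (f y)^-1) x = - (f x)^-1 ^+ 2 * partial i f x.
Proof.
by move=> fx0 df; rewrite /partial (deriveV fx0 df) exprVn.
Qed.

Lemma partial_cst i (c : R) : partial i (fun _ : E => c) = fun=> 0.
Proof. by apply/funext => x; rewrite /partial derive_cst. Qed.

Lemma Ck_cst k (c : R) : Ck k (fun _ : E => c).
Proof.
elim: k c => [|k IH] c; split => //; try exact: cst_continuous.
move=> i; split; first by move=> x; exact: derivable_cst.
by rewrite partial_cst; exact: IH.
Qed.

Lemma CkD k f g : Ck k f -> Ck k g -> Ck k (fun x => f x + g x).
Proof.
elim: k f g => [|k IH] f g [cf hf] [cg hg].
  by split => // x; exact: (cvgD (cf x) (cg x)).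
split; first by move=> x; exact: (cvgD (cf x) (cg x)).
move=> i; have [df Cf] := hf i; have [dg Cg] := hg i; split.
  by move=> x; apply: derivableD.
rewrite (_ : partial i _ = fun x => partial i f x + partial i g x).
  exact: IH.
by apply/funext => x; rewrite partialD.
Qed.

Lemma CkM k f g : Ck k f -> Ck k g -> Ck k (fun x => f x * g x).
Proof.
elim: k f g => [|k IH] f g Cf Cg.
  by split => // x; exact: (cvgM (Cf.1 x) (Cg.1 x)).
split; first by move=> x; exact: (cvgM (Cf.1 x) (Cg.1 x)).
move=> i; split.
  by move=> x; apply: derivableM; apply: Ck_derivable; eassumption.
rewrite (_ : partial i _ =
    fun x => f x * partial i g x + g x * partial i f x).
  by apply: CkD; apply: IH; (try exact: CkS); exact: Ck_partial.
by apply/funext => x; rewrite partialM//; apply: Ck_derivable; eassumption.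
Qed.

(** The induction keeps [f] fixed, since the derivative of 1 / f contains 1 / f again. *)
Lemma CkV k f : (forall x, f x != 0) -> Ck k f -> Ck k (fun x => (f x)^-1).
Proof.
move=> f0; elim: k => [|k IH] Cf.
  by split => // x; exact: (cvgV (f0 x) (Cf.1 x)).
split; first by move=> x; exact: (cvgV (f0 x) (Cf.1 x)).
move=> i; split.
  by move=> x; apply: derivableV; [exact: f0|apply: Ck_derivable; eassumption].
rewrite (_ : partial i _ =
    fun x => ((fun=> -1) x * ((f x)^-1 * (f x)^-1)) * partial i f x).
  apply: CkM; last exact: Ck_partial.
  apply: CkM; first exact: Ck_cst.
  by apply: CkM; apply: IH; exact: CkS.
apply/funext => x; rewrite partialV ?expr2 ?mulN1r//.
by apply: Ck_derivable; eassumption.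
Qed.

Lemma Ck_scale k (c : R) f : Ck k f -> Ck k (fun x => c * f x).
Proof. by move=> Cf; apply: (@CkM k (fun=> c)) => //; exact: Ck_cst. Qed.

Section test_functions.
Variable Omega : set E.
Implicit Types phi psi : E -> R.

Lemma test_continuous phi : test_function Omega phi -> continuous phi.
Proof. by case=> /(_ 0%N)[]. Qed.

Lemma test_derivable phi i x : test_function Omega phi ->
  derivable phi x (delta_mx ord0 i).
Proof. by case=> /(_ 1%N)[_ /(_ i)[]]. Qed.

Lemma test_out phi x : test_function Omega phi -> ~ Omega x -> phi x = 0.
Proof. by move=> [_ [K [_ KO h]]] Ox; apply: h => /KO. Qed.

(** The complement of the compact support is open, so the derivative vanishes there too. *)
Lemma test_partial phi i : test_function Omega phi ->
  test_function Omega (partial i phi).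
Proof.
move=> [Cphi [K [cK KO phi0]]]; split.
  by move=> k; exact: Ck_partial (Cphi k.+1).
exists K; split => // x Kx.
have oK : open (~` K).
  by apply: closed_openC; apply: compact_closed => //; exact: norm_hausdorff.
rewrite /partial (@near_eq_derive _ _ _ _ (cst 0)) ?derive_cst//.
  have : nbhs x (~` K) by exact: open_nbhs_nbhs.
  by apply: filterS => y Ky; rewrite phi0.
Qed.

End test_functions.
End smooth_functions.

(** * Integration by parts *)

Section integration_by_parts.
Context {R : realType}.

Lemma continuous_measurable_rV n (f : 'rV[R]_n -> R) (D : set 'rV[R]_n) :
  continuous f -> measurable D -> measurable_fun D f.
Proof.
move=> cf mD; apply: (@measurable_funS _ _ _ _ setT) => //.
apply: (measurability _ (RGenOpens.measurableE R)).
move=> _ [_ [a [b ->] <-]]; rewrite setTI; apply: open_measurable_rV.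
by apply: open_comp; [move=> x _; exact: cf|exact: interval_open].
Qed.

Lemma measurable_box n (a b : 'rV[R]_n) :
  measurable [set x : 'rV[R]_n | forall i, a ord0 i <= x ord0 i <= b ord0 i].
Proof.
rewrite (_ : mkset _ = \bigcap_(i in [set: 'I_n])
    ((fun x : 'rV[R]_n => x ord0 i) @^-1` `[a ord0 i, b ord0 i])); last first.
  apply/seteqP; split => x /= h i; first by rewrite /= in_itv; move=> _; exact: h.
  by have := h i Logic.I; rewrite /= in_itv.
apply: fin_bigcap_measurable => // i _; rewrite -[X in measurable X]setTI.
exact: (@measurable_coord_rV R n i measurableT _ (measurable_itv _)).
Qed.

Lemma lebesgue_rV_bounded n (M : R) : 0 <= M ->
  exists B : set 'rV[R]_n, [/\ measurable B, (lebesgue_rV R n B < +oo)%E &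
    forall x : 'rV[R]_n, (forall i, `|x ord0 i| <= M) -> B x].
Proof.
move=> M0; exists [set x | forall i, (const_mx (- M) : 'rV_n) ord0 i <= x ord0 i
                              <= (const_mx M : 'rV_n) ord0 i]; split.
- exact: measurable_box.
- by rewrite lebesgue_rV_box ?ltry// => i; rewrite !mxE; lra.
- by move=> x xM i; rewrite !mxE -ler_norml.
Qed.

Lemma integrable_bounded_support n (D : set 'rV[R]_n) (h : 'rV[R]_n -> R) (C M : R) :
  measurable D -> measurable_fun D h -> 0 <= M ->
  (forall x, `|h x| <= C) ->
  (forall x : 'rV[R]_n, (exists i, M < `|x ord0 i|) -> h x = 0) ->
  (lebesgue_rV R n).-integrable D (EFin \o h).
Proof.
move=> mD mh M0 hC hM.
have [B [mB Boo hB]] := lebesgue_rV_bounded n M0.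
apply: (@le_integrable _ _ _ _ _ _ _ (fun x => (C * \1_B x)%:E)) => //.
- exact/measurable_EFinP.
- move=> x _ /=; rewrite lee_fin.
  have C0 : 0 <= C by exact: le_trans (hC x).
  have [xB|xB] := pselect (forall i, `|x ord0 i| <= M).
    by rewrite indicE mem_set ?mulr1 ?(ger0_norm C0)//; exact: hB.
  rewrite hM ?normr0 ?normr_ge0//.
  by move: xB => /existsNP[i]/negP; rewrite -ltNge => ?; exists i.
apply: (@integrableZl _ _ _ _ _ mD C (fun x => (\1_B x)%:E)).
apply: (@integrableS _ _ _ _ setT) => //.
apply/integrableP; split.
  exact/measurable_EFinP/measurable_indic.
under eq_integral do rewrite /= ger0_norm//.
by rewrite integral_indic// setIT.
Qed.

Lemma integral_derive_compact_support (h : R -> R) (M : R) :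
  (forall x, derivable h x 1) -> continuous ('D_1 h) ->
  (forall x, M < `|x| -> h x = 0) ->
  (\int[lebesgue_measure]_x ('D_1 h x)%:E = 0)%E.
Proof.
move=> dh ch hM.
(* [N] is strictly larger than [M], so that [h] vanishes in a neighbourhood of every point with N <=
   |x| and its derivative vanishes there as well. *)
pose N := `|M| + 1; have N0 : 0 < N by rewrite /N; have := normr_ge0 M; lra.
have MN : M < N by rewrite /N; have := ler_norm M; lra.
have h'0 x : N <= `|x| -> 'D_1 h x = 0.
  move=> xN; rewrite (@near_eq_derive _ _ _ _ (cst 0)) ?derive_cst//.
  have : (fun y : R => `|y|) @ x --> `|x| by exact: norm_continuous.
  move=> /cvgr_gt/(_ M (lt_le_trans MN xN)).
  by apply: filterS => y; exact: hM.
rewrite (_ : (fun x => _) = (EFin \o 'D_1 h) \_ `[- N, N]); last first.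
  apply/funext => x; rewrite patchE; case: ifPn => //.
  move=> /negP; rewrite inE /= in_itv /= => /negP; rewrite -ler_norml -ltNge.
  by move=> /ltW/h'0 ->.
rewrite -integral_mkcond.
have ch0 : continuous h.
  by move=> x; exact/differentiable_continuous/derivable1_diffP.
have NN : - N < N by lra.
rewrite (@continuous_FTC2 _ ('D_1 h) h _ _ NN).
- have h0 y : `|y| = N -> h y = 0 by move=> yN; rewrite hM ?yN.
  by rewrite !h0 ?normrN ?gtr0_norm// subee.
- exact: continuous_subspaceT.
- split => //; first by apply: cvg_at_right_filter; exact: ch0.
  by apply: cvg_at_left_filter; exact: ch0.
- by move=> x _; rewrite derive1E.
Qed.

Lemma rV_cons_continuous1 n (y : 'rV[R]_n) :
  continuous (fun t : R => rV_cons (t, y)).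
Proof.
move=> t U /nbhs_ballP[e /= e0 eU]; apply/nbhs_ballP; exists e => //= s ts.
apply: eU; split => // i j; rewrite ord1 !mxE.
by case: unliftP => //= j' _; exact: ballxx.
Qed.

Lemma rV_cons_continuous2 n (t : R) :
  continuous (fun y : 'rV[R]_n => rV_cons (t, y)).
Proof.
move=> y U /nbhs_ballP[e /= e0 eU]; apply/nbhs_ballP; exists e => //= z [_ yz].
apply: eU; split => // i j; rewrite ord1 !mxE.
by case: unliftP => /= [j' _|_]; [exact: yz|exact: ballxx].
Qed.

Lemma rV_cons_shift0 n (h t : R) (y : 'rV[R]_n) :
  h *: (delta_mx ord0 ord0 : 'rV[R]_n.+1) + rV_cons (t, y) = rV_cons (h *: (1 : R) + t, y).
Proof.
apply/rowP => j; rewrite !mxE eqxx /=.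
case: unliftP => [j' ->|->]; rewrite /= ?mulr0 ?add0r//.
Qed.

Lemma rV_cons_shiftS n (h t : R) (y : 'rV[R]_n) i :
  h *: (delta_mx ord0 (lift ord0 i) : 'rV[R]_n.+1) + rV_cons (t, y) =
  rV_cons (t, h *: delta_mx ord0 i + y).
Proof.
apply/rowP => j; rewrite !mxE eqxx /=.
case: unliftP => [j' ->|->]; rewrite /= ?mxE ?eqxx/=.
  by rewrite (inj_eq (@lift_inj _ ord0)).
by rewrite mulr0 add0r.
Qed.

(** The difference quotients are identified as functions, so that both the existence and the value
    of the derivatives transfer. *)
Lemma growth_rate_cons0 n (chi : 'rV[R]_n.+1 -> R) (t : R) (y : 'rV[R]_n) :
  (fun h : R => h^-1 *: ((chi \o shift (rV_cons (t, y)))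
     (h *: delta_mx ord0 ord0) - chi (rV_cons (t, y)))) =
  (fun h : R => h^-1 *: (((fun s : R => chi (rV_cons (s, y))) \o shift t)
     (h *: (1 : R)) - chi (rV_cons (t, y)))).
Proof. by apply/funext => h /=; rewrite rV_cons_shift0. Qed.

Lemma growth_rate_consS n (chi : 'rV[R]_n.+1 -> R) (t : R) (y : 'rV[R]_n) i :
  (fun h : R => h^-1 *: ((chi \o shift (rV_cons (t, y)))
     (h *: delta_mx ord0 (lift ord0 i)) - chi (rV_cons (t, y)))) =
  (fun h : R => h^-1 *: (((fun z : 'rV[R]_n => chi (rV_cons (t, z))) \o shift y)
     (h *: delta_mx ord0 i) - chi (rV_cons (t, y)))).
Proof. by apply/funext => h /=; rewrite rV_cons_shiftS. Qed.

Lemma derive_cons0 n (chi : 'rV[R]_n.+1 -> R) (t : R) (y : 'rV[R]_n) :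
  'D_(delta_mx ord0 ord0) chi (rV_cons (t, y)) =
  'D_1 (fun s : R => chi (rV_cons (s, y))) t.
Proof. by rewrite /derive growth_rate_cons0. Qed.

Lemma derivable_cons0 n (chi : 'rV[R]_n.+1 -> R) (t : R) (y : 'rV[R]_n) :
  derivable chi (rV_cons (t, y)) (delta_mx ord0 ord0) ->
  derivable (fun s : R => chi (rV_cons (s, y))) t 1.
Proof. by rewrite /derivable growth_rate_cons0. Qed.

Lemma derive_consS n (chi : 'rV[R]_n.+1 -> R) (t : R) (y : 'rV[R]_n) i :
  'D_(delta_mx ord0 (lift ord0 i)) chi (rV_cons (t, y)) =
  'D_(delta_mx ord0 i) (fun z : 'rV[R]_n => chi (rV_cons (t, z))) y.
Proof. by rewrite /derive growth_rate_consS. Qed.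

Lemma derivable_consS n (chi : 'rV[R]_n.+1 -> R) (t : R) (y : 'rV[R]_n) i :
  derivable chi (rV_cons (t, y)) (delta_mx ord0 (lift ord0 i)) ->
  derivable (fun z : 'rV[R]_n => chi (rV_cons (t, z))) y (delta_mx ord0 i).
Proof. by rewrite /derivable growth_rate_consS. Qed.

(* Induction on the dimension along the recursive definition of [lebesgue_rV]. *)
Lemma integral_partial_eq0 n (chi : 'rV[R]_n -> R) (i : 'I_n) (C M : R) :
  (forall x, derivable chi x (delta_mx ord0 i)) ->
  continuous (partial i chi) -> 0 <= M ->
  (forall x : 'rV[R]_n, (exists j, M < `|x ord0 j|) -> chi x = 0) ->
  (forall x : 'rV[R]_n, (exists j, M < `|x ord0 j|) -> partial i chi x = 0) ->
  (forall x, `|partial i chi x| <= C) ->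
  (\int[lebesgue_rV R n]_x (partial i chi x)%:E = 0)%E.
Proof.
elim: n chi i => [chi []//|n IHn] chi i dchi cchi M0 chi0 dchi0 chiC.
pose f := EFin \o partial i chi.
have intf : (lebesgue_rV R n.+1).-integrable setT f.
  apply: (@integrable_bounded_support _ _ _ C M) => //.
  exact: continuous_measurable_rV.
have mf : measurable_fun setT f by exact: measurable_int intf.
have mc := @measurable_rV_cons R n.
have intfc : (lebesgue_measure \x lebesgue_rV R n)%E.-integrable setT
    (f \o @rV_cons R n).
  apply/integrableP; split; first exact: measurableT_comp.
  have /integrableP[_] := intf; apply: le_lt_trans.
  rewrite /= ge0_integral_pushforward//.
  by apply/measurable_EFinP; apply: measurableT_comp => //; exact/measurable_EFinP.
transitivity (\int[lebesgue_measure \x lebesgue_rV R n]_z (f \o @rV_cons R n) z)%E.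
  by rewrite /= integral_pushforward.
(* Fubini is applied in the order for which the inner integral contains the variable of
   differentiation. The inner integral then vanishes, by the induction hypothesis or by the
   one-dimensional lemma. *)
case: (unliftP ord0 i) => [j ij|i0].
  rewrite -integral12_prod_meas1//; apply: integral0_eq => t _.
  rewrite /fubini_F /=.
  rewrite /f ij /partial /=.
  under eq_integral do rewrite derive_consS.
  apply: (IHn (fun z => chi (rV_cons (t, z)))) => //.
  - by move=> z; apply: derivable_consS; rewrite -ij.
  - rewrite (_ : partial j _ = partial i chi \o (fun z => rV_cons (t, z))).
      move=> z; apply: continuous_comp; first exact: rV_cons_continuous2.
      exact: cchi.
    by apply/funext => z /=; rewrite /partial ij derive_consS.
  - move=> z [k zk]; apply: chi0; exists (lift ord0 k).
    by rewrite rV_consS.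
  - move=> z [k zk]; rewrite /partial -derive_consS -ij.
    by apply: dchi0; exists (lift ord0 k); rewrite rV_consS.
  - by move=> z; rewrite /partial -derive_consS -ij; exact: chiC.
rewrite -integral21_prod_meas1//; apply: integral0_eq => y _.
rewrite /fubini_G /= /f i0 /partial /=.
under eq_integral do rewrite derive_cons0.
apply: (@integral_derive_compact_support _ M).
- by move=> t; apply: derivable_cons0; rewrite -i0.
- rewrite (_ : 'D_(1 : R^o) _ = partial i chi \o (fun t => rV_cons (t, y))).
    move=> z; apply: continuous_comp; first exact: rV_cons_continuous1.
    exact: cchi.
  by apply/funext => z /=; rewrite /partial i0 derive_cons0.
- by move=> t tM; apply: chi0; exists ord0; rewrite rV_cons0.
Qed.

End integration_by_parts.

(** * Integrals of real functions *)

Section real_integrals.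
Context d (T : measurableType d) (R : realType) (mu : {measure set T -> \bar R}).
Variables (D : set T) (mD : measurable D).
Implicit Types f g h : T -> R.
Local Notation integrable f := (mu.-integrable D (EFin \o f)).

Lemma integrable_measurable f : integrable f -> measurable_fun D f.
Proof. by move=> /measurable_int/measurable_EFinP. Qed.

Lemma le_integrableR f g : measurable_fun D f ->
  (forall x, D x -> `|f x| <= g x) -> integrable g -> integrable f.
Proof.
move=> mf fg; apply: le_integrable => //; first exact/measurable_EFinP.
move=> x Dx; rewrite /= lee_fin; apply: (le_trans (fg _ Dx)).
exact: ler_norm.
Qed.

Lemma integrableDR f g : integrable f -> integrable g ->
  integrable (fun x => f x + g x).
Proof. by move=> fi gi; exact: (integrableD mD fi gi). Qed.

Lemma integrableBR f g : integrable f -> integrable g ->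
  integrable (fun x => f x - g x).
Proof. by move=> fi gi; exact: (integrableB mD fi gi). Qed.

Lemma integrableZR (c : R) f : integrable f -> integrable (fun x => c * f x).
Proof. by move=> fi; exact: (integrableZl mD c fi). Qed.

Lemma integrableP_ge0 f : measurable_fun D f -> (forall x, D x -> 0 <= f x) ->
  integrable f <-> (\int[mu]_(x in D) (f x)%:E < +oo)%E.
Proof.
move=> mf f0; rewrite (_ : (\int[mu]_(x in D) (f x)%:E =
    \int[mu]_(x in D) `|(EFin \o f) x|)%E); last first.
  by apply: eq_integral => x /[!inE] Dx; rewrite /= ger0_norm ?f0.
split; first by move=> /integrableP[].
by move=> ?; apply/integrableP; split => //; exact/measurable_EFinP.
Qed.

Lemma ge0_integralZ_EFin (c : R) f : 0 <= c -> (forall x, 0 <= f x) ->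
  measurable_fun D f ->
  (\int[mu]_(x in D) (c * f x)%:E = c%:E * \int[mu]_(x in D) (f x)%:E)%E.
Proof.
move=> c0 f0 mf; under eq_integral do rewrite EFinM.
rewrite ge0_integralZl//; first exact/measurable_EFinP.
by move=> x _; rewrite lee_fin.
Qed.

Lemma EFin_Rintegral f : integrable f ->
  (\int[mu]_(x in D) f x)%:E = (\int[mu]_(x in D) (f x)%:E)%E.
Proof. by move=> fi; rewrite /Rintegral fineK// integrable_fin_num. Qed.

Lemma integrable_mulL2 f g : measurable_fun D f -> measurable_fun D g ->
  integrable (fun x => f x ^+ 2) -> integrable (fun x => g x ^+ 2) ->
  integrable (fun x => f x * g x).
Proof.
move=> mf mg f2 g2.
apply: (@le_integrableR _ (fun x => f x ^+ 2 + g x ^+ 2)).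
- exact: measurable_funM.
- by move=> x _; rewrite ler_norml; apply/andP; split; nra.
- exact: integrableDR.
Qed.

Lemma Rdominated_cvg (f_ : nat -> T -> R) f h :
  (forall k, measurable_fun D (f_ k)) -> measurable_fun D f ->
  {ae mu, forall x, D x -> f_ ^~ x @ \oo --> f x} -> integrable h ->
  (forall k x, D x -> `|f_ k x| <= h x) ->
  integrable f /\ \int[mu]_(x in D) f_ k x @[k --> \oo] --> \int[mu]_(x in D) f x.
Proof.
move=> mf_ mf ff hi fh.
have /(_ _)[] := @dominated_convergence _ _ _ mu D mD (fun k => EFin \o f_ k)
  (EFin \o f) (EFin \o h) _ _ _ hi _.
- by move=> k; exact/measurable_EFinP.
- exact/measurable_EFinP.
- apply: filterS ff => x /[apply] fx; apply: cvg_EFin => //.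
  by apply: nearW.
- by apply: aeW => x k Dx; rewrite /= lee_fin fh.
move=> fi _ cv; split => //.
apply: fine_cvg; rewrite EFin_Rintegral//; exact: cv.
Qed.

(** The bounds are summable, so by monotone convergence the series of the [f_ k] is integrable,
    hence finite almost everywhere, and its terms tend to 0. *)
Lemma ae_cvg0_of_integral (f_ : nat -> T -> R) :
  (forall k, measurable_fun D (f_ k)) -> (forall k x, 0 <= f_ k x) ->
  (forall k, (\int[mu]_(x in D) (f_ k x)%:E <= (1 / (2 ^ k.+1)%:R)%:E)%E) ->
  {ae mu, forall x, D x -> f_ ^~ x @ \oo --> (0 : R)}.
Proof.
move=> mf f0 fle.
have mf' k : measurable_fun D (fun x => (f_ k x)%:E) by exact/measurable_EFinP.
pose S x := (\sum_(k <oo) (f_ k x)%:E)%E.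
have mS : measurable_fun D S.
  by apply: ge0_emeasurable_sum => // k x _ _; rewrite lee_fin.
have S0 x : (0 <= S x)%E by apply: nneseries_ge0 => k _ _; rewrite lee_fin.
have Sint : mu.-integrable D S.
  apply/integrableP; split => //.
  under eq_integral do rewrite gee0_abs//.
  rewrite integral_nneseries//; last by move=> k x _; rewrite lee_fin.
  apply: (@le_lt_trans _ _ (\sum_(k <oo) (1 / (2 ^ k.+1)%:R : R)%:E)%E).
    apply: lee_nneseries => k _; last exact: fle.
    by move=> _; apply: integral_ge0 => x _; rewrite lee_fin.
  by apply: (le_lt_trans (epsilon_trick0 _ ler01)); rewrite ltry.
have := integrable_ae mD Sint; apply: filterS => x /[apply] Sx.
have tail : (\sum_(N <= k <oo) (f_ k x)%:E)%E @[N --> \oo] --> 0%E.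
  apply: nneseries_tail_cvg => [|k _]; last by rewrite lee_fin.
  by rewrite ltey_eq Sx.
have : (f_ k x)%:E @[k --> \oo] --> 0%E.
  apply: squeeze_cvge tail; last exact: cvg_cst.
  apply: nearW => k; rewrite lee_fin f0 /=.
  have := @nneseries_lim_ge R (fun j => (f_ j x)%:E) xpredT k k.+1.
  rewrite big_nat1; apply => j _ _; by rewrite lee_fin.
by move/fine_cvg.
Qed.

End real_integrals.

(** * Square integrable vector fields *)

Section vectors.
Context {R : realType} {n : nat}.
Implicit Types x y z : 'rV[R]_n.

Definition dotv x y : R := \sum_i x ord0 i * y ord0 i.

Lemma dotvv x : dotv x x = sqnorm2 x.
Proof. by apply: eq_bigr => i _; rewrite expr2. Qed.

Lemma dotvC x y : dotv x y = dotv y x.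
Proof. by apply: eq_bigr => i _; rewrite mulrC. Qed.

Lemma dotvDl x y z : dotv (x + y) z = dotv x z + dotv y z.
Proof. by rewrite -big_split; apply: eq_bigr => i _; rewrite mxE mulrDl. Qed.

Lemma dotvZl (c : R) x y : dotv (c *: x) y = c * dotv x y.
Proof. by rewrite mulr_sumr; apply: eq_bigr => i _; rewrite mxE mulrA. Qed.

Lemma dotvDr x y z : dotv x (y + z) = dotv x y + dotv x z.
Proof. by rewrite dotvC dotvDl !(dotvC x). Qed.

Lemma dotvZr (c : R) x y : dotv x (c *: y) = c * dotv x y.
Proof. by rewrite dotvC dotvZl (dotvC x). Qed.

Lemma dotv_deltar x i : dotv x (delta_mx ord0 i) = x ord0 i.
Proof.
rewrite /dotv (bigD1 i)//= big1 ?addr0 ?mxE ?eqxx ?mulr1//.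
by move=> j ji; rewrite mxE (negbTE ji) andbF mulr0.
Qed.

Lemma sqnorm2_ge0 x : 0 <= sqnorm2 x.
Proof. by apply: sumr_ge0 => i _; rewrite sqr_ge0. Qed.

Lemma sqnorm2Z (c : R) x : sqnorm2 (c *: x) = c ^+ 2 * sqnorm2 x.
Proof. by rewrite -!dotvv dotvZl dotvZr mulrA -expr2. Qed.

Lemma sqnorm2D x y :
  sqnorm2 (x + y) = sqnorm2 x + sqnorm2 y + 2 * dotv x y.
Proof. by rewrite -!dotvv dotvDl !dotvDr (dotvC y); ring. Qed.

Lemma sqnorm2D_le x y : sqnorm2 (x + y) <= 2 * (sqnorm2 x + sqnorm2 y).
Proof.
have := sqnorm2_ge0 (x - y).
rewrite sqnorm2D sqnorm2D -scaleN1r sqnorm2Z dotvZr; lra.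
Qed.

Lemma dotv_le x y : `|dotv x y| <= sqnorm2 x + sqnorm2 y.
Proof.
have := sqnorm2_ge0 (x - y); have := sqnorm2_ge0 (x + y).
rewrite !sqnorm2D -scaleN1r sqnorm2Z dotvZr ler_norml.
have := sqnorm2_ge0 x; have := sqnorm2_ge0 y.
by move=> ? ? ? ?; apply/andP; split; lra.
Qed.

Lemma sqr_coord_le x i : x ord0 i ^+ 2 <= sqnorm2 x.
Proof.
by rewrite /sqnorm2 (bigD1 i)//= lerDl sumr_ge0// => j _; rewrite sqr_ge0.
Qed.

End vectors.

Section measurable_fields.
Context {R : realType} {n : nat} d (T : measurableType d) (D : set T).
Implicit Types g h : T -> 'rV[R]_n.

Lemma measurable_coord g i : measurable_fun D g ->
  measurable_fun D (fun x => g x ord0 i).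
Proof. by apply: (measurableT_comp (measurable_coord_rV i)). Qed.

(** Open sets are countable unions of balls, and a ball of the sup norm is a product of intervals,
    so that its preimage is a finite intersection of preimages under the coordinates. *)
Lemma measurable_fieldP g : measurable D ->
  (forall i, measurable_fun D (fun x => g x ord0 i)) -> measurable_fun D g.
Proof.
move=> mD mg.
apply: (@measurability _ _ _ _ _ _ [set U : set 'rV[R]_n | open U]) => //.
move=> _ [U oU <-]; have [c [P ->]] := open_rV_bigcup oU.
rewrite preimage_bigcup setI_bigcupr; apply: bigcup_measurable => k _.
have [e0|e0] := ltP 0 (c k).2; last first.
  rewrite (_ : _ `&` _ = set0)//; apply/seteqP; split => // p /= [_ []].
  by rewrite ltNge e0.
rewrite (_ : _ `&` _ = D `&` \bigcap_(i in [set: 'I_n])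
   (D `&` (fun x => g x ord0 i) @^-1` ball ((c k).1 ord0 i) (c k).2)).
  apply: measurableI => //.
  apply: fin_bigcap_measurable => // i _; apply: mg => //.
  by rewrite ball_itv; exact: measurable_itv.
apply/seteqP; split => [x [Dx [_ cx]]|x [Dx cx]].
  by split => // i _; split => //; exact: cx.
split => //; split => // i j; rewrite ord1.
by have [] := cx j Logic.I.
Qed.

Lemma measurable_fieldD g h : measurable D -> measurable_fun D g ->
  measurable_fun D h -> measurable_fun D (fun x => g x + h x).
Proof.
move=> mD mg mh; apply: measurable_fieldP => // i.
rewrite (_ : (fun x => _) = fun x => g x ord0 i + h x ord0 i).
  by apply: measurable_funD; exact: measurable_coord.
by apply/funext => x; rewrite mxE.
Qed.

Lemma measurable_fieldZ (a : T -> R) g : measurable D -> measurable_fun D a ->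
  measurable_fun D g -> measurable_fun D (fun x => a x *: g x).
Proof.
move=> mD ma mg; apply: measurable_fieldP => // i.
rewrite (_ : (fun x => _) = fun x => a x * g x ord0 i).
  by apply: measurable_funM => //; exact: measurable_coord.
by apply/funext => x; rewrite mxE.
Qed.

Lemma measurable_fieldB g h : measurable D -> measurable_fun D g ->
  measurable_fun D h -> measurable_fun D (fun x => g x - h x).
Proof.
move=> mD mg mh; rewrite (_ : (fun x => _) = fun x => g x + (-1 : R) *: h x).
  by apply: measurable_fieldD => //; apply: (measurable_fieldZ (a := cst (-1))).
by apply/funext => x; rewrite scaleN1r.
Qed.

Lemma measurable_dotv g h : measurable_fun D g -> measurable_fun D h ->
  measurable_fun D (fun x => dotv (g x) (h x)).
Proof.
move=> mg mh; apply: measurable_sum => i.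
by apply: measurable_funM; exact: measurable_coord.
Qed.

Lemma measurable_sqnorm2 g : measurable_fun D g ->
  measurable_fun D (fun x => sqnorm2 (g x)).
Proof.
move=> mg; under eq_fun do rewrite -dotvv; exact: measurable_dotv.
Qed.

End measurable_fields.

Section L2_fields.
Context {R : realType} {n : nat} (Omega : set 'rV[R]_n) (mO : measurable Omega).
Local Notation mu := (lebesgue_rV R n).
Implicit Types g h w : 'rV[R]_n -> 'rV[R]_n.
Implicit Types (k : nat) (gs hs : nat -> 'rV[R]_n -> 'rV[R]_n).

Definition L2field g := measurable_fun Omega g /\
  mu.-integrable Omega (EFin \o (fun x => sqnorm2 (g x))).

Definition ip g h : R := \int[mu]_(x in Omega) dotv (g x) (h x).

Lemma L2fieldP g : measurable_fun Omega g ->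
  L2field g <-> (int_sqnorm Omega g < +oo)%E.
Proof.
move=> mg; rewrite /int_sqnorm -(@integrableP_ge0 _ _ _ mu Omega (fun x => sqnorm2 (g x))).
- by split => [[]|].
- exact: measurable_sqnorm2.
- by move=> x _; exact: sqnorm2_ge0.
Qed.

Lemma int_sqnormE g : L2field g -> int_sqnorm Omega g = (ip g g)%:E.
Proof.
move=> [mg ig]; rewrite /ip; under eq_Rintegral do rewrite dotvv.
by rewrite EFin_Rintegral.
Qed.

Lemma L2fieldD g h : L2field g -> L2field h -> L2field (fun x => g x + h x).
Proof.
move=> [mg ig] [mh ih]; split; first exact: measurable_fieldD.
apply: (@le_integrableR _ _ _ _ _ mO _ (fun x => 2 * (sqnorm2 (g x) + sqnorm2 (h x)))).
- by apply: measurable_sqnorm2; exact: measurable_fieldD.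
- by move=> x _; rewrite ger0_norm ?sqnorm2_ge0// sqnorm2D_le.
- by apply: integrableZR => //; exact: integrableDR.
Qed.

Lemma L2fieldM (a : 'rV[R]_n -> R) (C : R) g : measurable_fun Omega a ->
  (forall x, Omega x -> `|a x| <= C) -> L2field g -> L2field (fun x => a x *: g x).
Proof.
move=> ma aC [mg ig].
have mag : measurable_fun Omega (fun x => a x *: g x) by exact: measurable_fieldZ.
split => //.
apply: (@le_integrableR _ _ _ _ _ mO _ (fun x => C ^+ 2 * sqnorm2 (g x))).
- exact: measurable_sqnorm2.
- move=> x Ox; rewrite ger0_norm ?sqnorm2_ge0// sqnorm2Z.
  by rewrite ler_wpM2r ?sqnorm2_ge0// -[a x ^+ 2]real_normK ?num_real// lerXn2r
    ?nnegrE ?(le_trans _ (aC _ Ox))// aC.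
- exact: integrableZR.
Qed.

Lemma L2fieldZ (c : R) g : L2field g -> L2field (fun x => c *: g x).
Proof. by apply: (@L2fieldM (cst c) `|c|) => //. Qed.

Lemma L2fieldB g h : L2field g -> L2field h -> L2field (fun x => g x - h x).
Proof.
move=> Lg /(L2fieldZ (-1)) Lh; have := L2fieldD Lg Lh.
by under eq_fun do rewrite scaleN1r.
Qed.

Lemma integrable_dotv g h : L2field g -> L2field h ->
  mu.-integrable Omega (EFin \o (fun x => dotv (g x) (h x))).
Proof.
move=> [mg ig] [mh ih].
apply: (@le_integrableR _ _ _ _ _ mO _ (fun x => sqnorm2 (g x) + sqnorm2 (h x))).
- exact: measurable_dotv.
- by move=> x _; exact: dotv_le.
- exact: integrableDR.
Qed.

Lemma ipC g h : ip g h = ip h g.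
Proof. by apply: eq_Rintegral => x _; rewrite dotvC. Qed.

Lemma ipDl g h w : L2field g -> L2field h -> L2field w ->
  ip (fun x => g x + h x) w = ip g w + ip h w.
Proof.
move=> Lg Lh Lw; rewrite /ip; under eq_Rintegral do rewrite dotvDl.
by rewrite RintegralD//; exact: integrable_dotv.
Qed.

Lemma ipZl (c : R) g h : L2field g -> L2field h ->
  ip (fun x => c *: g x) h = c * ip g h.
Proof.
move=> Lg Lh; rewrite /ip; under eq_Rintegral do rewrite dotvZl.
by rewrite RintegralZl//; exact: integrable_dotv.
Qed.

Lemma ipDr g h w : L2field g -> L2field h -> L2field w ->
  ip w (fun x => g x + h x) = ip w g + ip w h.
Proof. by move=> Lg Lh Lw; rewrite ipC ipDl// !(ipC w). Qed.

Lemma ipZr (c : R) g h : L2field g -> L2field h ->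
  ip h (fun x => c *: g x) = c * ip h g.
Proof. by move=> Lg Lh; rewrite ipC ipZl// (ipC h). Qed.

Lemma ipBl g h w : L2field g -> L2field h -> L2field w ->
  ip (fun x => g x - h x) w = ip g w - ip h w.
Proof.
move=> Lg Lh Lw; under eq_fun do rewrite -scaleN1r.
by rewrite ipDl ?ipZl ?mulN1r//; exact: L2fieldZ.
Qed.

Lemma ipBr g h w : L2field g -> L2field h -> L2field w ->
  ip w (fun x => g x - h x) = ip w g - ip w h.
Proof. by move=> Lg Lh Lw; rewrite ipC ipBl// !(ipC w). Qed.

Lemma ip_ge0 g : 0 <= ip g g.
Proof. by apply: Rintegral_ge0 => x _; rewrite dotvv sqnorm2_ge0. Qed.

Lemma ipD_sqr g h : L2field g -> L2field h ->
  ip (fun x => g x + h x) (fun x => g x + h x) = ip g g + ip h h + 2 * ip g h.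
Proof.
move=> Lg Lh; have Lgh := L2fieldD Lg Lh.
by rewrite ipDl// !ipDr// (ipC h g); ring.
Qed.

Lemma ipB_sqr g h : L2field g -> L2field h ->
  ip (fun x => g x - h x) (fun x => g x - h x) = ip g g + ip h h - 2 * ip g h.
Proof.
move=> Lg Lh; have Lgh := L2fieldB Lg Lh.
by rewrite ipBl// !ipBr// (ipC h g); ring.
Qed.

Lemma ip_cauchy g h : L2field g -> L2field h ->
  ip g h ^+ 2 <= ip g g * ip h h.
Proof.
move=> Lg Lh.
have key (t : R) : 0 <= ip g g + t ^+ 2 * ip h h + 2 * t * ip g h.
  have Lth := L2fieldZ t Lh.
  have := ip_ge0 (fun x => g x + t *: h x).
  by rewrite ipD_sqr// ipZr// ipZl// ipZr//; congr (_ <= _); ring.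
have := ip_ge0 h; rewrite le_eqVlt => /predU1P[h0|h0].
  have [->|gh] := eqVneq (ip g h) 0; first by rewrite -h0 mulr0 expr0n.
  (* When [ip h h = 0] the quadratic in t is affine, and this t gives it the value -1. *)
  have := key (- (ip g g + 1) / (2 * ip g h)); rewrite -h0 mulr0 addr0.
  have -> : 2 * (- (ip g g + 1) / (2 * ip g h)) * ip g h = - (ip g g + 1).
    by field.
  by lra.
have := key (- (ip g h) / ip h h).
have -> : ip g g + (- ip g h / ip h h) ^+ 2 * ip h h +
    2 * (- ip g h / ip h h) * ip g h = ip g g - ip g h ^+ 2 / ip h h.
  by field; rewrite gt_eqF.
by rewrite subr_ge0 ler_pdivrMr.
Qed.

Definition L2cvg (gs : nat -> 'rV[R]_n -> 'rV[R]_n) g :=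
  [/\ forall k, L2field (gs k), L2field g &
  ip (fun x => gs k x - g x) (fun x => gs k x - g x) @[k --> \oo] --> (0 : R)].

Lemma L2cvg_cst g : L2field g -> L2cvg (fun=> g) g.
Proof.
move=> Lg; split; [by []|by []|].
rewrite (_ : (fun _ => _) = cst 0); first exact: cvg_cst.
by apply/funext => k; rewrite (ipB_sqr Lg Lg) /=; ring.
Qed.

Lemma L2cvg_ip gs g h : L2cvg gs g -> L2field h ->
  ip h (gs k) @[k --> \oo] --> ip h g.
Proof.
move=> [Lgs Lg gg] Lh; apply/cvgrPdist_lt => e e0.
have e20 : 0 < e ^+ 2 / (ip h h + 1).
  by rewrite divr_gt0// ?exprn_gt0//; have := ip_ge0 h; lra.
move/cvgrPdist_lt : gg => /(_ _ e20); apply: filterS => k.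
have Lk := L2fieldB (Lgs k) Lg.
rewrite sub0r normrN ger0_norm ?ip_ge0// => hk.
rewrite distrC -ipBr//.
have := ip_cauchy Lh Lk; have h0 := ip_ge0 h.
set a := ip h _; set b := ip (fun x => _) _ in hk *.
move=> ab; rewrite -[e]gtr0_norm// -ltr_sqr ?nnegrE//.
rewrite !real_normK ?num_real//; apply: (le_lt_trans ab).
move: hk; rewrite ltr_pdivlMr; last by lra.
have := ip_ge0 (fun x => gs k x - g x); rewrite -/b; nra.
Qed.

Lemma L2cvgD gs g hs h : L2cvg gs g -> L2cvg hs h ->
  L2cvg (fun k x => gs k x + hs k x) (fun x => g x + h x).
Proof.
move=> [Lgs Lg gg] [Lhs Lh hh]; split.
- by move=> k; exact: L2fieldD.
- exact: L2fieldD.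
apply: (@squeeze_cvgr _ _ _ _ (cst 0) (fun k =>
  2 * (ip (fun x => gs k x - g x) (fun x => gs k x - g x) +
       ip (fun x => hs k x - h x) (fun x => hs k x - h x)))); last 2 first.
- exact: cvg_cst.
- have := cvgM (cvg_cst (2 : R)) (cvgD gg hh).
  by rewrite addr0 mulr0; apply.
apply: nearW => k; rewrite ip_ge0 /=.
have L1 := L2fieldB (Lgs k) Lg; have L2 := L2fieldB (Lhs k) Lh.
have -> : (fun x => gs k x + hs k x - (g x + h x)) =
          (fun x => (gs k x - g x) + (hs k x - h x)).
  by apply/funext => x; rewrite opprD addrACA.
(* Parallelogram law: the squared norm of a sum is at most twice the sum of the squared norms. *)
have := ip_ge0 (fun x => (gs k x - g x) - (hs k x - h x)).
by rewrite (ipD_sqr L1 L2) (ipB_sqr L1 L2); lra.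
Qed.

(** Write a_k g_k - a g = a_k (g_k - g) + (a_k - a) g. The first term is controlled by the uniform
    bound [C], the second by dominated convergence with a multiple of |g|^2 as dominating
    function. *)
Lemma L2cvgM (a_ : nat -> 'rV[R]_n -> R) (a : 'rV[R]_n -> R) (C : R) gs g :
  (forall k, measurable_fun Omega (a_ k)) -> measurable_fun Omega a ->
  (forall k x, `|a_ k x| <= C) -> (forall x, `|a x| <= C) ->
  {ae mu, forall x, Omega x -> sqnorm2 (g x) != 0 -> a_ ^~ x @ \oo --> a x} ->
  L2cvg gs g -> L2cvg (fun k x => a_ k x *: gs k x) (fun x => a x *: g x).
Proof.
move=> ma_ ma a_C aC aa [Lgs Lg gg].
have L1 k : L2field (fun x => a_ k x *: gs k x).
  by apply: (L2fieldM (C := C)) => // x _; exact: a_C.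
have L2 : L2field (fun x => a x *: g x).
  by apply: (L2fieldM (C := C)) => // x _; exact: aC.
have C0 : 0 <= C by exact: le_trans (aC 0).
split => //.
pose I k := \int[mu]_(x in Omega) ((a_ k x - a x) ^+ 2 * sqnorm2 (g x)).
have mak k : measurable_fun Omega (fun x => (a_ k x - a x) ^+ 2 * sqnorm2 (g x)).
  apply: measurable_funM; last by apply: measurable_sqnorm2; case: Lg.
  by apply: measurable_funX; exact: measurable_funB.
have ak_le k x : `|(a_ k x - a x) ^+ 2 * sqnorm2 (g x)| <=
    (2 * C) ^+ 2 * sqnorm2 (g x) :> R.
  have h1 : (a_ k x - a x) ^+ 2 <= (2 * C) ^+ 2 :> R.
    rewrite -[leLHS]real_normK ?num_real// lerXn2r ?nnegrE ?mulr_ge0//.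
    by apply: (le_trans (ler_normB _ _)); have := a_C k x; have := aC x; lra.
  have h2 := ler_wpM2r (sqnorm2_ge0 (g x)) h1.
  by rewrite ger0_norm// mulr_ge0 ?sqr_ge0 ?sqnorm2_ge0.
have iC : mu.-integrable Omega (EFin \o (fun x => (2 * C) ^+ 2 * sqnorm2 (g x))).
  by apply: integrableZR => //; case: Lg.
have acv : {ae mu, forall x, Omega x ->
    (a_ k x - a x) ^+ 2 * sqnorm2 (g x) @[k --> \oo] --> (0 : R)}.
  apply: filterS aa => x /[apply].
  have [->|gx0 /(_ isT) ax] := eqVneq (sqnorm2 (g x)) 0.
    by move=> _; under eq_fun do rewrite mulr0; exact: cvg_cst.
  have ax0 : a_ k x - a x @[k --> \oo] --> (0 : R).
    by rewrite -[X in _ --> X](subrr (a x)); apply: cvgB => //; exact: cvg_cst.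
  under eq_fun do rewrite expr2.
  have h := cvgM (cvgM ax0 ax0) (cvg_cst (sqnorm2 (g x))). rewrite !mul0r in h.
  exact: (h _ _ _).
have I0 : I k @[k --> \oo] --> (0 : R).
  have [_] := Rdominated_cvg mO mak (measurable_cst _) acv iC
    (fun k x _ => ak_le k x).
  by rewrite Rintegral_cst//= mul0r.
apply: (@squeeze_cvgr _ _ _ _ (cst 0) (fun k =>
  2 * (C ^+ 2 * ip (fun x => gs k x - g x) (fun x => gs k x - g x) + I k)));
  last 2 first.
- exact: cvg_cst.
- have := cvgM (cvg_cst (2 : R)) (cvgD (cvgM (cvg_cst (C ^+ 2)) gg) I0).
  by rewrite mulr0 addr0 mulr0; apply.
apply: nearW => k; rewrite ip_ge0 /=.
have Ld := L2fieldB (Lgs k) Lg.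
rewrite -RintegralZl//; last by have := integrable_dotv Ld Ld.
rewrite -RintegralD//; last 2 first.
  by apply: integrableZR => //; exact: integrable_dotv.
  by apply: (le_integrableR mO (mak k) (fun x _ => ak_le k x)).
rewrite -RintegralZl//; last first.
  apply: integrableDR => //; first by apply: integrableZR => //; exact: integrable_dotv.
  by apply: (le_integrableR mO (mak k) (fun x _ => ak_le k x)).
apply: le_Rintegral => //.
- by apply: integrable_dotv; exact: L2fieldB.
- apply: integrableZR => //; apply: integrableDR => //.
    by apply: integrableZR => //; exact: integrable_dotv.
  by apply: (le_integrableR mO (mak k) (fun x _ => ak_le k x)).
move=> x _; rewrite !dotvv.
have -> : a_ k x *: gs k x - a x *: g x =
    a_ k x *: (gs k x - g x) + (a_ k x - a x) *: g x.
  by rewrite scalerBr scalerBl addrA subrK.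
apply: (le_trans (sqnorm2D_le _ _)); rewrite !sqnorm2Z.
rewrite ler_wpM2l// lerD2r ler_wpM2r ?sqnorm2_ge0//.
by rewrite -[leLHS]real_normK ?num_real// lerXn2r ?nnegrE// a_C.
Qed.

End L2_fields.

(** * Test functions *)

Section ereal_convergence.
Context {R : realType}.

Lemma nonneg_cvge0P (x_ : nat -> \bar R) : (forall k, (0 <= x_ k)%E) ->
  x_ @ \oo --> 0%E <-> (forall e : R, 0 < e -> \forall k \near \oo, (x_ k <= e%:E)%E).
Proof.
move=> x0; split => [/fine_cvgP[fx cx] e e0|h].
  move/cvgrPdist_le : cx => /(_ _ e0); apply: filterS2 fx => k fk.
  rewrite /= sub0r normrN ger0_norm ?fine_ge0// => ke.
  by rewrite -(fineK fk) lee_fin.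
apply/fine_cvgP; split.
  have := h 1 ltr01; apply: filterS => k k1.
  by rewrite ge0_fin_numE// (le_lt_trans k1)// ltry.
apply/cvgrPdist_le => e e0; have := h e e0; apply: filterS => k ke.
rewrite /= sub0r normrN ger0_norm ?fine_ge0// -lee_fin fineK//.
by rewrite ge0_fin_numE// (le_lt_trans ke)// ltry.
Qed.

Lemma poweR_cvg0 (x_ : nat -> \bar R) (a : R) : 0 < a -> (forall k, (0 <= x_ k)%E) ->
  x_ @ \oo --> 0%E -> (x_ k `^ a)%E @[k --> \oo] --> 0%E.
Proof.
move=> a0 x0 /(nonneg_cvge0P x0) h; apply/nonneg_cvge0P.
  by move=> k; exact: poweR_ge0.
move=> e e0; have := h (e `^ a^-1); rewrite powR_gt0// => /(_ isT).
apply: filterS => k ke.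
have -> : e%:E = ((e `^ a^-1)%:E `^ a)%E.
  by rewrite poweR_EFin -powRrM mulVf ?gt_eqF// powRr1// ltW.
apply: gt0_ler_poweR => //; first exact: ltW.
  by rewrite in_itv/= leey x0.
by rewrite in_itv/= leey lee_fin powR_ge0.
Qed.

End ereal_convergence.

Lemma measurable_normr_powR {R : realType} d (T : measurableType d)
    (D : set T) (f : T -> R) (q : R) :
  measurable_fun D f -> measurable_fun D (fun x => `|f x| `^ q).
Proof.
move=> mf; apply: (measurableT_comp (measurable_powR q)).
exact: (measurableT_comp (@normr_measurable R setT)).
Qed.

Section Lnorm_on.
Context {R : realType} {n : nat} (Omega : set 'rV[R]_n).
Local Notation mu := (lebesgue_rV R n).

Lemma Lnorm_onE (q : R) (h : 'rV[R]_n -> \bar R) : q != 0 ->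
  Lnorm_on Omega q h = ((\int[mu]_(x in Omega) (`|h x| `^ q)) `^ q^-1)%E.
Proof.
move=> q0; rewrite /Lnorm_on unlock; congr (_ `^ _)%E.
rewrite [RHS]integral_mkcond; apply: eq_integral => x _.
by rewrite /patch; case: ifPn => // _; rewrite abse0 poweR0r.
Qed.

Lemma Lnorm_on_EFin (q : R) (h : 'rV[R]_n -> R) : q != 0 ->
  Lnorm_on Omega q (fun x => (h x)%:E) =
  ((\int[mu]_(x in Omega) (`|h x| `^ q)%:E) `^ q^-1)%E.
Proof. exact: Lnorm_onE. Qed.

Lemma Lnorm_on_powR (q : R) (h : 'rV[R]_n -> R) : q != 0 ->
  (\int[mu]_(x in Omega) (`|h x| `^ q)%:E =
  Lnorm_on Omega q (fun x => (h x)%:E) `^ q)%E.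
Proof.
move=> q0; rewrite Lnorm_on_EFin// -poweRrM mulVf// poweRe1//.
by apply: integral_ge0 => x _; rewrite lee_fin powR_ge0.
Qed.

End Lnorm_on.

Section test_functions.
Context {R : realType} {n : nat} (Omega : set 'rV[R]_n).
Local Notation mu := (lebesgue_rV R n).
Implicit Types phi psi : 'rV[R]_n -> R.

Lemma test_bounded phi : test_function Omega phi ->
  exists2 C : R, 0 <= C & forall x, `|phi x| <= C.
Proof.
move=> tphi; have [_ [K [cK KO phi0]]] := tphi.
have : compact (phi @` K).
  apply: continuous_compact => //; apply: continuous_subspaceT.
  exact: test_continuous tphi.
move=> /compact_bounded[M [_ hM]].
exists (`|M| + 1); first by have := normr_ge0 M; lra.
move=> x; have [Kx|/phi0->] := pselect (K x); last first.
  by rewrite normr0; have := normr_ge0 M; lra.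
by apply: (hM (`|M| + 1)); [have := ler_norm M; lra|exists x].
Qed.

Lemma test_bounded_support phi : test_function Omega phi ->
  exists2 M : R, 0 <= M &
    forall x : 'rV[R]_n, (exists i, M < `|x ord0 i|) -> phi x = 0.
Proof.
move=> [_ [K [cK KO phi0]]]; have [M [_ hM]] := compact_bounded cK.
exists (`|M| + 1); first by have := normr_ge0 M; lra.
move=> x [i Mi]; apply: phi0 => Kx.
have M1 : M < `|M| + 1 by have := ler_norm M; lra.
have /= xM := hM _ M1 x Kx.
have : `|x ord0 i| <= `|x|.
  rewrite [leRHS]/Num.norm /= mx_normrE.
  exact: (le_bigmax _ (fun ij => `|x ij.1 ij.2|) (ord0, i)).
by move=> /le_trans/(_ xM); rewrite leNgt Mi.
Qed.

Lemma test_lin (a : R) phi psi : test_function Omega phi ->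
  test_function Omega psi -> test_function Omega (fun x => a * phi x + psi x).
Proof.
move=> [Cphi [K [cK KO phi0]]] [Cpsi [L [cL LO psi0]]]; split.
  by move=> k; apply: CkD => //; exact: Ck_scale.
exists (K `|` L); split; first exact: compactU.
- by move=> x [/KO|/LO].
- by move=> x /not_orP[/phi0-> /psi0->]; rewrite mulr0 addr0.
Qed.

Lemma testM phi psi : test_function Omega phi ->
  test_function Omega psi -> test_function Omega (fun x => phi x * psi x).
Proof.
move=> [Cphi [K [cK KO phi0]]] [Cpsi _]; split.
  by move=> k; exact: CkM.
by exists K; split => // x /phi0 ->; rewrite mul0r.
Qed.

Lemma partial_lin (a : R) phi psi i x : test_function Omega phi ->
  test_function Omega psi ->
  partial i (fun x => a * phi x + psi x) x = a * partial i phi x + partial i psi x.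
Proof.
move=> tphi tpsi.
have dphi : derivable phi x (delta_mx ord0 i) by exact: test_derivable tphi.
have dpsi : derivable psi x (delta_mx ord0 i) by exact: test_derivable tpsi.
have dc : derivable (fun _ : 'rV[R]_n => a) x (delta_mx ord0 i).
  exact: derivable_cst.
rewrite (partialD (derivable_mulf dc dphi) dpsi) (partialM dc dphi).
by rewrite partial_cst mulr0 addr0.
Qed.

Lemma gradient_lin (a : R) phi psi x : test_function Omega phi ->
  test_function Omega psi ->
  gradient (fun x => a * phi x + psi x) x = a *: gradient phi x + gradient psi x.
Proof. by move=> tphi tpsi; apply/rowP => i; rewrite !mxE partial_lin. Qed.

Lemma test_measurable phi (D : set 'rV[R]_n) : test_function Omega phi ->
  measurable D -> measurable_fun D phi.
Proof. by move=> /test_continuous; exact: continuous_measurable_rV. Qed.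

Lemma test_powR_integrable phi (q : R) (D : set 'rV[R]_n) : 0 < q ->
  test_function Omega phi -> measurable D ->
  mu.-integrable D (EFin \o (fun x => `|phi x| `^ q)).
Proof.
move=> q0 tphi mD.
have [C C0 hC] := test_bounded tphi; have [M M0 hM] := test_bounded_support tphi.
apply: (@integrable_bounded_support _ _ _ _ (C `^ q) M) => //.
- by apply: measurable_normr_powR; exact: test_measurable.
- move=> x; rewrite ger0_norm ?powR_ge0//.
  by apply: ge0_ler_powR; rewrite ?nnegrE ?(ltW q0).
- by move=> x /hM ->; rewrite normr0 powR0 ?gt_eqF.
Qed.

Lemma test_integrable phi (D : set 'rV[R]_n) :
  test_function Omega phi -> measurable D -> mu.-integrable D (EFin \o phi).
Proof.
move=> tphi mD.
have [C C0 hC] := test_bounded tphi; have [M M0 hM] := test_bounded_support tphi.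
apply: (@integrable_bounded_support _ _ _ _ C M) => //.
exact: test_measurable.
Qed.

Lemma gradient_L2field phi : measurable Omega -> test_function Omega phi ->
  L2field Omega (gradient phi).
Proof.
move=> mO tphi; have tp i := test_partial i tphi; split.
  apply: measurable_fieldP => // i.
  rewrite (_ : (fun x => gradient phi x ord0 i) = partial i phi).
    exact: test_measurable.
  by apply/funext => x; rewrite mxE.
apply: (@eq_integrable _ _ _ mu _ mO (fun x => (\sum_i (partial i phi x * partial i phi x)%:E)%E)).
  move=> x _; rewrite /= sumEFin /sqnorm2; congr (_%:E).
  by apply: eq_bigr => i _; rewrite mxE expr2.
apply: integrable_sum => // i _.
by apply: test_integrable => //; exact: testM.
Qed.

(** A test function is defined on the whole space and vanishes off [Omega], which turns the integral
    into one over the whole space. *)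
Lemma integral_test_partial phi i : measurable Omega -> test_function Omega phi ->
  \int[mu]_(x in Omega) partial i phi x = 0.
Proof.
move=> mO tphi; have tp := test_partial i tphi.
have [C C0 hC] := test_bounded tp.
have [M M0 hM] := test_bounded_support tphi.
have [M' M'0 hM'] := test_bounded_support tp.
rewrite /Rintegral integral_mkcond (_ : (_ \_ _) = EFin \o partial i phi); last first.
  apply/funext => x; rewrite /patch; case: ifPn => // /negP; rewrite inE => Ox.
  by rewrite /= (test_out tp).
rewrite (@integral_partial_eq0 _ _ _ _ C (Num.max M M'))//.
- by move=> x; exact: test_derivable tphi.
- exact: test_continuous tp.
- by rewrite le_max M0.
- by move=> x [j]; rewrite gt_max => /andP[Mx _]; apply: hM; exists j.
- by move=> x [j]; rewrite gt_max => /andP[_ Mx]; apply: hM'; exists j.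
Qed.

Lemma test_integration_by_parts phi psi i : measurable Omega ->
  test_function Omega phi -> test_function Omega psi ->
  \int[mu]_(x in Omega) (partial i phi x * psi x) =
  - \int[mu]_(x in Omega) (phi x * partial i psi x).
Proof.
move=> mO tphi tpsi.
have := integral_test_partial i mO (testM tphi tpsi).
under eq_Rintegral => x _.
  rewrite partialM; [over| exact: test_derivable tphi|exact: test_derivable tpsi].
rewrite RintegralD//; last 2 first.
- by apply: test_integrable => //; apply: testM => //; exact: test_partial.
- by apply: test_integrable => //; apply: testM => //; exact: test_partial.
under [X in _ + X]eq_Rintegral do rewrite mulrC.
by move=> /eqP; rewrite addrC addr_eq0 => /eqP.
Qed.

End test_functions.

(** * Sobolev pairs *)

Section sobolev_pairs.
Context {R : realType} {n : nat} (n3 : (3 <= n)%N).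
Variable (Omega : set 'rV[R]_n) (oO : open Omega).
Local Notation mu := (lebesgue_rV R n).
Local Notation qs := (sobolev_exponent R n).
Let mO : measurable Omega := open_measurable_rV oO.
Implicit Types (u v phi psi : 'rV[R]_n -> R) (g h : 'rV[R]_n -> 'rV[R]_n).

Lemma sobolev_exponent_ge1 : 1 <= qs.
Proof.
have : (3%:R : R) <= n%:R by rewrite ler_nat.
by move=> h; rewrite /sobolev_exponent ler_pdivlMr; lra.
Qed.

Let qs0 : 0 < qs. Proof. by have := sobolev_exponent_ge1; lra. Qed.
Let qsn0 : qs != 0. Proof. by rewrite gt_eqF. Qed.

Lemma measurable_qs u : measurable_fun Omega u ->
  measurable_fun Omega (fun x => (`|u x| `^ qs)%:E).
Proof. by move=> mu; exact/measurable_EFinP/measurable_normr_powR. Qed.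

(* Approximation up to [e] spares the diagonal extractions that sequences would
   require. *)
Lemma sobolev_pairP u g : sobolev_pair Omega u g <->
  [/\ measurable_fun Omega u, measurable_fun Omega g &
   forall e : R, 0 < e -> exists phi, [/\ test_function Omega phi,
     (\int[mu]_(x in Omega) (`|phi x - u x| `^ qs)%:E <= e%:E)%E &
     (int_sqnorm Omega (fun x => gradient phi x - g x)%R <= e%:E)%E]].
Proof.
have I0 (h : 'rV[R]_n -> R) : (0 <= \int[mu]_(x in Omega) (`|h x| `^ qs)%:E)%E.
  by apply: integral_ge0 => x _; rewrite lee_fin powR_ge0.
have S0 g' : (0 <= int_sqnorm Omega g')%E.
  by apply: integral_ge0 => x _; rewrite lee_fin sqnorm2_ge0.
split=> -[mu' mg h]; split => //.
  move=> e e0; have [phi [tphi cphi cg]] := h.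
  have cphi' : (\int[mu]_(x in Omega) (`|phi k x - u x| `^ qs)%:E)%E @[k --> \oo] --> 0%E.
    have := poweR_cvg0 qs0 (fun k => Lnorm_ge0 _ _ _) cphi.
    apply: cvg_trans; apply: near_eq_cvg; apply: nearW => k.
    by rewrite (Lnorm_on_powR _ (fun x => phi k x - u x)).
  have /(nonneg_cvge0P (fun k => I0 _))/(_ _ e0) h1 := cphi'.
  have /(nonneg_cvge0P (fun k => S0 _))/(_ _ e0) h2 := cg.
  near \oo => k; exists (phi k); split => //; near: k; [exact: h1|exact: h2].
have k0 (k : nat) : (0 : R) < k.+1%:R^-1 by rewrite invr_gt0.
have /choice[phi hphi] := fun k => h _ (k0 k).
exists phi; split.
- by move=> k; have [] := hphi k.
- under eq_fun do rewrite Lnorm_on_EFin//.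
  apply: poweR_cvg0 => //; first by rewrite invr_gt0.
  apply/nonneg_cvge0P => // e e0.
  have := near_infty_natSinv_lt (PosNum e0); apply: filterS => k ke.
  by have [_ + _] := hphi k => /le_trans; apply; rewrite lee_fin ltW.
- apply/nonneg_cvge0P => // e e0.
  have := near_infty_natSinv_lt (PosNum e0); apply: filterS => k ke.
  by have [_ _] := hphi k => /le_trans; apply; rewrite lee_fin ltW.
Unshelve. all: by end_near. Qed.

Lemma sobolev_pair_L2field u g : sobolev_pair Omega u g -> L2field Omega g.
Proof.
move=> /sobolev_pairP[mu' mg /(_ _ ltr01)[phi [tphi _ h]]].
have Lphi := gradient_L2field mO tphi.
have Ld : L2field Omega (fun x => gradient phi x - g x).
  apply/L2fieldP; last by rewrite (le_lt_trans h)// ltry.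
  by apply: measurable_fieldB => //; case: Lphi.
have := L2fieldB mO Lphi Ld; rewrite (_ : (fun x => _) = g)//.
by apply/funext => x; rewrite opprB addrC subrK.
Qed.

Lemma sobolev_pair_lin (a : R) u v g h : sobolev_pair Omega u g ->
  sobolev_pair Omega v h ->
  sobolev_pair Omega (fun x => a * u x + v x) (fun x => a *: g x + h x).
Proof.
move=> /[dup] /sobolev_pair_L2field Lg /sobolev_pairP[mu' mg hu].
move=> /[dup] /sobolev_pair_L2field Lh /sobolev_pairP[mv mh hv].
apply/sobolev_pairP; split.
- by apply: measurable_funD => //; exact: measurable_funM.
- by have [] := L2fieldD mO (L2fieldZ mO a Lg) Lh.
move=> e e0.
(* The first summand pays for the error in the functions, where a power of a sum costs 2^qs, and the
   second for the error in the gradients, where a square of a sum costs 2. *)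
pose K := 2 `^ qs * (`|a| `^ qs + 1) + 2 * (a ^+ 2 + 1).
have K0 : 0 < K.
  rewrite ltr_wpDl ?mulr_ge0 ?powR_ge0 ?addr_ge0 ?powR_ge0//.
  by rewrite mulr_gt0// ltr_wpDl ?sqr_ge0.
have eK0 : 0 < e / K by rewrite divr_gt0.
have [phi [tphi phiu phig]] := hu _ eK0; have [psi [tpsi psiv psih]] := hv _ eK0.
exists (fun x => a * phi x + psi x); split; first exact: test_lin.
  have mu1 : measurable_fun Omega (fun x => phi x - u x).
    by apply: measurable_funB => //; exact: test_measurable tphi mO.
  have mv1 : measurable_fun Omega (fun x => psi x - v x).
    by apply: measurable_funB => //; exact: test_measurable tpsi mO.
  apply: (@le_trans _ _ (\int[mu]_(x in Omega)
    ((2 `^ qs * `|a| `^ qs)%:E * (`|phi x - u x| `^ qs)%:E +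
     (2 `^ qs)%:E * (`|psi x - v x| `^ qs)%:E))%E).
    apply: ge0_le_integral => //.
    - apply: measurable_qs; apply: measurable_funB.
        exact: test_measurable (test_lin a tphi tpsi) mO.
      by apply: measurable_funD => //; exact: measurable_funM.
    - by apply: emeasurable_funD; apply: emeasurable_funM => //; exact: measurable_qs.
    move=> x _; rewrite -!EFinM -EFinD lee_fin.
    have -> : a * phi x + psi x - (a * u x + v x) =
        a * (phi x - u x) + (psi x - v x) by ring.
    apply: (@le_trans _ _ ((`|a * (phi x - u x)| + `|psi x - v x|) `^ qs)).
      by apply: ge0_ler_powR; rewrite ?nnegrE ?addr_ge0 ?ler_normD// ltW.
    apply: (le_trans (powRD_le _ _ _)) => //; first exact: ltW.
    by rewrite normrM powRM// mulrDr mulrA.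
  rewrite ge0_integralD//; [|by apply: emeasurable_funM => //; exact: measurable_qs..].
  rewrite !ge0_integralZl//; [|exact: measurable_qs..].
  apply: (@le_trans _ _ ((2 `^ qs * `|a| `^ qs)%:E * (e / K)%:E +
      (2 `^ qs)%:E * (e / K)%:E)%E).
    by apply: leeD; apply: lee_wpmul2l => //; rewrite lee_fin ?mulr_ge0 ?powR_ge0.
  rewrite -!EFinM -EFinD lee_fin -mulrDl mulrCA -[leRHS]mulr1 ler_wpM2l ?(ltW e0)//.
  rewrite ler_pdivrMr// mul1r /K mulrDr mulr1 lerDl.
  by rewrite mulr_ge0// addr_ge0 ?sqr_ge0.
have Lphi := gradient_L2field mO tphi; have Lpsi := gradient_L2field mO tpsi.
have L1 := L2fieldB mO Lphi Lg; have L2 := L2fieldB mO Lpsi Lh.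
have L3 := L2fieldZ mO a L1.
have L4 := L2fieldB mO L3 L2.
rewrite (_ : (fun x => _) = (fun x => a *: (gradient phi x - g x) +
    (gradient psi x - h x))); last first.
  apply/funext => x; rewrite (gradient_lin a x tphi tpsi) scalerBr.
  by rewrite opprD addrACA.
rewrite int_sqnormE//; last exact: L2fieldD.
have := ip_ge0 Omega (fun x => a *: (gradient phi x - g x) - (gradient psi x - h x)).
rewrite (ipD_sqr mO L3 L2) (ipB_sqr mO L3 L2) => cross.
move: phig psih; rewrite !int_sqnormE// !lee_fin => phig psih.
have E1 : ip Omega (fun x => a *: (gradient phi x - g x))
   (fun x => a *: (gradient phi x - g x)) = a ^+ 2 *
   ip Omega (fun x => gradient phi x - g x) (fun x => gradient phi x - g x).
  by rewrite ipZl// ipZr// mulrA expr2.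
rewrite E1 in cross *.
have aphig := ler_wpM2l (sqr_ge0 a) phig.
apply: (@le_trans _ _ (2 * (a ^+ 2 + 1) * (e / K))); first by lra.
rewrite mulrCA -[leRHS]mulr1 ler_wpM2l ?(ltW e0)//.
rewrite ler_pdivrMr// mul1r /K lerDr.
by rewrite mulr_ge0 ?powR_ge0// addr_ge0 ?powR_ge0.
Qed.

End sobolev_pairs.

(** Splitting at the level [d]. It takes the place of Hoelder's inequality when an L^q function is
    integrated against a bounded integrable one: the term [d] is made small first, then the L^q
    error. *)
Lemma normr_le_powR {R : realType} (q d a : R) : 1 <= q -> 0 < d ->
  `|a| <= d + d `^ (1 - q) * `|a| `^ q.
Proof.
move=> q1 d0; have [ad|ad] := leP `|a| d.
  by rewrite -[leLHS]addr0 lerD// mulr_ge0 ?powR_ge0.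
have a0 : 0 < `|a| by exact: lt_trans ad.
rewrite -[leLHS]add0r lerD ?(ltW d0)//.
have {1}-> : `|a| = `|a| `^ (1 - q) * `|a| `^ q.
  rewrite -powRD; last by rewrite (gt_eqF a0) implybT.
  by rewrite subrK powRr1.
rewrite ler_wpM2r ?powR_ge0//; apply: ler_powRN => //; last exact: ltW.
by rewrite subr_le0.
Qed.

(** * Weak derivatives and uniqueness of the gradient *)

Section weak_derivatives.
Context {R : realType} {n : nat} (n3 : (3 <= n)%N).
Variable (Omega : set 'rV[R]_n) (oO : open Omega).
Local Notation mu := (lebesgue_rV R n).
Local Notation qs := (sobolev_exponent R n).
Let mO : measurable Omega := open_measurable_rV oO.
Implicit Types (u v phi psi : 'rV[R]_n -> R) (g h : 'rV[R]_n -> 'rV[R]_n).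

Let qs1 : 1 <= qs := sobolev_exponent_ge1 n3.
Let qs0 : 0 < qs. Proof. by have := qs1; lra. Qed.

(** The rate of convergence of the functions is prescribed, so that a summable one can later be
    chosen to obtain convergence almost everywhere. *)
Lemma sobolev_approx u g (eps : nat -> R) : (forall k, 0 < eps k) ->
  sobolev_pair Omega u g ->
  exists phi : nat -> 'rV[R]_n -> R, [/\ forall k, test_function Omega (phi k),
    forall k, (\int[mu]_(x in Omega) (`|phi k x - u x| `^ qs)%:E <= (eps k)%:E)%E &
    L2cvg Omega (fun k => gradient (phi k)) g].
Proof.
move=> eps0 /[dup] ug /(sobolev_pairP n3)[mu' mg h].
have e0 k : 0 < Num.min (eps k) k.+1%:R^-1 by rewrite lt_min eps0 invr_gt0 ltr0n.
have /choice[phi hphi] := fun k => h _ (e0 k).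
have Lg := sobolev_pair_L2field n3 oO ug.
have Lphi k : L2field Omega (gradient (phi k)).
  by apply: (gradient_L2field mO); have [] := hphi k.
exists phi; split.
- by move=> k; have [] := hphi k.
- by move=> k; have [_ + _] := hphi k => /le_trans; apply; rewrite lee_fin ge_min lexx.
split => //; apply/cvgrPdist_le => e e_gt0.
have := near_infty_natSinv_lt (PosNum e_gt0); apply: filterS => k ke.
rewrite sub0r normrN ger0_norm ?ip_ge0// -lee_fin -int_sqnormE//; last exact: L2fieldB.
have [_ _ /le_trans] := hphi k; apply.
by rewrite lee_fin ge_min (ltW ke) orbT.
Qed.

Lemma sobolev_pair_measurable u g : sobolev_pair Omega u g -> measurable_fun Omega u.
Proof. by case. Qed.

Lemma sobolev_pair_integrable u g : sobolev_pair Omega u g ->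
  mu.-integrable Omega (EFin \o (fun x => `|u x| `^ qs)).
Proof.
move=> /(sobolev_pairP n3)[mu' mg /(_ _ ltr01)[phi [tphi h _]]].
have md : measurable_fun Omega (fun x => phi x - u x).
  by apply: measurable_funB => //; exact: test_measurable tphi mO.
have i1 : mu.-integrable Omega (EFin \o (fun x => `|phi x - u x| `^ qs)).
  apply/integrableP_ge0; first exact: measurable_normr_powR.
    by move=> x _; rewrite powR_ge0.
  by apply: (le_lt_trans h); rewrite ltry.
have i2 := test_powR_integrable qs0 tphi mO.
apply: (@le_integrableR _ _ _ _ _ mO _ (fun x =>
  2 `^ qs * (`|phi x| `^ qs + `|phi x - u x| `^ qs))).
- exact: measurable_normr_powR.
- move=> x _; rewrite ger0_norm ?powR_ge0//.
  apply: le_trans (powRD_le (ltW qs0) _ _) => //.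
  apply: ge0_ler_powR; rewrite ?nnegrE ?addr_ge0//; first exact: ltW.
  by have := ler_normB (phi x) (phi x - u x); rewrite opprB addrC subrK.
- by apply: integrableZR => //; exact: integrableDR.
Qed.

Lemma integrable_mul_test u psi : measurable_fun Omega u ->
  mu.-integrable Omega (EFin \o (fun x => `|u x| `^ qs)) ->
  test_function Omega psi -> mu.-integrable Omega (EFin \o (fun x => u x * psi x)).
Proof.
move=> mu' iu tpsi; have [C C0 hC] := test_bounded tpsi.
have ipsi := integrable_norm (test_integrable tpsi mO).
apply: (@le_integrableR _ _ _ _ _ mO _ (fun x => `|psi x| + C * `|u x| `^ qs)).
- by apply: measurable_funM => //; exact: test_measurable tpsi mO.
- move=> x _; rewrite normrM.
  have := normr_le_powR (u x) qs1 ltr01; rewrite powR1 mul1r.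
  have := hC x; have := normr_ge0 (psi x); have := powR_ge0 `|u x| qs.
  move: (`|u x|) (`|psi x|) (_ `^ _) => a b c; nra.
- by apply: integrableDR => //; exact: integrableZR.
Qed.

Lemma cvg_integral_mul_test u psi (us : nat -> 'rV[R]_n -> R) :
  (forall k, measurable_fun Omega (us k)) -> measurable_fun Omega u ->
  (forall k, mu.-integrable Omega (EFin \o (fun x => `|us k x| `^ qs))) ->
  mu.-integrable Omega (EFin \o (fun x => `|u x| `^ qs)) ->
  test_function Omega psi ->
  (forall e : R, 0 < e -> \forall k \near \oo,
    (\int[mu]_(x in Omega) (`|us k x - u x| `^ qs)%:E <= e%:E)%E) ->
  \int[mu]_(x in Omega) (us k x * psi x) @[k --> \oo] -->
  \int[mu]_(x in Omega) (u x * psi x).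
Proof.
move=> mus mu' ius iu tpsi h.
have [C C0 hC] := test_bounded tpsi.
have ipsi := integrable_norm (test_integrable tpsi mO).
pose A := \int[mu]_(x in Omega) `|psi x|.
have A0 : 0 <= A by apply: Rintegral_ge0.
apply/cvgrPdist_le => e e0.
(* [d] makes the contribution of small differences at most e / 2. Then e' does the same for large
   ones, whose factor d^(1-qs) C depends on [d]. The added 1 keeps the denominators positive. *)
pose d := e / (2 * (A + 1)); have d0 : 0 < d by rewrite divr_gt0 ?mulr_gt0//; lra.
pose e' := e / (2 * (d `^ (1 - qs) * C + 1)).
have dC0 : 0 <= d `^ (1 - qs) * C by rewrite mulr_ge0 ?powR_ge0.
have e'0 : 0 < e' by rewrite divr_gt0// mulr_gt0//; lra.
apply: filterS (h _ e'0) => k hk.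
have i1 : mu.-integrable Omega (EFin \o (fun x => `|us k x - u x| `^ qs)).
  apply/integrableP_ge0; last by apply: (le_lt_trans hk); rewrite ltry.
    by apply: measurable_normr_powR; exact: measurable_funB.
  by move=> x _; rewrite powR_ge0.
move: hk; rewrite -EFin_Rintegral// lee_fin => hk.
have iB : mu.-integrable Omega (EFin \o (fun x => u x * psi x - us k x * psi x)).
  by apply: integrableBR => //; exact: integrable_mul_test.
rewrite -RintegralB//; last 2 first.
- exact: integrable_mul_test.
- exact: integrable_mul_test.
apply: (le_trans (le_normr_Rintegral mO iB)).
have i2 : mu.-integrable Omega (EFin \o (fun x => d * `|psi x|)).
  exact: integrableZR.
have i3 : mu.-integrable Omega (EFin \o (fun x =>
    d `^ (1 - qs) * C * `|us k x - u x| `^ qs)).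
  exact: integrableZR.
apply: (@le_trans _ _ (\int[mu]_(x in Omega) (d * `|psi x| +
    d `^ (1 - qs) * C * `|us k x - u x| `^ qs))).
  apply: le_Rintegral => //.
  - exact: integrable_norm.
  - exact: integrableDR.
  move=> x _; rewrite -mulrBl normrM distrC.
  have := normr_le_powR (us k x - u x) qs1 d0.
  have := hC x; have := normr_ge0 (psi x); have := powR_ge0 `|us k x - u x| qs.
  have := powR_ge0 d (1 - qs).
  move: (`|us k x - u x|) (`|psi x|) (_ `^ qs) (_ `^ (1 - qs)) => a b c f.
  move=> f0 c0 b0 bC afc.
  have h1 := ler_wpM2r b0 afc.
  have h2 := ler_wpM2l (mulr_ge0 f0 c0) bC.
  by rewrite (le_trans h1)//; lra.
rewrite RintegralD// !RintegralZl// -/A.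
have h1 : d * A <= e / 2.
  have -> : e / 2 = d * (A + 1) by rewrite /d; field; lra.
  by rewrite ler_wpM2l ?(ltW d0)//; lra.
have h2 := ler_wpM2l dC0 hk.
have h3 : d `^ (1 - qs) * C * e' <= e / 2.
  have -> : e / 2 = (d `^ (1 - qs) * C + 1) * e' by rewrite /e'; field; lra.
  by rewrite ler_wpM2r ?(ltW e'0)//; lra.
lra.
Qed.

Lemma L2field_test_delta psi i : test_function Omega psi ->
  L2field Omega (fun x => psi x *: (delta_mx ord0 i : 'rV[R]_n)).
Proof.
move=> tpsi; split.
  by apply: measurable_fieldZ => //; exact: test_measurable tpsi mO.
apply: (@eq_integrable _ _ _ mu _ mO (EFin \o (fun x => psi x * psi x))).
  by move=> x _; rewrite /= sqnorm2Z -dotvv dotv_deltar mxE !eqxx mulr1 expr2.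
by apply: test_integrable (testM tpsi tpsi) mO.
Qed.

Lemma ip_test_delta psi i h :
  ip Omega (fun x => psi x *: (delta_mx ord0 i : 'rV[R]_n)) h =
  \int[mu]_(x in Omega) (h x ord0 i * psi x).
Proof. by apply: eq_Rintegral => x _; rewrite dotvZl dotvC dotv_deltar mulrC. Qed.

(** Integration by parts holds for the approximating test functions, and both sides pass to the
    limit: the left one by L^2 convergence of the gradients, paired with the field psi e_i, the
    right one by convergence of the functions. *)
Lemma sobolev_pair_weak u g psi i : sobolev_pair Omega u g ->
  test_function Omega psi ->
  \int[mu]_(x in Omega) (g x ord0 i * psi x) =
  - \int[mu]_(x in Omega) (u x * partial i psi x).
Proof.
move=> ug tpsi.
have k0 (k : nat) : (0 : R) < k.+1%:R^-1 by rewrite invr_gt0.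
have [phi [tphi cphi Lphi]] := sobolev_approx k0 ug.
have c1 : \int[mu]_(x in Omega) (phi k x * partial i psi x) @[k --> \oo] -->
  \int[mu]_(x in Omega) (u x * partial i psi x).
  apply: cvg_integral_mul_test.
  - by move=> k; exact: test_measurable (tphi k) mO.
  - exact: sobolev_pair_measurable ug.
  - by move=> k; exact: test_powR_integrable qs0 (tphi k) mO.
  - exact: sobolev_pair_integrable ug.
  - exact: test_partial.
  move=> e e0; have := near_infty_natSinv_lt (PosNum e0); apply: filterS => k ke.
  by apply: (le_trans (cphi k)); rewrite lee_fin ltW.
have := L2cvg_ip mO Lphi (L2field_test_delta i tpsi); rewrite ip_test_delta => c2.
rewrite -(cvg_lim (@Rhausdorff R) c2); apply: cvg_lim; first exact: Rhausdorff.
rewrite (_ : (fun k => _) = fun k => - \int[mu]_(x in Omega)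
    (phi k x * partial i psi x)); first exact: cvgN.
apply/funext => k.
rewrite ip_test_delta -(test_integration_by_parts i mO (tphi k) tpsi).
by apply: eq_Rintegral => x _; rewrite mxE.
Qed.

(** The components of the gradient of a test function are test functions, and such gradients are
    dense among those of Sobolev pairs. This replaces the fundamental lemma of the calculus of
    variations: if [g] is itself such a gradient, it is orthogonal to itself. *)
Lemma ip_eq0_of_weak g : L2field Omega g ->
  (forall psi i, test_function Omega psi ->
    \int[mu]_(x in Omega) (g x ord0 i * psi x) = 0) ->
  forall v h, sobolev_pair Omega v h -> ip Omega g h = 0.
Proof.
move=> Lg g0 v h vh.
have k0 (k : nat) : (0 : R) < k.+1%:R^-1 by rewrite invr_gt0.
have [phi [tphi cphi Lphi]] := sobolev_approx k0 vh.
rewrite -(cvg_lim (@Rhausdorff R) (L2cvg_ip mO Lphi Lg)).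
apply: cvg_lim; first exact: Rhausdorff.
under eq_fun => k.
  rewrite (_ : ip _ _ _ = 0); first over.
  rewrite /ip /dotv /Rintegral.
  have h1 i : mu.-integrable Omega (fun x => (g x ord0 i * partial i (phi k) x)%:E).
    apply: (@integrable_mulL2 _ _ _ _ _ mO (fun x => g x ord0 i) (partial i (phi k))).
    - by apply: measurable_coord; case: Lg.
    - exact: test_measurable (test_partial i (tphi k)) mO.
    - apply: (@le_integrableR _ _ _ _ _ mO _ (fun x => sqnorm2 (g x))); last by case: Lg.
        by apply: measurable_funX; apply: measurable_coord; case: Lg.
      by move=> x _; rewrite ger0_norm ?sqr_ge0// sqr_coord_le.
    - apply: (@eq_integrable _ _ _ mu _ mO
        (EFin \o (fun x => partial i (phi k) x * partial i (phi k) x))).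
        by move=> x _; rewrite /= expr2.
      by apply: test_integrable mO; apply: testM; exact: test_partial.
  under eq_integral do rewrite -sumEFin.
  rewrite integral_sum//; last first.
    move=> i; apply: eq_integrable (h1 i) => // x _.
    by rewrite mxE.
  rewrite big1// => i _.
  have := g0 (partial i (phi k)) i (test_partial i (tphi k)).
  rewrite /Rintegral => h2.
  under eq_integral do rewrite mxE.
  by rewrite -[LHS]fineK ?h2//; exact: integrable_fin_num.
exact: cvg_cst.
Qed.

(** The difference of the two fields is a gradient of the zero function. It is therefore weakly
    zero, hence orthogonal to all gradients and in particular to itself. *)
Lemma sobolev_pair_unique u g h : sobolev_pair Omega u g ->
  sobolev_pair Omega u h ->
  ip Omega (fun x => g x - h x) (fun x => g x - h x) = 0.
Proof.
move=> ug uh.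
have := sobolev_pair_lin n3 oO (-1) uh ug => d.
have Ld : L2field Omega (fun x => g x - h x).
  exact: (L2fieldB mO (sobolev_pair_L2field n3 oO ug)
    (sobolev_pair_L2field n3 oO uh)).
have dE : (fun x => -1 *: h x + g x) = (fun x => g x - h x).
  by apply/funext => x; rewrite scaleN1r addrC.
rewrite dE in d; apply: (ip_eq0_of_weak Ld _ d) => psi i tpsi.
rewrite (sobolev_pair_weak i d tpsi).
under eq_Rintegral do rewrite mulN1r addNr mul0r.
by rewrite Rintegral_cst// mul0r oppr0.
Qed.

Lemma ip_null g h : L2field Omega g -> L2field Omega h ->
  ip Omega g g = 0 -> ip Omega g h = 0.
Proof.
move=> Lg Lh g0; have := ip_cauchy mO Lg Lh; rewrite g0 mul0r => h1.
by apply/eqP; rewrite -sqrf_eq0 eq_le h1 sqr_ge0.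
Qed.

(** [weak_gradient] is a choice among the gradients of [u]. By uniqueness any of them computes the
    Dirichlet integral, and this is how the energies below are evaluated. *)
Lemma dirichletE u g : sobolev_pair Omega u g ->
  dirichlet Omega u = (ip Omega g g)%:E.
Proof.
move=> ug; have uw : sobolev_pair Omega u (weak_gradient Omega u).
  by rewrite /weak_gradient; apply: (xgetPex (fun=> 0)); exists g.
have Lg := sobolev_pair_L2field n3 oO ug.
have Lw := sobolev_pair_L2field n3 oO uw.
have L1 := L2fieldB mO Lg Lw.
rewrite /dirichlet int_sqnormE//; congr (_%:E).
have h0 := sobolev_pair_unique ug uw.
have h1 := ip_null L1 Lg h0; have h2 := ip_null L1 Lw h0.
move: h1 h2; rewrite !ipBl// (ipC _ g); lra.
Qed.

End weak_derivatives.

(** * Truncations *)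

Section truncated_mean.
Context {R : realType}.
Implicit Types e s t : R.

(* A smooth substitute for the truncation of [s] at level [`|t|]: it maps pairs
   of test functions to test functions, and tends to [s] as [t --> s] and
   [e --> 0]. *)
Definition mean e s t : R := 2 * (s * t ^+ 2) / (e + s ^+ 2 + t ^+ 2).
Definition mean_ds e s t : R :=
  2 * t ^+ 2 * (e + t ^+ 2 - s ^+ 2) / (e + s ^+ 2 + t ^+ 2) ^+ 2.
Definition mean_dt e s t : R :=
  4 * (s * t) * (e + s ^+ 2) / (e + s ^+ 2 + t ^+ 2) ^+ 2.

Lemma mean_den_gt0 e s t : 0 < e -> 0 < e + s ^+ 2 + t ^+ 2.
Proof. by move=> e0; have := sqr_ge0 s; have := sqr_ge0 t; lra. Qed.

Let norm_num s t : `|2 * (s * t ^+ 2)| = 2 * (`|s| * `|t| ^+ 2).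
Proof. by rewrite normrM (normrM s) normrX ger0_norm. Qed.

Lemma mean_le_r e s t : 0 < e -> `|mean e s t| <= `|t|.
Proof.
move=> e0; have d0 := mean_den_gt0 s t e0.
rewrite /mean normrM normfV (gtr0_norm d0) ler_pdivrMr// norm_num.
rewrite -[s ^+ 2]real_normK ?num_real//.
rewrite -[t ^+ 2]real_normK ?num_real//.
have := sqr_ge0 (`|s| - `|t|); have := normr_ge0 t.
by move: (`|s|) (`|t|) => a b; nra.
Qed.

Lemma mean_le_l e s t : 0 < e -> `|mean e s t| <= 2 * `|s|.
Proof.
move=> e0; have d0 := mean_den_gt0 s t e0.
rewrite /mean normrM normfV (gtr0_norm d0) ler_pdivrMr// norm_num.
rewrite -mulrA ler_wpM2l// ler_wpM2l//.
by rewrite real_normK ?num_real// lerDr; have := sqr_ge0 s; lra.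
Qed.

Lemma mean_ds_le e s t : 0 < e -> `|mean_ds e s t| <= 2.
Proof.
move=> e0; have d0 := mean_den_gt0 s t e0.
rewrite /mean_ds normrM normfV ler_pdivrMr ?normr_gt0 ?gt_eqF ?exprn_gt0//.
rewrite [`|_ ^+ 2|]ger0_norm ?sqr_ge0// ler_norml.
have := sqr_ge0 s; have := sqr_ge0 t; move: (s ^+ 2) (t ^+ 2) => a b a0 b0.
have h1 : 0 <= a * b by rewrite mulr_ge0.
have h2 : 0 <= e * a by rewrite mulr_ge0// ltW.
have h3 : 0 <= e * b by rewrite mulr_ge0// ltW.
by apply/andP; split; nra.
Qed.

Lemma mean_dt_le e s t : 0 < e -> `|mean_dt e s t| <= 2.
Proof.
move=> e0; have d0 := mean_den_gt0 s t e0.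
rewrite /mean_dt normrM normfV ler_pdivrMr ?normr_gt0 ?gt_eqF ?exprn_gt0//.
rewrite [`|_ ^+ 2|]ger0_norm ?sqr_ge0// !normrM.
rewrite (ger0_norm (ler0n _ 4)) [`|e + _|]ger0_norm; last first.
  by rewrite addr_ge0 ?sqr_ge0// ltW.
have h1 : 2 * (`|s| * `|t|) <= e + s ^+ 2 + t ^+ 2.
  have := sqr_ge0 (`|s| - `|t|).
  by rewrite sqrrB !real_normK ?num_real//; lra.
have h2 : e + s ^+ 2 <= e + s ^+ 2 + t ^+ 2 by rewrite lerDl sqr_ge0.
have h3 : 0 <= e + s ^+ 2 by rewrite addr_ge0 ?sqr_ge0// ltW.
have h4 : 0 <= 2 * (`|s| * `|t|) by rewrite !mulr_ge0.
have := ler_pM h4 h3 h1 h2; rewrite -expr2; lra.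
Qed.

(** The difference is s - s' times an explicit quotient. With A = e + t^2 that quotient is at most 2
    in modulus, because t^2 <= A and (A + s^2) (A + s'^2) = (A - s s')^2 + A (s + s')^2. *)
Lemma mean_lipschitz e s s' t : 0 < e ->
  `|mean e s t - mean e s' t| <= 2 * `|s - s'|.
Proof.
move=> e0; have d0 := mean_den_gt0 s t e0; have d0' := mean_den_gt0 s' t e0.
have -> : mean e s t - mean e s' t = (s - s') * (2 * t ^+ 2 *
   (e + t ^+ 2 - s * s') / ((e + s ^+ 2 + t ^+ 2) * (e + s' ^+ 2 + t ^+ 2))).
  by rewrite /mean; field; rewrite !gt_eqF.
rewrite normrM mulrC ler_wpM2r//.
rewrite normrM normfV ler_pdivrMr; last by rewrite normr_gt0 mulf_neq0// gt_eqF.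
rewrite [in leRHS]ger0_norm; last by rewrite mulr_ge0// ltW.
rewrite -[leRHS]ger0_norm; last by rewrite !mulr_ge0// ltW.
rewrite -ler_sqr ?nnegrE// !real_normK ?num_real//.
have := sqr_ge0 s; have := sqr_ge0 s'; have := sqr_ge0 t.
set A := e + t ^+ 2 => t0 s'0 s0.
have A0 : 0 < A by rewrite /A; lra.
have -> : e + s ^+ 2 + t ^+ 2 = A + s ^+ 2 by rewrite /A; ring.
have -> : e + s' ^+ 2 + t ^+ 2 = A + s' ^+ 2 by rewrite /A; ring.
have tA : (t ^+ 2) ^+ 2 <= (A + s ^+ 2) * (A + s' ^+ 2).
  by rewrite expr2; apply: ler_pM => //; rewrite /A; lra.
have sA : (A - s * s') ^+ 2 <= (A + s ^+ 2) * (A + s' ^+ 2).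
  have -> : (A + s ^+ 2) * (A + s' ^+ 2) = (A - s * s') ^+ 2 + A * (s + s') ^+ 2.
    by ring.
  by rewrite lerDl mulr_ge0 ?sqr_ge0// ltW.
have := ler_pM (sqr_ge0 _) (sqr_ge0 _) tA sA.
rewrite -expr2; set P := (A + _) * _; set a := t ^+ 2; set b := A - _.
move=> h; have -> : (2 * a * b) ^+ 2 = 4 * (a ^+ 2 * b ^+ 2) by ring.
have -> : (2 * P) ^+ 2 = 4 * P ^+ 2 by ring.
lra.
Qed.

Lemma cvg_sqr (u : nat -> R) (l : R) : u @ \oo --> l -> u k ^+ 2 @[k --> \oo] --> l ^+ 2.
Proof.
move=> ul; rewrite expr2 (_ : (fun k => _) = fun k => u k * u k).
  exact: cvgM.
by apply/funext => k; rewrite expr2.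
Qed.

Section limits.
Variables (es ss ts : nat -> R) (e s t : R).
Hypotheses (ce : es @ \oo --> e) (cs : ss @ \oo --> s) (ct : ts @ \oo --> t).
Hypothesis d0 : e + s ^+ 2 + t ^+ 2 != 0.

Let cden : (es k + ss k ^+ 2 + ts k ^+ 2)^-1 @[k --> \oo] -->
  (e + s ^+ 2 + t ^+ 2)^-1.
Proof. by apply: cvgV => //; apply: cvgD; [apply: cvgD|]=> //; exact: cvg_sqr. Qed.

Let cden2 : ((es k + ss k ^+ 2 + ts k ^+ 2) ^+ 2)^-1 @[k --> \oo] -->
  ((e + s ^+ 2 + t ^+ 2) ^+ 2)^-1.
Proof.
apply: cvgV; first by rewrite expf_neq0.
by apply: cvg_sqr; apply: cvgD; [apply: cvgD|]=> //; exact: cvg_sqr.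
Qed.

(** The limit [e] may be 0 as long as the denominator does not vanish. This is the case met below at
    the points where u is nonzero. *)
Lemma cvg_mean : mean (es k) (ss k) (ts k) @[k --> \oo] --> mean e s t.
Proof.
rewrite /mean; apply: cvgM => //; apply: cvgM; first exact: cvg_cst.
by apply: cvgM => //; exact: cvg_sqr.
Qed.

Lemma cvg_mean_ds : mean_ds (es k) (ss k) (ts k) @[k --> \oo] --> mean_ds e s t.
Proof.
rewrite /mean_ds; apply: cvgM => //; apply: cvgM.
  by apply: cvgM; [exact: cvg_cst|exact: cvg_sqr].
by apply: cvgB; [apply: cvgD|] => //; exact: cvg_sqr.
Qed.

Lemma cvg_mean_dt : mean_dt (es k) (ss k) (ts k) @[k --> \oo] --> mean_dt e s t.
Proof.
rewrite /mean_dt; apply: cvgM => //; apply: cvgM.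
  by apply: cvgM; [exact: cvg_cst|exact: cvgM].
by apply: cvgD => //; exact: cvg_sqr.
Qed.

End limits.
End truncated_mean.

Section measurable_mean.
Context {R : realType} d (T : measurableType d) (D : set T).
Variables (e : R) (e0 : 0 < e) (u v : T -> R).
Hypotheses (mu : measurable_fun D u) (mv : measurable_fun D v).

Let measurable_inv (f : T -> R) : (forall x, 0 < f x) -> measurable_fun D f ->
  measurable_fun D (fun x => (f x)^-1).
Proof.
move=> f0 mf; rewrite (_ : (fun x => _) = fun x => f x `^ (-1)).
  exact: (measurableT_comp (measurable_powR (-1))).
by apply/funext => x; rewrite powR_inv1// ltW.
Qed.

Let mden : measurable_fun D (fun x => e + u x ^+ 2 + v x ^+ 2).
Proof.
apply: measurable_funD; last exact: measurable_funX.
by apply: measurable_funD => //; exact: measurable_funX.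
Qed.

Lemma measurable_mean : measurable_fun D (fun x => mean e (u x) (v x)).
Proof.
apply: measurable_funM; last first.
  by apply: measurable_inv => // x; exact: mean_den_gt0.
apply: measurable_funM => //.
by apply: measurable_funM => //; exact: measurable_funX.
Qed.

Lemma measurable_mean_ds : measurable_fun D (fun x => mean_ds e (u x) (v x)).
Proof.
apply: measurable_funM; last first.
  apply: measurable_inv; last exact: measurable_funX.
  by move=> x; rewrite exprn_gt0// mean_den_gt0.
apply: measurable_funM => //.
  by apply: measurable_funM => //; exact: measurable_funX.
apply: measurable_funB; last exact: measurable_funX.
by apply: measurable_funD => //; exact: measurable_funX.
Qed.

Lemma measurable_mean_dt : measurable_fun D (fun x => mean_dt e (u x) (v x)).
Proof.
apply: measurable_funM; last first.
  apply: measurable_inv; last exact: measurable_funX.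
  by move=> x; rewrite exprn_gt0// mean_den_gt0.
apply: measurable_funM => //.
  by apply: measurable_funM => //; exact: measurable_funM.
by apply: measurable_funD => //; exact: measurable_funX.
Qed.

End measurable_mean.

Section mean_test_functions.
Context {R : realType} {n : nat} (Omega : set 'rV[R]_n).
Variables (e : R) (e0 : 0 < e) (phi psi : 'rV[R]_n -> R).
Hypotheses (tphi : test_function Omega phi) (tpsi : test_function Omega psi).

Let den x := e + phi x * phi x + psi x * psi x.
Let den0 x : den x != 0.
Proof. by rewrite /den gt_eqF// -!expr2 mean_den_gt0. Qed.

Let Cden k : Ck k den.
Proof.
by apply: CkD; [apply: CkD; first exact: Ck_cst|]; apply: CkM;
  (case: tphi; case: tpsi).
Qed.

Let meanE : (fun x => mean e (phi x) (psi x)) =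
  fun x => 2 * (phi x * (psi x * psi x)) * (den x)^-1.
Proof. by apply/funext => x; rewrite /mean /den !expr2. Qed.

Lemma test_mean : test_function Omega (fun x => mean e (phi x) (psi x)).
Proof.
have [Cphi [K [cK KO phi0]]] := tphi; have [Cpsi _] := tpsi; split.
  move=> k; rewrite meanE; apply: CkM; last exact: CkV.
  by apply: Ck_scale; apply: CkM => //; exact: CkM.
by exists K; split => // x /phi0; rewrite /mean => ->; rewrite mul0r mulr0 mul0r.
Qed.

Lemma gradient_mean x : gradient (fun x => mean e (phi x) (psi x)) x =
  mean_ds e (phi x) (psi x) *: gradient phi x +
  mean_dt e (phi x) (psi x) *: gradient psi x.
Proof.
apply/rowP => i; rewrite !mxE meanE.
have dphi : derivable phi x (delta_mx ord0 i) by exact: test_derivable tphi.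
have dpsi : derivable psi x (delta_mx ord0 i) by exact: test_derivable tpsi.
have dc (c : R) : derivable (fun _ : 'rV[R]_n => c) x (delta_mx ord0 i).
  exact: derivable_cst.
have dphi2 := derivable_mulf dphi dphi; have dpsi2 := derivable_mulf dpsi dpsi.
have dnum := derivable_mulf dphi dpsi2; have d2num := derivable_mulf (dc 2) dnum.
have dden : derivable den x (delta_mx ord0 i).
  exact: (derivable_addf (derivable_addf (dc e) dphi2) dpsi2).
have dinv : derivable (fun y => (den y)^-1) x (delta_mx ord0 i).
  exact: (derivableV (den0 x) dden).
rewrite (partialM d2num dinv) (partialV (den0 x) dden) (partialM (dc 2) dnum).
rewrite (partialM dphi dpsi2) /den (partialD (derivable_addf (dc e) dphi2) dpsi2).
rewrite (partialD (dc e) dphi2) !partial_cst (partialM dpsi dpsi) (partialM dphi dphi).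
move: (den0 x); rewrite /den /mean_ds /mean_dt !expr2 => d0.
by field.
Qed.

End mean_test_functions.

Lemma powR_cvg0_inv {R : realType} (x : nat -> R) (q : R) : 0 < q ->
  (forall k, 0 <= x k) -> x k `^ q @[k --> \oo] --> (0 : R) ->
  x @ \oo --> (0 : R).
Proof.
move=> q0 x0 /cvgrPdist_lt h; apply/cvgrPdist_lt => e e0.
have := h (e `^ q); rewrite powR_gt0// => /(_ isT); apply: filterS => k.
rewrite !sub0r !normrN !ger0_norm ?powR_ge0//.
rewrite !ltNge; apply: contra => ex; apply: ge0_ler_powR; rewrite ?nnegrE ?x0 ?(ltW e0) ?(ltW q0)//.
Qed.

Section truncation.
Context {R : realType} {n : nat} (n3 : (3 <= n)%N).
Variable (Omega : set 'rV[R]_n) (oO : open Omega).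
Local Notation mu := (lebesgue_rV R n).
Local Notation qs := (sobolev_exponent R n).
Let mO : measurable Omega := open_measurable_rV oO.
Implicit Types (u v phi psi : 'rV[R]_n -> R) (g h : 'rV[R]_n -> 'rV[R]_n).

Let qs1 : 1 <= qs := sobolev_exponent_ge1 n3.
Let qs0 : 0 < qs. Proof. by have := qs1; lra. Qed.

(** With errors at most a_k^(-qs) 2^(-k-1), the integrals of (a_k |phi_k - u|)^qs are summable. The
    weights give convergence at a prescribed speed almost everywhere, which the truncations need on
    {u = 0}. *)
Lemma sobolev_approx_ae u g (a : nat -> R) : (forall k, 0 < a k) ->
  sobolev_pair Omega u g ->
  exists phi : nat -> 'rV[R]_n -> R, [/\ forall k, test_function Omega (phi k),
    forall k, (\int[mu]_(x in Omega) (`|phi k x - u x| `^ qs)%:E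
               <= ((a k)^-1 `^ qs)%:E)%E,
    {ae mu, forall x, Omega x -> a k * (phi k x - u x) @[k --> \oo] --> (0 : R)} &
    L2cvg Omega (fun k => gradient (phi k)) g].
Proof.
move=> a0 ug.
pose eps k := (a k)^-1 `^ qs * (1 / (2 ^ k.+1)%:R).
have eps0 k : 0 < eps k.
  by rewrite mulr_gt0 ?powR_gt0 ?invr_gt0// divr_gt0// ltr0n expn_gt0.
have [phi [tphi cphi Lphi]] := sobolev_approx n3 oO eps0 ug.
have mu' := sobolev_pair_measurable ug.
have md k : measurable_fun Omega (fun x => phi k x - u x).
  by apply: measurable_funB => //; exact: test_measurable (tphi k) mO.
exists phi; split => //.
  move=> k; apply: (le_trans (cphi k)); rewrite lee_fin /eps -[leRHS]mulr1.
  rewrite ler_wpM2l ?powR_ge0// ler_pdivrMr ?ltr0n ?expn_gt0// mul1r ler1n.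
  by rewrite expn_gt0.
have := @ae_cvg0_of_integral _ _ _ mu Omega mO
  (fun k x => a k `^ qs * `|phi k x - u x| `^ qs).
move=> /(_ _ _ _)/wrap[].
- by move=> k; apply: measurable_funM => //; exact: measurable_normr_powR.
- by move=> k x; rewrite mulr_ge0 ?powR_ge0.
- move=> k; rewrite ge0_integralZ_EFin ?powR_ge0//;
    last exact: measurable_normr_powR.
  apply: (@le_trans _ _ ((a k `^ qs)%:E * (eps k)%:E)%E).
    by rewrite lee_wpmul2l ?lee_fin ?powR_ge0.
  rewrite -EFinM lee_fin /eps mulrA -powRM ?invr_ge0 ?(ltW (a0 k))//.
  by rewrite mulfV ?(gt_eqF (a0 k))// powR1 !mul1r.
apply: filterS => x /[apply] h.
apply/norm_cvg0P; apply: (powR_cvg0_inv qs0) => //.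
apply: cvg_trans h; apply: near_eq_cvg; apply: nearW => k.
by rewrite normrM (gtr0_norm (a0 k)) powRM// ltW.
Qed.

(** With [psi] fixed, the means of [psi] with approximations of [u] are test functions. Their
    gradients converge because the partial derivatives of [mean] are bounded by 2 and converge
    almost everywhere. *)
Lemma sobolev_pair_mean (e : R) u psi g : 0 < e -> sobolev_pair Omega u g ->
  test_function Omega psi ->
  sobolev_pair Omega (fun x => mean e (u x) (psi x))
    (fun x => mean_ds e (u x) (psi x) *: g x +
              mean_dt e (u x) (psi x) *: gradient psi x).
Proof.
move=> e0 ug tpsi.
have mu' := sobolev_pair_measurable ug.
have mpsi := test_measurable tpsi mO.
have Lg := sobolev_pair_L2field n3 oO ug.
have Lpsi := gradient_L2field mO tpsi.
apply/(sobolev_pairP n3); split.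
- exact: measurable_mean.
- apply: measurable_fieldD => //; apply: measurable_fieldZ => //.
  + exact: measurable_mean_ds.
  + by case: Lg.
  + exact: measurable_mean_dt.
  + by case: Lpsi.
move=> e' e'0.
(* The second factor makes 2^qs a_k^(-qs) <= e' for every k, so that the index [N] found below only
   has to serve the gradients. It also gives a_k >= 1, so that phi_k tends to u almost
   everywhere. *)
pose a (k : nat) : R := k.+1%:R * Num.max 1 ((e' / 2 `^ qs) `^ qs^-1)^-1.
have m1 : 1 <= Num.max 1 ((e' / 2 `^ qs) `^ qs^-1)^-1 by rewrite le_max lexx.
have a0 k : 0 < a k.
  by rewrite mulr_gt0 ?ltr0n// (lt_le_trans _ m1).
have a1 k : 1 <= a k.
  by rewrite -[leLHS]mulr1 ler_pM// ler1n.
have [phi [tphi cphi aephi Lphi]] := sobolev_approx_ae a0 ug.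
have mphi k := test_measurable (tphi k) mO.
have ae1 : {ae mu, forall x, Omega x -> phi k x @[k --> \oo] --> u x}.
  apply: filterS aephi => x /[apply] h.
  apply/subr_cvg0; apply/norm_cvg0P.
  have h' := (norm_cvg0P _).2 h.
  apply: (@squeeze_cvgr _ _ _ _ (cst 0)
    (fun k => `|a k * (phi k x - u x)|)); last 2 first.
  - exact: cvg_cst.
  - exact: h'.
  apply: nearW => k; rewrite normr_ge0 /= normrM ler_peMl//.
  by rewrite gtr0_norm.
have C0 : L2cvg Omega (fun _ : nat => gradient psi) (gradient psi).
  exact: L2cvg_cst.
have L1 : L2cvg Omega
    (fun k x => mean_ds e (phi k x) (psi x) *: gradient (phi k) x)
    (fun x => mean_ds e (u x) (psi x) *: g x).
  apply: (@L2cvgM _ _ _ mO (fun k x => mean_ds e (phi k x) (psi x))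
     (fun x => mean_ds e (u x) (psi x)) 2) => //.
  - by move=> k; exact: measurable_mean_ds.
  - exact: measurable_mean_ds.
  - by move=> k x; exact: mean_ds_le.
  - by move=> x; exact: mean_ds_le.
  - apply: filterS ae1 => x /[apply] h _; apply: cvg_mean_ds => //.
    + exact: cvg_cst.
    + exact: cvg_cst.
    + by rewrite gt_eqF// mean_den_gt0.
have L2 : L2cvg Omega
    (fun k x => mean_dt e (phi k x) (psi x) *: gradient psi x)
    (fun x => mean_dt e (u x) (psi x) *: gradient psi x).
  apply: (@L2cvgM _ _ _ mO (fun k x => mean_dt e (phi k x) (psi x))
     (fun x => mean_dt e (u x) (psi x)) 2) => //.
  - by move=> k; exact: measurable_mean_dt.
  - exact: measurable_mean_dt.
  - by move=> k x; exact: mean_dt_le.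
  - by move=> x; exact: mean_dt_le.
  - apply: filterS ae1 => x /[apply] h _; apply: cvg_mean_dt => //.
    + exact: cvg_cst.
    + exact: cvg_cst.
    + by rewrite gt_eqF// mean_den_gt0.
have [LL1 LL2 /cvgrPdist_le/(_ _ e'0)[N _ /(_ N (leqnn N))]] := L2cvgD mO L1 L2.
rewrite sub0r normrN ger0_norm ?ip_ge0// => hN.
exists (fun x => mean e (phi N x) (psi x)); split.
- exact: test_mean.
- apply: (@le_trans _ _ ((2 `^ qs)%:E *
     \int[mu]_(x in Omega) (`|phi N x - u x| `^ qs)%:E)%E).
    rewrite -ge0_integralZ_EFin ?powR_ge0//; last first.
      by apply: measurable_normr_powR; exact: measurable_funB.
    apply: ge0_le_integral => //.
    + apply/measurable_EFinP; apply: measurable_normr_powR.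
      by apply: measurable_funB; exact: measurable_mean.
    + apply/measurable_EFinP; apply: measurable_funM => //.
      by apply: measurable_normr_powR; exact: measurable_funB.
    move=> x _; rewrite lee_fin -powRM//.
    have h := mean_lipschitz (phi N x) (u x) (psi x) e0.
    by apply: ge0_ler_powR => //; rewrite ?nnegrE ?(ltW qs0)// mulr_ge0.
  apply: (@le_trans _ _ ((2 `^ qs)%:E * ((a N)^-1 `^ qs)%:E)%E).
    by rewrite lee_wpmul2l ?lee_fin ?powR_ge0.
  rewrite -EFinM lee_fin mulrC -ler_pdivlMr ?powR_gt0//.
  have -> : e' / 2 `^ qs = ((e' / 2 `^ qs) `^ qs^-1) `^ qs.
    by rewrite -powRrM mulVf ?(gt_eqF qs0)// powRr1// divr_ge0 ?powR_ge0 ?(ltW e'0).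
  apply: ge0_ler_powR; rewrite ?nnegrE ?invr_ge0 ?powR_ge0 ?(ltW (a0 N))//.
    exact: ltW.
  rewrite -[leRHS]invrK lef_pV2 ?posrE ?invr_gt0 ?powR_gt0 ?divr_gt0 ?powR_gt0//.
  apply: (@le_trans _ _ (Num.max 1 ((e' / 2 `^ qs) `^ qs^-1)^-1)).
    by rewrite le_max lexx orbT.
  by rewrite /a ler_peMl ?ler1n// (le_trans _ m1).
- have -> : gradient (fun x => mean e (phi N x) (psi x)) =
    fun x => mean_ds e (phi N x) (psi x) *: gradient (phi N) x +
             mean_dt e (phi N x) (psi x) *: gradient psi x.
    by apply/funext => x; rewrite (gradient_mean e0 (tphi N) tpsi).
  by rewrite int_sqnormE ?lee_fin//; exact: L2fieldB.
Qed.

End truncation.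

(** * Strong convergence of the truncations *)

Section truncation_limit.
Context {R : realType} {n : nat} (n3 : (3 <= n)%N).
Variable (Omega : set 'rV[R]_n) (oO : open Omega).
Local Notation mu := (lebesgue_rV R n).
Local Notation qs := (sobolev_exponent R n).
Let mO : measurable Omega := open_measurable_rV oO.
Implicit Types (u v phi psi : 'rV[R]_n -> R) (g h : 'rV[R]_n -> 'rV[R]_n).

Let inv_cvg0 : (k.+1%:R : R)^-1 @[k --> \oo] --> (0 : R).
Proof.
apply/cvgrPdist_lt => e e0; have := near_infty_natSinv_lt (PosNum e0).
by apply: filterS => k ke; rewrite sub0r normrN ger0_norm ?invr_ge0.
Qed.

(** For s nonzero these are the values of the three functions at (0, s, s). For s = 0 only the
    second limit needs an argument: there [mean_ds] is 2 t^2 / (e + t^2) <= 2 t^2 / e with 1 / e = k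
    + 1, and the assumed speed makes (k + 1) t_k^2 tend to 0. *)
Let mean_limits (s : R) (t : nat -> R) :
  k.+1%:R * (t k - s) @[k --> \oo] --> (0 : R) ->
  [/\ mean k.+1%:R^-1 s (t k) @[k --> \oo] --> s,
      mean_ds k.+1%:R^-1 s (t k) @[k --> \oo] --> (0 : R) &
      mean_dt k.+1%:R^-1 s (t k) @[k --> \oo] --> ((s != 0)%:R : R)].
Proof.
move=> h.
have k0 (k : nat) : (0 : R) < k.+1%:R by rewrite ltr0n.
have ts0 : t k - s @[k --> \oo] --> (0 : R).
  have h2 : k.+1%:R^-1 * (k.+1%:R * (t k - s)) @[k --> \oo] --> (0 * 0 : R).
    exact: cvgM.
  rewrite mul0r in h2; rewrite (_ : (fun k => _) =
    fun k => k.+1%:R^-1 * (k.+1%:R * (t k - s)))//.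
  by apply/funext => k; rewrite mulrA mulVf ?mul1r// gt_eqF.
have ts : t @ \oo --> s by apply/subr_cvg0.
have cs : s @[k --> \oo] --> s by exact: cvg_cst.
have [s0|s0] := eqVneq s 0; last first.
  have d0 : 0 + s ^+ 2 + s ^+ 2 != 0.
    by rewrite add0r -mulr2n mulrn_eq0 expf_eq0.
  split.
  - have := cvg_mean inv_cvg0 cs ts d0; rewrite (_ : mean 0 s s = s)//.
    by rewrite /mean add0r; field; rewrite add0r in d0.
  - have := cvg_mean_ds inv_cvg0 cs ts d0; rewrite (_ : mean_ds 0 s s = 0)//.
    by rewrite /mean_ds add0r subrr mulr0 mul0r.
  - have := cvg_mean_dt inv_cvg0 cs ts d0; rewrite (_ : mean_dt 0 s s = 1)//.
    by rewrite /mean_dt add0r; field; rewrite add0r in d0.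
subst s; split.
- rewrite (_ : (fun k => _) = cst 0); first exact: cvg_cst.
  by apply/funext => k; rewrite /mean mul0r mulr0 mul0r.
- have c2 : 2 * (k.+1%:R * (t k - 0) * (t k - 0)) @[k --> \oo] --> (0 : R).
    have h2 : 2 * (k.+1%:R * (t k - 0) * (t k - 0)) @[k --> \oo] -->
        (2 * (0 * 0) : R).
      by apply: cvgM; [exact: cvg_cst|exact: cvgM].
    by rewrite !mulr0 in h2.
  apply: (@squeeze_cvgr _ _ _ _ (cst 0)
    (fun k => 2 * (k.+1%:R * (t k - 0) * (t k - 0)))); last 2 first.
  + exact: cvg_cst.
  + exact: c2.
  apply: nearW => k; rewrite /mean_ds expr0n/= addr0 !subr0.
  have e0 : 0 < k.+1%:R^-1 :> R by rewrite invr_gt0.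
  have -> : k.+1%:R * t k * t k = t k ^+ 2 / k.+1%:R^-1.
    by rewrite invrK; ring.
  move: (k.+1%:R^-1) e0 => e e0; have t0 := sqr_ge0 (t k).
  have et0 : 0 < e + t k ^+ 2 by lra.
  have -> : 2 * t k ^+ 2 * (e + t k ^+ 2) / (e + t k ^+ 2) ^+ 2 =
      2 * (t k ^+ 2 / (e + t k ^+ 2)) by field; rewrite gt_eqF.
  apply/andP; split.
    by rewrite mulr_ge0// mulr_ge0// invr_ge0 ltW.
  by rewrite ler_wpM2l// ler_wpM2l// lef_pV2 ?posrE// lerDl.
- rewrite (_ : (fun k => _) = cst 0); first exact: cvg_cst.
  by apply/funext => k; rewrite /mean_dt mul0r mulr0 !mul0r.
Qed.

(* The limit of the gradients of the truncations is [1_{u <> 0} g]; since the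
   truncations also converge to [u] as distributions, this shows [g = 0] almost
   everywhere on [{u = 0}] (Stampacchia), and [g] itself is the limit. *)
Lemma sobolev_pair_truncation u g : sobolev_pair Omega u g ->
  exists (ws : nat -> 'rV[R]_n -> R) (gs : nat -> 'rV[R]_n -> 'rV[R]_n)
         (phi : nat -> 'rV[R]_n -> R),
  [/\ forall k, sobolev_pair Omega (ws k) (gs k),
      forall k, test_function Omega (phi k) /\
        forall x, `|ws k x| <= `|phi k x|,
      forall k x, `|ws k x| <= 2 * `|u x|,
      {ae mu, forall x, Omega x -> ws k x @[k --> \oo] --> u x} &
      L2cvg Omega gs g].
Proof.
move=> ug.
have mu' := sobolev_pair_measurable ug.
have Lg := sobolev_pair_L2field n3 oO ug.
have a0 (k : nat) : (0 : R) < k.+1%:R by rewrite ltr0n.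
have e0 (k : nat) : (0 : R) < k.+1%:R^-1 by rewrite invr_gt0.
have [phi [tphi _ aephi Lphi]] := sobolev_approx_ae n3 oO a0 ug.
have mphi k := test_measurable (tphi k) mO.
pose ws k x := mean k.+1%:R^-1 (u x) (phi k x).
pose gs k x := mean_ds k.+1%:R^-1 (u x) (phi k x) *: g x +
               mean_dt k.+1%:R^-1 (u x) (phi k x) *: gradient (phi k) x.
pose a x : R := (u x != 0)%:R.
have ma : measurable_fun Omega a.
  rewrite /a (_ : (fun x => _) = fun x => if u x == 0 then 0 else 1); last first.
    by apply/funext => x; case: eqVneq.
  apply: measurable_fun_if => //.
  by apply: measurable_fun_eqr.
have pws k : sobolev_pair Omega (ws k) (gs k) by exact: sobolev_pair_mean.
have ae1 : {ae mu, forall x, Omega x -> ws k x @[k --> \oo] --> u x}.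
  by apply: filterS aephi => x /[apply] /mean_limits[].
have C0 : L2cvg Omega (fun _ : nat => g) g.
  exact: L2cvg_cst.
have L1 : L2cvg Omega
    (fun k x => mean_ds k.+1%:R^-1 (u x) (phi k x) *: g x)
    (fun x => (0 : R) *: g x).
  apply: (@L2cvgM _ _ _ mO (fun k x => mean_ds k.+1%:R^-1 (u x) (phi k x))
     (cst 0) 2) => //.
  - by move=> k; exact: measurable_mean_ds.
  - by move=> k x; exact: mean_ds_le.
  - by move=> x; rewrite normr0.
  - by apply: filterS aephi => x /[apply] /mean_limits[].
have L2 : L2cvg Omega
    (fun k x => mean_dt k.+1%:R^-1 (u x) (phi k x) *: gradient (phi k) x)
    (fun x => a x *: g x).
  apply: (@L2cvgM _ _ _ mO (fun k x => mean_dt k.+1%:R^-1 (u x) (phi k x))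
     a 2) => //.
  - by move=> k; exact: measurable_mean_dt.
  - by move=> k x; exact: mean_dt_le.
  - by move=> x; rewrite /a; case: eqP; rewrite ?normr0 ?normr1// ler1n.
  - by apply: filterS aephi => x /[apply] /mean_limits[].
have L3 : L2cvg Omega gs (fun x => a x *: g x).
  have := L2cvgD mO L1 L2; congr (L2cvg _ _ _); apply/funext => x.
  by rewrite scale0r add0r.
have [Lgs Lag cgs] := L3.
have Ld := L2fieldB mO Lg Lag.
(* Both fields have the same integrals against test functions: for [g] by definition of a weak
   gradient, for its restriction to {u <> 0} by passing to the limit in the same identity for
   [ws k]. *)
have weak psi i : test_function Omega psi ->
    \int[mu]_(x in Omega) ((g x - a x *: g x) ord0 i * psi x) = 0.
  move=> tpsi.
  have Lw := L2field_test_delta oO i tpsi.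
  rewrite -(ip_test_delta Omega psi i (fun x => g x - a x *: g x)) ipBr//.
  apply/eqP; rewrite subr_eq0; apply/eqP.
  have tdpsi := test_partial i tpsi; have mdpsi := test_measurable tdpsi mO.
  have iu := integrable_mul_test n3 oO mu' (sobolev_pair_integrable n3 oO ug) tdpsi.
  have [_ c1] : mu.-integrable Omega (EFin \o (fun x => u x * partial i psi x)) /\
      \int[mu]_(x in Omega) (ws k x * partial i psi x) @[k --> \oo] -->
      \int[mu]_(x in Omega) (u x * partial i psi x).
    apply: (@Rdominated_cvg _ _ _ mu _ mO _ _
      (fun x => 2 * `|u x * partial i psi x|)) => //.
    - by move=> k; apply: measurable_funM => //; exact: measurable_mean.
    - exact: measurable_funM.
    - by apply: filterS ae1 => x /[apply] h; apply: cvgM => //; exact: cvg_cst.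
    - by apply: integrableZR => //; exact: integrable_norm.
    - move=> k x _; have h := ler_wpM2r (normr_ge0 (partial i psi x))
        (mean_le_l (u x) (phi k x) (e0 k)).
      by rewrite /ws normrM [X in _ <= 2 * X]normrM mulrA.
  rewrite (_ : ip Omega _ g = - \int[mu]_(x in Omega) (u x * partial i psi x));
    last by rewrite ip_test_delta (sobolev_pair_weak n3 oO i ug tpsi).
  rewrite -(cvg_lim (@Rhausdorff R) (L2cvg_ip mO L3 Lw)).
  apply/esym/cvg_lim; first exact: Rhausdorff.
  rewrite (_ : (fun k => _) = fun k => - \int[mu]_(x in Omega)
    (ws k x * partial i psi x)); first exact: cvgN.
  by apply/funext => k; rewrite ip_test_delta (sobolev_pair_weak n3 oO i (pws k) tpsi).
(* Since [a] takes only the values 0 and 1, the square of g - a g is its product with g, and g is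
   the gradient of [u]. *)
have gag : ip Omega (fun x => g x - a x *: g x) (fun x => g x - a x *: g x) = 0.
  rewrite -(ip_eq0_of_weak n3 oO Ld weak ug); apply: eq_Rintegral => x _.
  rewrite /a; case: eqVneq => _ /=; rewrite ?scale0r ?subr0//.
  by rewrite scale1r subrr -(scale0r (0 : 'rV[R]_n)) !dotvZl !mul0r.
exists ws, gs, phi; split; [exact: pws| | |exact: ae1|].
- by move=> k; split; [exact: tphi|move=> x; exact: mean_le_r].
- by move=> k x; exact: mean_le_l.
split; [exact: Lgs|exact: Lg|].
apply: cvg_trans cgs; apply: near_eq_cvg; apply: nearW => k.
have L4 := L2fieldB mO (Lgs k) Lag.
(* The limit may be changed from a g to g because they differ by a field of norm 0. *)
have -> : (fun x => gs k x - g x) =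
    (fun x => (gs k x - a x *: g x) - (g x - a x *: g x)).
  by apply/funext => x; rewrite opprB addrA subrK.
by rewrite (ipB_sqr mO L4 Ld) gag ipC (ip_null oO Ld L4 gag) mulr0 subr0 addr0.
Qed.

End truncation_limit.

(** * The Euler-Lagrange equation *)

Lemma powR_mul_sqr_le {R : realType} (q a b : R) : 2 < q ->
  `|a| `^ (q - 2) * b ^+ 2 <= `|a| `^ q + `|b| `^ q.
Proof.
move=> q2; have q0 : 0 <= q - 2 by lra.
have b2 : b ^+ 2 = `|b| ^+ 2 by rewrite real_normK ?num_real.
have [ab|ba] := leP `|a| `|b|.
  rewrite -[leLHS]add0r lerD ?powR_ge0// (powR_split2 b q2).
  by rewrite ler_wpM2r ?sqr_ge0//; apply: ge0_ler_powR; rewrite ?nnegrE.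
rewrite -[leLHS]addr0 lerD ?powR_ge0// (powR_split2 a q2).
rewrite ler_wpM2l ?powR_ge0// -[a ^+ 2]real_normK ?num_real// b2.
by rewrite lerXn2r ?nnegrE// ltW.
Qed.

Lemma powR_mul_le {R : realType} (q a b : R) : 2 < q ->
  Num.norm (`|a| `^ (q - 2) * a * b) <= 2 * `|a| `^ q + `|b| `^ q.
Proof.
move=> q2; have h := powR_mul_sqr_le a b q2.
have := powR_split2 a q2; have := powR_ge0 `|a| (q - 2).
move: h; move: (`|a| `^ (q - 2)) (`|a| `^ q) (`|b| `^ q) => A B C h A0 E.
rewrite -mulrA normrM (ger0_norm A0).
have : `|a * b| <= a ^+ 2 + b ^+ 2 by rewrite ler_norml; apply/andP; split; nra.
by move=> /(ler_wpM2l A0); lra.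
Qed.

Lemma linear_coef_eq0 {R : realType} (a b : R) :
  (forall t : R, `|t| <= 1 -> 0 <= t * a + t ^+ 2 * b) -> a = 0.
Proof.
move=> h; apply/eqP; case: eqVneq => // a0.
(* [c] is larger than |a|, so that t = - a / c is allowed, and larger than [b], so that the
   expression at this t, which is (a / c)^2 (b - c), is negative unless a = 0. *)
pose c := `|a| + `|b| + 1.
have na0 : 0 < `|a| by rewrite normr_gt0.
have c0 : 0 < c by rewrite /c; have := normr_ge0 b; lra.
have t1 : `|- a / c| <= 1.
  rewrite normrM normrN normfV (gtr0_norm c0) ler_pdivrMr// mul1r /c.
  by have := normr_ge0 b; lra.
have := h _ t1.
have -> : - a / c * a + (- a / c) ^+ 2 * b = (a / c) ^+ 2 * (b - c).
  by field; rewrite gt_eqF.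
have : 0 < (a / c) ^+ 2 by rewrite exprn_even_gt0//= mulf_neq0// invr_neq0// gt_eqF.
have : b - c < 0 by rewrite /c; have := ler_norm b; lra.
by move=> h1 h2; rewrite leNgt pmulr_rlt0// h1.
Qed.

Section norm_expansion.
Context d (T : measurableType d) (R : realType) (mu : {measure set T -> \bar R}).
Variables (D : set T) (mD : measurable D) (q : R) (q2 : 2 < q).
Variables (v w : T -> R).
Hypotheses (mv : measurable_fun D v) (mw : measurable_fun D w).
Hypothesis iv : mu.-integrable D (EFin \o (fun x => `|v x| `^ q)).
Hypothesis iw : mu.-integrable D (EFin \o (fun x => `|w x| `^ q)).

Lemma measurable_powR_mul (r : R) :
  measurable_fun D (fun x => `|v x| `^ r * v x * w x).
Proof.
apply: measurable_funM => //; apply: measurable_funM => //.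
exact: measurable_normr_powR.
Qed.

Lemma integrable_powR_mul :
  mu.-integrable D (EFin \o (fun x => `|v x| `^ (q - 2) * v x * w x)).
Proof.
apply: (@le_integrableR _ _ _ mu _ mD _ (fun x => 2 * `|v x| `^ q + `|w x| `^ q)).
- exact: measurable_powR_mul.
- by move=> x _; exact: powR_mul_le.
- by apply: integrableDR => //; exact: integrableZR.
Qed.

Let iE : mu.-integrable D (EFin \o
  (fun x => `|v x| `^ (q - 2) * w x ^+ 2 + `|w x| `^ q)).
Proof.
apply: integrableDR => //.
apply: (@le_integrableR _ _ _ mu _ mD _ (fun x => `|v x| `^ q + `|w x| `^ q)).
- by apply: measurable_funM; [exact: measurable_normr_powR|exact: measurable_funX].
- move=> x _; rewrite ger0_norm; last by rewrite mulr_ge0 ?powR_ge0 ?sqr_ge0.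
  exact: powR_mul_sqr_le.
- exact: integrableDR.
Qed.

Lemma integrable_powR_add (t : R) :
  mu.-integrable D (EFin \o (fun x => `|t * w x + v x| `^ q)).
Proof.
have q0 : 0 < q by exact: lt_trans q2.
apply: (@le_integrableR _ _ _ mu _ mD _ (fun x =>
  2 `^ q * (`|t| `^ q * `|w x| `^ q + `|v x| `^ q))).
- apply: measurable_normr_powR; apply: measurable_funD => //.
  exact: measurable_funM.
- move=> x _; rewrite ger0_norm ?powR_ge0// -powRM//.
  apply: le_trans (powRD_le _ _ _) => //; last exact: ltW.
  rewrite -normrM; apply: ge0_ler_powR; rewrite ?nnegrE ?addr_ge0 ?(ltW q0)//.
  exact: ler_normD.
- by apply: integrableZR => //; apply: integrableDR => //; exact: integrableZR.
Qed.

(** Integrate [powR_taylor], then bound the power 2 / q <= 1 by its tangent at the norm of [v]. An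
    upper bound is all that a first-order condition at a minimizer requires. *)
Lemma powR_norm_expansion : exists K : R, forall t : R, `|t| <= 1 ->
  (\int[mu]_(x in D) (`|t * w x + v x| `^ q)) `^ (2 / q) <=
  (\int[mu]_(x in D) (`|v x| `^ q)) `^ (2 / q) +
  2 * t * ((\int[mu]_(x in D) (`|v x| `^ q)) `^ (2 / q - 1) *
     \int[mu]_(x in D) (`|v x| `^ (q - 2) * v x * w x)) + t ^+ 2 * K.
Proof.
have q0 : 0 < q by exact: lt_trans q2.
have th0 : 0 < 2 / q by rewrite divr_gt0.
have th1 : 2 / q <= 1 by rewrite ler_pdivrMr// mul1r ltW.
set S0 := \int[mu]_(x in D) (`|v x| `^ q).
set L := \int[mu]_(x in D) (`|v x| `^ (q - 2) * v x * w x).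
have S00 : 0 <= S0 by apply: Rintegral_ge0 => x _; rewrite powR_ge0.
have tq (t : R) : `|t| <= 1 -> `|t| `^ q <= t ^+ 2.
  move=> t1; rewrite -[leRHS]real_normK ?num_real// -powR_mulrn//.
  have [->|t0] := eqVneq t 0; first by rewrite normr0 !powR0 ?gt_eqF.
  by apply: ger_powR; rewrite ?normr_gt0 ?t0// ltW.
have [S0E|S0n] := eqVneq S0 0.
  pose W := \int[mu]_(x in D) (`|w x| `^ q).
  have W0 : 0 <= W by apply: Rintegral_ge0 => x _; rewrite powR_ge0.
  exists ((2 `^ q * W) `^ (2 / q)) => t t1.
  (* The convention that 0 to a nonzero power is 0, here for the negative exponent 2 / q - 1,
     removes the linear term. *)
  rewrite S0E powR0 ?gt_eqF// powR0; last by rewrite subr_eq0 lt_eqF// ltr_pdivrMr// mul1r.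
  rewrite mul0r mulr0 !add0r.
  have -> : t ^+ 2 = (`|t| `^ q) `^ (2 / q).
    rewrite -powRrM mulrCA mulfV ?gt_eqF// mulr1 powR_mulrn//.
    by rewrite real_normK ?num_real.
  rewrite -powRM ?powR_ge0 ?mulr_ge0 ?powR_ge0//.
  apply: ge0_ler_powR.
  - exact: ltW.
  - by rewrite nnegrE; apply: Rintegral_ge0 => x _; rewrite powR_ge0.
  - by rewrite nnegrE !mulr_ge0 ?powR_ge0.
  rewrite mulrCA.
  apply: (@le_trans _ _ (\int[mu]_(x in D) (2 `^ q * (`|t| `^ q * `|w x| `^ q +
      `|v x| `^ q)))).
    apply: le_Rintegral => //; first exact: integrable_powR_add.
      by apply: integrableZR => //; apply: integrableDR => //; exact: integrableZR.
    move=> x _; rewrite -powRM//.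
    apply: le_trans (powRD_le _ _ _) => //; last exact: ltW.
    rewrite -normrM; apply: ge0_ler_powR; rewrite ?nnegrE ?addr_ge0 ?(ltW q0)//.
    exact: ler_normD.
  rewrite RintegralZl//; last by apply: integrableDR => //; exact: integrableZR.
  rewrite RintegralD//; last exact: integrableZR.
  by rewrite RintegralZl// -/S0 S0E addr0.
have S0p : 0 < S0 by rewrite lt_neqAle eq_sym S0n.
pose J := \int[mu]_(x in D) (`|v x| `^ (q - 2) * w x ^+ 2 + `|w x| `^ q).
have C0 : 0 <= taylor_const q.
  by rewrite /taylor_const !addr_ge0 ?mulr_ge0 ?powR_ge0 ?sqr_ge0 ?(ltW q0).
exists (2 / q * S0 `^ (2 / q - 1) * (taylor_const q * J)) => t t1.
set S := \int[mu]_(x in D) (`|t * w x + v x| `^ q).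
have S_le : S <= S0 + q * (t * L) + taylor_const q * (t ^+ 2 * J).
  have i1 := integrableZR mD q (integrableZR mD t integrable_powR_mul).
  have i2 := integrableZR mD (taylor_const q) (integrableZR mD (t ^+ 2) iE).
  apply: (@le_trans _ _ (\int[mu]_(x in D) (`|v x| `^ q +
     q * (t * (`|v x| `^ (q - 2) * v x * w x)) +
     taylor_const q * (t ^+ 2 * (`|v x| `^ (q - 2) * w x ^+ 2 + `|w x| `^ q))))).
    apply: le_Rintegral => //; first exact: integrable_powR_add.
      by apply: integrableDR => //; exact: integrableDR.
    move=> x _; rewrite addrC; apply: (le_trans (powR_taylor _ _ q2)).
    apply: lerD; first by rewrite [X in _ <= _ + q * X]mulrCA.
    rewrite ler_wpM2l// mulrDr exprMn mulrCA lerD2l normrM powRM//.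
    by rewrite ler_wpM2r ?powR_ge0// tq.
  rewrite (RintegralD mD (integrableDR mD iv i1) i2) (RintegralD mD iv i1).
  rewrite (RintegralZl q mD (integrableZR mD t integrable_powR_mul)).
  rewrite (RintegralZl t mD integrable_powR_mul).
  rewrite (RintegralZl (taylor_const q) mD (integrableZR mD (t ^+ 2) iE)).
  by rewrite (RintegralZl (t ^+ 2) mD iE).
have S_ge0 : 0 <= S by apply: Rintegral_ge0 => x _; rewrite powR_ge0.
apply: (le_trans (powR_le_tangent th0 th1 S_ge0 S0p)).
set c := S0 `^ (2 / q - 1).
have c0 : 0 <= c by rewrite powR_ge0.
have h1 : 0 <= 2 / q * c by rewrite mulr_ge0// ltW.
have := ler_wpM2l h1 S_le.
have -> : 2 / q * c * (S0 + q * (t * L) + taylor_const q * (t ^+ 2 * J)) =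
  2 / q * c * S0 + (2 * t * (c * L) + t ^+ 2 * (2 / q * c * (taylor_const q * J))).
  by field; rewrite gt_eqF.
by rewrite mulrBr; lra.
Qed.

End norm_expansion.

(** * The functional [f] on Sobolev pairs *)

Section dual.
Context {R : realType} {n : nat} (n3 : (3 <= n)%N).
Variable (Omega : set 'rV[R]_n) (oO : open Omega).
Variables (f : ('rV[R]_n -> R) -> R) (df : dual_W012 Omega f).
Let mO : measurable Omega := open_measurable_rV oO.

Lemma sobolev_pair_W012 u g : sobolev_pair Omega u g -> W012 Omega u.
Proof. by move=> ug; exists g. Qed.

Lemma dual_lin (a : R) u v g h : sobolev_pair Omega u g ->
  sobolev_pair Omega v h -> f (fun x => a * u x + v x) = a * f u + f v.
Proof. by move=> /sobolev_pair_W012 u0 /sobolev_pair_W012 v0; apply: df.1. Qed.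

Lemma dual_bound : exists2 C : R, 0 <= C & forall u g, sobolev_pair Omega u g ->
  f u ^+ 2 <= C * ip Omega g g.
Proof.
have [_ [C hC]] := df; exists (C ^+ 2); first exact: sqr_ge0.
move=> u g ug; have := hC _ (sobolev_pair_W012 ug).
rewrite (dirichletE n3 oO ug) poweR_EFin -EFinM lee_fin => h.
rewrite -[leLHS]real_normK ?num_real//.
have -> : C ^+ 2 * ip Omega g g = (C * ip Omega g g `^ 2^-1) ^+ 2.
  rewrite exprMn -(powR_mulrn 2 (powR_ge0 (ip Omega g g) 2^-1)).
  by rewrite -powRrM mulVf// powRr1// ip_ge0.
by rewrite lerXn2r// ?nnegrE// (le_trans _ h).
Qed.

Lemma dual_cvg us gs u g : (forall k, sobolev_pair Omega (us k) (gs k)) ->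
  sobolev_pair Omega u g -> L2cvg Omega gs g -> f (us k) @[k --> \oo] --> f u.
Proof.
move=> pus pu [Lgs Lg cgs]; have [C C0 hC] := dual_bound.
apply/cvgrPdist_le => e e0.
have e1 : 0 < e ^+ 2 / (C + 1) by rewrite divr_gt0 ?exprn_gt0//; lra.
move/cvgrPdist_le : cgs => /(_ _ e1); apply: filterS => k.
rewrite sub0r normrN ger0_norm ?ip_ge0// => hk.
have pd := sobolev_pair_lin n3 oO (-1) pu (pus k).
have := hC _ _ pd; rewrite (dual_lin (-1) pu (pus k)).
rewrite (_ : (fun x => -1 *: g x + gs k x) = (fun x => gs k x - g x)); last first.
  by apply/funext => x; rewrite scaleN1r addrC.
move=> h; rewrite -ler_sqr ?nnegrE ?(ltW e0)//.
rewrite real_normK ?num_real//.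
have -> : (f u - f (us k)) ^+ 2 = (-1 * f u + f (us k)) ^+ 2 by ring.
apply: (le_trans h); move: hk; rewrite ler_pdivlMr; last by lra.
have := ip_ge0 Omega (fun x => gs k x - g x); nra.
Qed.

End dual.

Section euler_lagrange.
Context {R : realType} {n : nat} (n3 : (3 <= n)%N).
Variable (Omega : set 'rV[R]_n) (oO : open Omega).
Local Notation mu := (lebesgue_rV R n).
Let mO : measurable Omega := open_measurable_rV oO.
Variables (p : R) (p1 : 1 < p).
Local Notation q := (2 * p / (p - 1)).
Variables (f : ('rV[R]_n -> R) -> R) (df : dual_W012 Omega f).
Variables (v0 : 'rV[R]_n -> R) (hv0 : G_minimizer Omega p f v0).
Hypothesis fin_v0 : (conj_power_int Omega p v0 < +oo)%E.
Local Notation V0 := (optimal_potential Omega p v0).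
Local Notation S0 := (fine (conj_power_int Omega p v0)).

Let p0 : 0 < p. Proof. by have := p1; lra. Qed.
Let pm1 : 0 < p - 1. Proof. by have := p1; lra. Qed.

Lemma conj_exponent_gt2 : 2 < q.
Proof. by rewrite ltr_pdivlMr//; lra. Qed.
Let q2 := conj_exponent_gt2.
Let q0 : 0 < q. Proof. by have := q2; lra. Qed.

Lemma conj_exponentB2 : q - 2 = 2 / (p - 1).
Proof. by field; rewrite gt_eqF. Qed.

Lemma conj_exponent_inv : 2 / q = (p - 1) / p.
Proof. by field; rewrite !gt_eqF. Qed.

Let th_subr1 : 2 / q - 1 = - p^-1.
Proof. by rewrite conj_exponent_inv; field; rewrite gt_eqF. Qed.

Let g0 := weak_gradient Omega v0.
Lemma minimizer_pair : sobolev_pair Omega v0 g0.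
Proof.
have [[g ?] _] := hv0; rewrite /g0 /weak_gradient.
by apply: (xgetPex (fun=> 0)); exists g.
Qed.
Let pv0 := minimizer_pair.
Let mv0 := sobolev_pair_measurable pv0.
Let Lg0 := sobolev_pair_L2field n3 oO pv0.

Lemma minimizer_integrable :
  mu.-integrable Omega (EFin \o (fun x => `|v0 x| `^ q)).
Proof.
apply/integrableP_ge0; first exact: measurable_normr_powR.
  by move=> x _; rewrite powR_ge0.
exact: fin_v0.
Qed.
Let iv0 := minimizer_integrable.

Lemma optimal_potential_ge0 x : 0 <= V0 x.
Proof. by rewrite mulr_ge0 ?powR_ge0. Qed.

Lemma measurable_optimal_potential : measurable_fun Omega V0.
Proof. by apply: measurable_funM => //; exact: measurable_normr_powR. Qed.

(** As -1 / p = 2 / q - 1, this identifies V0 v0 with the derivative at v0 of half the squared L^q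
    norm. *)
Lemma optimal_potential_mulr x (w : R) : V0 x * v0 x * w =
  S0 `^ (- p^-1) * (`|v0 x| `^ (q - 2) * v0 x * w).
Proof. by rewrite /optimal_potential conj_exponentB2 !mulrA. Qed.

Lemma G_functionalE u g : sobolev_pair Omega u g ->
  mu.-integrable Omega (EFin \o (fun x => `|u x| `^ q)) ->
  G_functional Omega p f u = (2^-1 * ip Omega g g +
    2^-1 * (\int[mu]_(x in Omega) (`|u x| `^ q)) `^ (2 / q) - f u)%:E.
Proof.
move=> ug iu; rewrite /G_functional (dirichletE n3 oO ug) /conj_power_int.
by rewrite -EFin_Rintegral// poweR_EFin conj_exponent_inv.
Qed.

(** By minimality and the expansion of the norm, 0 <= G(v0 + t w) - G(v0) <= t a + t^2 b for |t| <=
    1, where a is the first variation. Hence a = 0. *)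
Lemma euler_lagrange_Lq w h : sobolev_pair Omega w h ->
  mu.-integrable Omega (EFin \o (fun x => `|w x| `^ q)) ->
  f w = ip Omega g0 h + \int[mu]_(x in Omega) (V0 x * v0 x * w x).
Proof.
move=> wh iw.
have mw := sobolev_pair_measurable wh.
have Lh := sobolev_pair_L2field n3 oO wh.
have [K hK] := powR_norm_expansion mO q2 mv0 mw iv0 iw.
have EL : \int[mu]_(x in Omega) (V0 x * v0 x * w x) =
    S0 `^ (2 / q - 1) * \int[mu]_(x in Omega) (`|v0 x| `^ (q - 2) * v0 x * w x).
  rewrite -RintegralZl//; last exact: integrable_powR_mul.
  by apply: eq_Rintegral => x _; rewrite optimal_potential_mulr th_subr1.
apply/esym/eqP; rewrite -subr_eq0; apply/eqP.
apply: (@linear_coef_eq0 _ _ (2^-1 * ip Omega h h + 2^-1 * K)) => t t1.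
have pt := sobolev_pair_lin n3 oO t wh pv0.
have := hv0.2 _ (sobolev_pair_W012 pt).
rewrite (G_functionalE pt); last exact: integrable_powR_add.
rewrite (G_functionalE pv0 iv0) lee_fin (dual_lin df t wh pv0).
have Lth := L2fieldZ mO t Lh.
rewrite (ipD_sqr mO Lth Lg0) ipZl// ipZr// ipZl// (ipC _ h g0).
have := hK t t1; rewrite EL.
rewrite -[fine _]/(\int[mu]_(x in Omega) (`|v0 x| `^ q)).
set A := (\int[mu]_(x in Omega) (`|t * w x + v0 x| `^ q)) `^ (2 / q).
set B := (\int[mu]_(x in Omega) (`|v0 x| `^ q)) `^ (2 / q).
set c := (\int[mu]_(x in Omega) (`|v0 x| `^ q)) `^ (2 / q - 1).
set L := \int[mu]_(x in Omega) (`|v0 x| `^ (q - 2) * v0 x * w x).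
move=> h1 h2.
have -> : t * (ip Omega g0 h + c * L - f w) + t ^+ 2 *
    (2^-1 * ip Omega h h + 2^-1 * K) =
  2^-1 * (2 * t * (c * L) + t ^+ 2 * K) + (2^-1 * (t * (t * ip Omega h h)) +
     t * ip Omega g0 h - t * f w) by field.
lra.
Qed.

Lemma integral_optimal_potential_sqr :
  \int[mu]_(x in Omega) (V0 x * v0 x * v0 x) = S0 `^ (2 / q).
Proof.
under eq_Rintegral => x _.
  rewrite optimal_potential_mulr -mulrA -expr2 -powR_split2//; over.
rewrite /= RintegralZl// -[\int[mu]_(_ in _) _]/S0.
have S00 : 0 <= S0 by apply: Rintegral_ge0 => x _; rewrite powR_ge0.
rewrite -th_subr1; have [->|S0n] := eqVneq S0 0.
  by rewrite mulr0 powR0// gt_eqF// divr_gt0.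
by rewrite -[X in _ * X]powRr1// -powRD ?S0n ?implybT// subrK.
Qed.

Lemma integrable_optimal_potential_sqr :
  mu.-integrable Omega (EFin \o (fun x => V0 x * v0 x ^+ 2)).
Proof.
apply: (@eq_integrable _ _ _ mu _ mO (EFin \o (fun x => S0 `^ (- p^-1) * `|v0 x| `^ q))).
  move=> x _; rewrite /= [in RHS]expr2 [in RHS]mulrA optimal_potential_mulr.
  by rewrite (powR_split2 (v0 x) q2) expr2 !mulrA.
exact: integrableZR.
Qed.

Let norm_optimal_le x (w : R) :
  `|V0 x * v0 x * w| <= V0 x * v0 x ^+ 2 + V0 x * w ^+ 2.
Proof.
rewrite -mulrA normrM (ger0_norm (optimal_potential_ge0 x)) -mulrDr.
rewrite ler_wpM2l ?optimal_potential_ge0// ler_norml.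
by apply/andP; split; nra.
Qed.

Lemma integrable_optimal_potential_mul (w : 'rV[R]_n -> R) : measurable_fun Omega w ->
  mu.-integrable Omega (EFin \o (fun x => V0 x * w x ^+ 2)) ->
  mu.-integrable Omega (EFin \o (fun x => V0 x * v0 x * w x)).
Proof.
move=> mw iw; apply: (@le_integrableR _ _ _ mu _ mO _
  (fun x => V0 x * v0 x ^+ 2 + V0 x * w x ^+ 2)).
- apply: measurable_funM => //; apply: measurable_funM => //.
  exact: measurable_optimal_potential.
- by move=> x _; exact: norm_optimal_le.
- by apply: integrableDR => //; exact: integrable_optimal_potential_sqr.
Qed.

Lemma euler_lagrange u g : sobolev_pair Omega u g ->
  mu.-integrable Omega (EFin \o (fun x => V0 x * u x ^+ 2)) ->
  f u = ip Omega g0 g + \int[mu]_(x in Omega) (V0 x * v0 x * u x).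
Proof.
move=> ug iu; have mu' := sobolev_pair_measurable ug.
have [ws [gs [phi [pws hphi hu aews Lgs]]]] := sobolev_pair_truncation n3 oO ug.
have mws k := sobolev_pair_measurable (pws k).
have iVu := integrable_optimal_potential_mul mu' iu.
have [_ c1] : mu.-integrable Omega (EFin \o (fun x => V0 x * v0 x * u x)) /\
    \int[mu]_(x in Omega) (V0 x * v0 x * ws k x) @[k --> \oo] -->
    \int[mu]_(x in Omega) (V0 x * v0 x * u x).
  apply: (@Rdominated_cvg _ _ _ mu _ mO _ _
    (fun x => 2 * `|V0 x * v0 x * u x|)) => //.
  - move=> k; apply: measurable_funM => //; apply: measurable_funM => //.
    exact: measurable_optimal_potential.
  - exact: integrable_measurable iVu.
  - by apply: filterS aews => x /[apply] h; apply: cvgM => //; exact: cvg_cst.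
  - by apply: integrableZR => //; exact: integrable_norm.
  - move=> k x _; have h := ler_wpM2l (normr_ge0 (V0 x * v0 x)) (hu k x).
    by rewrite normrM [X in _ <= 2 * X]normrM mulrCA.
rewrite -(cvg_lim (@Rhausdorff R) (dual_cvg n3 oO df pws ug Lgs)).
apply: cvg_lim; first exact: Rhausdorff.
rewrite (_ : (fun k => _) = fun k => ip Omega g0 (gs k) +
    \int[mu]_(x in Omega) (V0 x * v0 x * ws k x)).
  by apply: cvgD => //; exact: L2cvg_ip.
(* [ws k] is in L^q because it is dominated by a test function, although [u] need not be. *)
apply/funext => k; apply: euler_lagrange_Lq => //.
have [tphi wphi] := hphi k.
apply: (@le_integrableR _ _ _ mu _ mO _ (fun x => `|phi k x| `^ q)).
- exact: measurable_normr_powR.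
- move=> x _; rewrite ger0_norm ?powR_ge0//.
  by apply: ge0_ler_powR; rewrite ?nnegrE ?(ltW q0).
- exact: test_powR_integrable q0 tphi mO.
Qed.

(** By the Euler-Lagrange equation for [u] and for v0, the functional of V0 at [u] exceeds G(v0) by
    exactly half of |g - g0|^2 plus half of the integral of V0 (u - v0)^2; these are [P1] and
    [P2]. *)
Lemma energy_optimal_ge :
  (G_functional Omega p f v0 <= energy Omega f (fun x => (V0 x)%:E))%E.
Proof.
apply: le_ereal_inf_tmp => _ [u [g ug] <-].
have mu' := sobolev_pair_measurable ug.
have Lg := sobolev_pair_L2field n3 oO ug.
rewrite /energy_functional (dirichletE n3 oO ug) (G_functionalE pv0 iv0).
under eq_integral do rewrite -EFinM.
have mVu : measurable_fun Omega (fun x => V0 x * u x ^+ 2).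
  by apply: measurable_funM; [exact: measurable_optimal_potential|exact: measurable_funX].
have Vu0 x : 0 <= V0 x * u x ^+ 2 by rewrite mulr_ge0 ?sqr_ge0 ?optimal_potential_ge0.
(* If the integral of V0 u^2 is infinite, so is the functional at [u], and there is nothing to
   compare. *)
have [Iu|] := ltP (\int[mu]_(x in Omega) (V0 x * u x ^+ 2)%:E)%E +oo%E; last first.
  rewrite leye_eq => /eqP ->.
  by rewrite -EFinM gt0_muley ?lte_fin ?invr_gt0// addey// addye// leey.
have iu : mu.-integrable Omega (EFin \o (fun x => V0 x * u x ^+ 2)).
  by apply/integrableP_ge0.
rewrite -EFin_Rintegral// -[leRHS]/((2^-1 * ip Omega g g + 2^-1 *
  \int[mu]_(x in Omega) (V0 x * u x ^+ 2) - f u)%:E) lee_fin.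
have E1 := euler_lagrange ug iu.
have E0 := euler_lagrange pv0 integrable_optimal_potential_sqr.
rewrite integral_optimal_potential_sqr in E0.
have P1 := ip_ge0 Omega (fun x => g x - g0 x).
rewrite (ipB_sqr mO Lg Lg0) (ipC _ g g0) in P1.
have P2 : 0 <= \int[mu]_(x in Omega) (V0 x * (u x - v0 x) ^+ 2).
  by apply: Rintegral_ge0 => x _; rewrite mulr_ge0 ?sqr_ge0 ?optimal_potential_ge0.
have iVu := integrable_optimal_potential_mul mu' iu.
have i0 := integrable_optimal_potential_sqr.
have E2 : \int[mu]_(x in Omega) (V0 x * (u x - v0 x) ^+ 2) =
    \int[mu]_(x in Omega) (V0 x * u x ^+ 2) -
    2 * \int[mu]_(x in Omega) (V0 x * v0 x * u x) + S0 `^ (2 / q).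
  rewrite -integral_optimal_potential_sqr.
  have -> : \int[mu]_(x in Omega) (V0 x * v0 x * v0 x) =
    \int[mu]_(x in Omega) (V0 x * v0 x ^+ 2).
    by apply: eq_Rintegral => x _; rewrite expr2 mulrA.
  rewrite -(RintegralZl 2 mO iVu) -RintegralB//; last exact: integrableZR.
  rewrite -RintegralD//; last by apply: integrableBR => //; exact: integrableZR.
  by apply: eq_Rintegral => x _; ring.
rewrite E2 in P2; rewrite -[\int[mu]_(x in Omega) (`|v0 x| `^ _)]/S0.
lra.
Qed.

End euler_lagrange.

(** * Stability of Hoelder's inequality *)

Section stability.
Context d (T : measurableType d) (R : realType) (mu : {measure set T -> \bar R}).
Variables (D : set T) (mD : measurable D) (r : R) (r1 : 1 < r) (r2 : r <= 2).
Variables (s t : T -> R).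
Hypotheses (ms : measurable_fun D s) (mt : measurable_fun D t).
Hypothesis is_ : mu.-integrable D (EFin \o (fun x => `|s x| `^ r)).
Hypothesis it : mu.-integrable D (EFin \o (fun x => `|t x| `^ r)).
Hypothesis s1 : \int[mu]_(x in D) (`|s x| `^ r) <= 1.
Hypothesis t1 : \int[mu]_(x in D) (`|t x| `^ r) <= 1.

Let r0 : 0 < r. Proof. exact: lt_trans r1. Qed.
Let rm1 : 0 < r - 1. Proof. by rewrite subr_gt0. Qed.
Let rV1 : 0 <= 1 - r^-1. Proof. by rewrite subr_ge0 invf_le1// ltW. Qed.

Lemma integrable_young :
  mu.-integrable D (EFin \o (fun x => `|t x| `^ (r - 2) * t x * s x)).
Proof.
apply: (@le_integrableR _ _ _ mu _ mD _
  (fun x => r^-1 * `|s x| `^ r + (1 - r^-1) * `|t x| `^ r)).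
- apply: measurable_funM => //; apply: measurable_funM => //.
  exact: measurable_normr_powR.
- move=> x _; have h1 := young_powR (s x) (t x) r1.
  have := young_powR (- s x) (t x) r1; rewrite normrN mulrN => h2.
  rewrite ler_norml; apply/andP; split; move: h1 h2; rewrite (mulrC r^-1) (mulrC (1 - r^-1)); lra.
- by apply: integrableDR => //; exact: integrableZR.
Qed.

Definition bregman x := `|s x| `^ r / r + `|t x| `^ r * (1 - r^-1) -
  `|t x| `^ (r - 2) * t x * s x.

Lemma integrable_bregman : mu.-integrable D (EFin \o bregman).
Proof.
apply: (integrableBR mD _ integrable_young).
apply: (@eq_integrable _ _ _ mu _ mD (EFin \o
  (fun x => r^-1 * `|s x| `^ r + (1 - r^-1) * `|t x| `^ r))).
  by move=> x _; rewrite /= (mulrC r^-1) (mulrC (1 - _)).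
by apply: integrableDR => //; exact: integrableZR.
Qed.

(** The weights 1 / r and 1 - 1 / r of the two norms add up to 1, and both norms are at most 1. *)
Lemma integral_bregman_le : \int[mu]_(x in D) bregman x <=
  1 - \int[mu]_(x in D) (`|t x| `^ (r - 2) * t x * s x).
Proof.
have i1 := integrableZR mD r^-1 is_; have i2 := integrableZR mD (1 - r^-1) it.
have -> : \int[mu]_(x in D) bregman x = \int[mu]_(x in D)
   (r^-1 * `|s x| `^ r + (1 - r^-1) * `|t x| `^ r - `|t x| `^ (r - 2) * t x * s x).
  by apply: eq_Rintegral => x _; rewrite /bregman (mulrC r^-1) (mulrC (1 - _)).
rewrite (RintegralB mD (integrableDR mD i1 i2) integrable_young).
rewrite (RintegralD mD i1 i2) (RintegralZl r^-1 mD is_).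
rewrite (RintegralZl (1 - r^-1) mD it) lerD2r.
have rV0 : 0 <= r^-1 by rewrite invr_ge0 ltW.
have := ler_wpM2l rV0 s1; have := ler_wpM2l rV1 t1; lra.
Qed.

Let wgt x := (s x - t x) ^+ 2 * (`|s x| + `|t x|) `^ (r - 2).

Let wgt_le x : wgt x <= 8 / (r - 1) * bregman x.
Proof.
have := bregman_powR (s x) (t x) r1 r2; rewrite -/(bregman x) -/(wgt x) => h.
have c0 : 0 <= 8 / (r - 1) by rewrite divr_ge0// ltW.
have := ler_wpM2l c0 h; congr (_ <= _).
by field; rewrite gt_eqF.
Qed.

Let iwgt : mu.-integrable D (EFin \o wgt).
Proof.
apply: (@le_integrableR _ _ _ mu _ mD _ (fun x => 8 / (r - 1) * bregman x)).
- apply: measurable_funM.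
    by apply: measurable_funX; exact: measurable_funB.
  apply: (measurableT_comp (measurable_powR (r - 2))).
  by apply: measurable_funD; exact: (measurableT_comp (@normr_measurable R setT)).
- move=> x _; rewrite ger0_norm ?wgt_le//.
  by rewrite /wgt mulr_ge0 ?sqr_ge0 ?powR_ge0.
- by apply: integrableZR => //; exact: integrable_bregman.
Qed.

Let isum : mu.-integrable D (EFin \o (fun x => (`|s x| + `|t x|) `^ r)).
Proof.
apply: (@le_integrableR _ _ _ mu _ mD _ (fun x => 2 `^ r * (`|s x| `^ r + `|t x| `^ r))).
- apply: (measurableT_comp (measurable_powR r)).
  by apply: measurable_funD; exact: (measurableT_comp (@normr_measurable R setT)).
- by move=> x _; rewrite ger0_norm ?powR_ge0//; apply: powRD_le => //; exact: ltW.
- by apply: integrableZR => //; exact: integrableDR.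
Qed.

(** The 8 is 2^2 (1 + 1), a bound for 2^r times the sum of the two norms. *)
Let sum_le : \int[mu]_(x in D) ((`|s x| + `|t x|) `^ r) <= 8.
Proof.
apply: (@le_trans _ _ (\int[mu]_(x in D) (2 `^ r * (`|s x| `^ r + `|t x| `^ r)))).
  apply: le_Rintegral => //.
    by apply: integrableZR => //; exact: integrableDR.
  by move=> x _; apply: powRD_le => //; exact: ltW.
rewrite (RintegralZl (2 `^ r) mD (integrableDR mD is_ it)) RintegralD//.
have h : 2 `^ r <= 2 `^ 2 :> R by apply: ler_powR; rewrite ?ler1n.
have h0 : 0 <= 2 `^ r :> R by rewrite powR_ge0.
rewrite (powR_mulrn 2) // in h.
have h1 := lerD s1 t1; have := ler_wpM2l h0 h1.
have E : (2 : R) ^+ 2 = 4 by ring.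
by move=> /le_trans; apply; rewrite E in h; lra.
Qed.

Lemma integrable_diff_powR :
  mu.-integrable D (EFin \o (fun x => `|s x - t x| `^ r)).
Proof.
apply: (@le_integrableR _ _ _ mu _ mD _ (fun x => (`|s x| + `|t x|) `^ r)) => //.
- by apply: measurable_normr_powR; exact: measurable_funB.
- move=> x _; rewrite ger0_norm ?powR_ge0//.
  apply: ge0_ler_powR; rewrite ?nnegrE ?addr_ge0 ?(ltW r0)//.
  exact: ler_normB.
Qed.

Let diff_le (e : R) : 0 < e -> \int[mu]_(x in D) (`|s x - t x| `^ r) <=
  e `^ (r - 2) * \int[mu]_(x in D) wgt x + e `^ r * 8.
Proof.
move=> e0; apply: (@le_trans _ _ (\int[mu]_(x in D) (e `^ (r - 2) * wgt x +
    e `^ r * (`|s x| + `|t x|) `^ r))).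
  apply: le_Rintegral => //; first exact: integrable_diff_powR.
    by apply: integrableDR => //; exact: integrableZR.
  move=> x _; rewrite /wgt -[(s x - t x) ^+ 2]real_normK ?num_real//.
  by apply: powR_interpolate => //; exact: ler_normB.
rewrite (RintegralD mD (integrableZR mD _ iwgt) (integrableZR mD _ isum)).
rewrite (RintegralZl _ mD iwgt) (RintegralZl _ mD isum).
by rewrite lerD2l ler_wpM2l ?powR_ge0.
Qed.

(** In substance Hoelder's inequality with exponents 2 / r and 2 / (2 - r), obtained by choosing the
    free parameter of [diff_le], which also covers r = 2. *)
Lemma diff_powR_le_bregman :
  (\int[mu]_(x in D) (`|s x - t x| `^ r)) `^ (2 / r) <=
  648 / (r - 1) * \int[mu]_(x in D) bregman x.
Proof.
set X := \int[mu]_(x in D) (`|s x - t x| `^ r).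
set I := \int[mu]_(x in D) wgt x.
have X0 : 0 <= X by apply: Rintegral_ge0 => x _; rewrite powR_ge0.
have I0 : 0 <= I.
  by apply: Rintegral_ge0 => x _; rewrite /wgt mulr_ge0 ?sqr_ge0 ?powR_ge0.
have IB : I <= 8 / (r - 1) * \int[mu]_(x in D) bregman x.
  rewrite -(RintegralZl _ mD integrable_bregman); apply: le_Rintegral => //.
  by apply: integrableZR => //; exact: integrable_bregman.
have r20 : 0 < 2 / r by rewrite divr_gt0.
suff XI : X `^ (2 / r) <= 81 * I.
  apply: (le_trans XI); have := ler_wpM2l (ler0n R 81) IB.
  by rewrite !mulrA -natrM.
have [IE|In] := eqVneq I 0.
  suff -> : X = 0 by rewrite powR0 ?gt_eqF// mulr_ge0.
  apply/eqP; case: eqVneq => // Xn0.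
  have Xp : 0 < X by rewrite lt_neqAle eq_sym Xn0.
  (* For this e the bound [diff_le] reads X <= X / 2. *)
  have e0 : 0 < (X / 16) `^ r^-1 by rewrite powR_gt0// divr_gt0.
  have := diff_le e0; rewrite -/X -/I IE mulr0 add0r.
  rewrite -powRrM mulVf ?gt_eqF// powRr1; last by rewrite divr_ge0.
  lra.
have Ip : 0 < I by rewrite lt_neqAle eq_sym In.
(* With e the square root of I, both e^(r-2) I and e^r are I^(r/2), so that X <= 9 I^(r/2). *)
have e0 : 0 < I `^ 2^-1 by rewrite powR_gt0.
have := diff_le e0; rewrite -/X -/I -!powRrM.
have -> : I `^ (2^-1 * (r - 2)) * I = I `^ (2^-1 * r).
  rewrite -[X in _ * X]powRr1//.
  rewrite -powRD; last by rewrite In implybT.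
  by congr (_ `^ _); lra.
have -> : I `^ (2^-1 * r) + I `^ (2^-1 * r) * 8 = 9 * I `^ (2^-1 * r) by ring.
move=> XI.
have : X `^ (2 / r) <= (9 * I `^ (2^-1 * r)) `^ (2 / r).
  apply: ge0_ler_powR => //; first exact: ltW.
  by rewrite nnegrE mulr_ge0 ?powR_ge0.
move=> /le_trans; apply.
rewrite powRM ?powR_ge0// -powRrM.
have -> : 2^-1 * r * (2 / r) = 1 by field; rewrite gt_eqF.
rewrite powRr1// ler_wpM2r//.
(* The power 2 / r turns 9 into 9^(2/r), which is at most 9^2 since r >= 1. *)
have -> : 81 = 9 `^ 2 :> R by rewrite (powR_mulrn 2)// -natrX.
apply: ler_powR; first by rewrite ler1n.
by rewrite ler_pdivrMr// ler_peMr// ltW.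
Qed.

End stability.

(** * The minimizer is not zero *)

Section nontrivial.
Context {R : realType} {n : nat} (n3 : (3 <= n)%N).
Variable (Omega : set 'rV[R]_n) (oO : open Omega).
Local Notation mu := (lebesgue_rV R n).
Let mO : measurable Omega := open_measurable_rV oO.
Variables (p : R) (p1 : 1 < p).
Variables (f : ('rV[R]_n -> R) -> R) (df : dual_W012 Omega f).
Variables (v0 : 'rV[R]_n -> R) (hv0 : G_minimizer Omega p f v0).
Hypothesis fin_v0 : (conj_power_int Omega p v0 < +oo)%E.

(** Otherwise v0 = 0 almost everywhere and V0 = 0, so the equation reduces f(u) to the pairing of
    the gradients of v0 and u. The former is weakly zero, whence f = 0. *)
Lemma minimizer_conj_power_gt0 : nonzero_dual Omega f ->
  0 < fine (conj_power_int Omega p v0).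
Proof.
move=> [u [g ug] fu]; have S0 : 0 <= fine (conj_power_int Omega p v0).
  by apply: Rintegral_ge0 => x _; rewrite powR_ge0.
rewrite lt_neqAle S0 andbT eq_sym; apply/eqP => SE; apply: fu.
(* The convention that 0 to the power -1 / p is 0 makes V0 vanish everywhere, so the equation
   applies to every [u]. *)
have V00 x : optimal_potential Omega p v0 x = 0.
  by rewrite /optimal_potential SE powR0 ?mul0r// oppr_eq0 invr_eq0 gt_eqF// (lt_trans _ p1).
have pv0 := minimizer_pair hv0.
have mv0 := sobolev_pair_measurable pv0.
have iv0 := minimizer_integrable hv0 fin_v0.
rewrite (euler_lagrange n3 oO p1 df hv0 fin_v0 ug); last first.
  apply: (@eq_integrable _ _ _ mu _ mO (cst 0%E)); last exact: integrable0.
  by move=> x _; rewrite /= V00 mul0r.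
under eq_Rintegral do rewrite V00 !mul0r.
rewrite Rintegral_cst// mul0r addr0.
apply: (ip_eq0_of_weak n3 oO (sobolev_pair_L2field n3 oO pv0) _ ug) => psi i tpsi.
rewrite (sobolev_pair_weak n3 oO i pv0 tpsi).
have v0ae : ae_eq mu Omega
    (fun x => (`|v0 x| `^ (2 * p / (p - 1)))%:E) (cst 0%E).
  apply/(ae_eq_integral_abs _ mO); first by case/integrableP : iv0.
  under eq_integral do rewrite /= ger0_norm ?powR_ge0//.
  by rewrite -(EFin_Rintegral mO iv0) -[RHS]/(0%:E) -SE.
rewrite /Rintegral (ae_eq_integral (cst 0%E)) ?integral0 ?oppr0//.
  apply/measurable_EFinP; apply: measurable_funM => //.
  exact: test_measurable (test_partial i tpsi) mO.
apply: filterS v0ae => x /[apply] -[] /powR_eq0_eq0/normr0_eq0 ->.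
by rewrite mul0r.
Qed.

End nontrivial.

(** * Stability for the potentials V and V0 *)

Section hoelder_stability.
Context {R : realType} {n : nat} (n3 : (3 <= n)%N).
Variable (Omega : set 'rV[R]_n) (oO : open Omega).
Local Notation mu := (lebesgue_rV R n).
Let mO : measurable Omega := open_measurable_rV oO.
Variables (p : R) (p1 : 1 < p).
Local Notation q := (2 * p / (p - 1)).
Variables (v0 : 'rV[R]_n -> R) (mv0 : measurable_fun Omega v0).
Hypothesis iv0 : mu.-integrable Omega (EFin \o (fun x => `|v0 x| `^ q)).
Local Notation V0 := (optimal_potential Omega p v0).
Local Notation S0 := (fine (conj_power_int Omega p v0)).
Hypothesis S00 : 0 < S0.
Local Notation kappa := (S0 `^ (2 / q)).
Variables (W : 'rV[R]_n -> R) (mW : measurable_fun Omega W).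
Hypothesis iW : mu.-integrable Omega (EFin \o (fun x => `|W x| `^ p)).
Hypothesis W1 : \int[mu]_(x in Omega) (`|W x| `^ p) <= 1.

Let p0 : 0 < p. Proof. by have := p1; lra. Qed.
Let pm1 : 0 < p - 1. Proof. by have := p1; lra. Qed.
Let V0_ge0 x : 0 <= V0 x. Proof. exact: optimal_potential_ge0. Qed.
Let mV0 : measurable_fun Omega V0.
Proof. by apply: measurable_funM => //; exact: measurable_normr_powR. Qed.

Lemma kappa_gt0 : 0 < kappa. Proof. by rewrite powR_gt0. Qed.

Lemma optimal_potential_powR x : V0 x `^ p = S0^-1 * `|v0 x| `^ q.
Proof.
rewrite /optimal_potential powRM ?powR_ge0// -!powRrM mulNr mulVf ?gt_eqF//.
by rewrite powR_inv1 ?(ltW S00)// mulrAC.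
Qed.

(** The equality case of Hoelder's inequality: V0^(p-1) is v0^2 normalized in L^(p'), so that
    pairing with it is pairing with v0^2. *)
Lemma optimal_potential_powR_subr1 x : V0 x `^ (p - 1) = kappa^-1 * v0 x ^+ 2.
Proof.
rewrite /optimal_potential powRM ?powR_ge0// -!powRrM divfK ?gt_eqF//.
rewrite powR_mulrn// real_normK ?num_real// -powRN; congr (_ `^ _ * _).
by field; rewrite !gt_eqF.
Qed.

Lemma integrable_optimal_potential_powR :
  mu.-integrable Omega (EFin \o (fun x => V0 x `^ p)).
Proof.
apply: (@eq_integrable _ _ _ mu _ mO (EFin \o (fun x => S0^-1 * `|v0 x| `^ q))).
  by move=> x _; rewrite /= optimal_potential_powR.
exact: integrableZR.
Qed.

Lemma integral_optimal_potential_powR :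
  \int[mu]_(x in Omega) (V0 x `^ p) = 1.
Proof.
under eq_Rintegral do rewrite optimal_potential_powR.
by rewrite RintegralZl// -[Rintegral _ _ _]/S0 mulVf ?gt_eqF.
Qed.

(** The base point of the divergence is V0, where the derivative of |.|^p / p is V0^(p-1), that is
    v0^2 divided by [kappa]. *)
Lemma hoelder_stability_lt2 : p < 2 ->
  [/\ mu.-integrable Omega (EFin \o (fun x => W x * v0 x ^+ 2)),
   mu.-integrable Omega (EFin \o (fun x => `|W x - V0 x| `^ p)) &
   (\int[mu]_(x in Omega) (`|W x - V0 x| `^ p)) `^ (2 / p) <=
   648 / (p - 1) * (1 - kappa^-1 * \int[mu]_(x in Omega) (W x * v0 x ^+ 2))].
Proof.
move=> /ltW p2.
have V0p x : `|V0 x| `^ p = V0 x `^ p by rewrite ger0_norm.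
have iV : mu.-integrable Omega (EFin \o (fun x => `|V0 x| `^ p)).
  apply: eq_integrable integrable_optimal_potential_powR => // x _.
  by rewrite /= V0p.
have V1 : \int[mu]_(x in Omega) (`|V0 x| `^ p) <= 1.
  by under eq_Rintegral do rewrite V0p; rewrite integral_optimal_potential_powR.
have E x : `|V0 x| `^ (p - 2) * V0 x * W x = kappa^-1 * (W x * v0 x ^+ 2).
  rewrite -[X in _ * X * _]ger0_norm// (_ : p - 2 = p - 1 - 1); last by ring.
  by rewrite normr_powRM// ger0_norm// optimal_potential_powR_subr1; ring.
have iy := integrable_young mO p1 mW mV0 iW iV.
have iWv : mu.-integrable Omega (EFin \o (fun x => W x * v0 x ^+ 2)).
  apply: eq_integrable (integrableZR mO kappa iy) => // x _ /=.
  by rewrite E mulrA mulfV ?mul1r// gt_eqF// kappa_gt0.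
split => //; first exact: integrable_diff_powR.
apply: (le_trans (diff_powR_le_bregman mO p1 p2 mW mV0 iW iV W1 V1)).
apply: ler_wpM2l; first by apply: divr_ge0; [exact: ler0n|exact: ltW].
apply: (le_trans (integral_bregman_le mO p1 mW mV0 iW iV W1 V1)).
rewrite lerD2l lerN2 -RintegralZl// le_eqVlt; apply/orP; left; apply/eqP.
by apply: eq_Rintegral => x _; rewrite E.
Qed.

(** Here the base point of the divergence is the image of [W], and V0^(p-1) is the other argument.
    As [r] is conjugate to [p], the derivative of |.|^r / r undoes the map W -> |W|^(p-2) W, so that
    the pairing is again that of [W] with v0^2. *)
Lemma hoelder_stability_ge2 : 2 <= p ->
  let r := p / (p - 1) in
  [/\ mu.-integrable Omega (EFin \o (fun x => W x * v0 x ^+ 2)),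
   mu.-integrable Omega
     (EFin \o (fun x => `|(`|W x| `^ (p - 2) * W x - V0 x `^ (p - 1))| `^ r)) &
   (\int[mu]_(x in Omega)
     (`|(`|W x| `^ (p - 2) * W x - V0 x `^ (p - 1))| `^ r)) `^ (2 / r) <=
   648 / (r - 1) * (1 - kappa^-1 * \int[mu]_(x in Omega) (W x * v0 x ^+ 2))].
Proof.
move=> p2 r.
have r1 : 1 < r by rewrite /r ltr_pdivlMr//; lra.
have r2 : r <= 2 by rewrite /r ler_pdivrMr//; lra.
have rn0 : r - 1 != 0 by rewrite subr_eq0 gt_eqF.
pose s x := V0 x `^ (p - 1); pose t x := `|W x| `^ (p - 2) * W x.
have s0 x : 0 <= s x by exact: powR_ge0.
have ms : measurable_fun Omega s by exact: (measurableT_comp (measurable_powR _)).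
have mt : measurable_fun Omega t.
  by apply: measurable_funM => //; exact: measurable_normr_powR.
have nt x : `|t x| = `|W x| `^ (p - 1).
  rewrite /t normrM (ger0_norm (powR_ge0 _ _)).
  by rewrite (_ : p - 2 = p - 1 - 1) ?normr_powRM//; ring.
have pr : (p - 1) * r = p by rewrite /r mulrC divfK// gt_eqF.
have sE x : `|s x| `^ r = V0 x `^ p by rewrite ger0_norm// -powRrM pr.
have tE x : `|t x| `^ r = `|W x| `^ p by rewrite nt -powRrM pr.
have is_ : mu.-integrable Omega (EFin \o (fun x => `|s x| `^ r)).
  apply: eq_integrable integrable_optimal_potential_powR => // x _.
  by rewrite /= sE.
have it : mu.-integrable Omega (EFin \o (fun x => `|t x| `^ r)).
  by apply: eq_integrable iW => // x _; rewrite /= tE.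
have s1 : \int[mu]_(x in Omega) (`|s x| `^ r) <= 1.
  by under eq_Rintegral do rewrite sE; rewrite integral_optimal_potential_powR.
have t1 : \int[mu]_(x in Omega) (`|t x| `^ r) <= 1.
  by under eq_Rintegral do rewrite tE.
have E x : `|t x| `^ (r - 2) * t x * s x = kappa^-1 * (W x * v0 x ^+ 2).
  have -> : `|t x| `^ (r - 2) * t x = W x.
    have [Wx0|Wx0] := eqVneq (W x) 0; first by rewrite /t Wx0 !mulr0.
    (* The exponents (p - 1) (r - 2) and p - 2 add up to 0. *)
    rewrite nt -powRrM /t mulrA -powRD; last by rewrite normr_eq0 Wx0 implybT.
    rewrite (_ : _ + _ = 0) ?powRr0 ?mul1r//.
    by rewrite mulrBr pr; ring.
  by rewrite /s optimal_potential_powR_subr1; ring.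
have iy := integrable_young mO r1 ms mt is_ it.
have iWv : mu.-integrable Omega (EFin \o (fun x => W x * v0 x ^+ 2)).
  apply: eq_integrable (integrableZR mO kappa iy) => // x _ /=.
  by rewrite E mulrA mulfV ?mul1r// gt_eqF// kappa_gt0.
split => //.
  apply: eq_integrable (integrable_diff_powR mO r1 ms mt is_ it) => // x _.
  by rewrite /= distrC.
under eq_Rintegral do rewrite distrC.
apply: (le_trans (diff_powR_le_bregman mO r1 r2 ms mt is_ it s1 t1)).
have rm1 : 0 <= r - 1 by rewrite subr_ge0 ltW.
apply: ler_wpM2l; first by apply: divr_ge0; [exact: ler0n|].
apply: (le_trans (integral_bregman_le mO r1 ms mt is_ it s1 t1)).
rewrite lerD2l lerN2 -RintegralZl// le_eqVlt; apply/orP; left; apply/eqP.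
by apply: eq_Rintegral => x _; rewrite E.
Qed.

End hoelder_stability.

(** * From extended real to real potentials *)

Section energy.
Context {R : realType} {n : nat} (n3 : (3 <= n)%N).
Variable (Omega : set 'rV[R]_n) (oO : open Omega).
Local Notation mu := (lebesgue_rV R n).
Let mO : measurable Omega := open_measurable_rV oO.

Lemma powR_integral_ae_fin (p : R) (V : 'rV[R]_n -> \bar R) : 0 < p ->
  measurable_fun Omega V ->
  (\int[mu]_(x in Omega) (`|V x| `^ p) < +oo)%E ->
  {ae mu, forall x, Omega x -> V x = (fine (V x))%:E}.
Proof.
move=> p0 mV h.
have iV : mu.-integrable Omega (fun x => `|V x| `^ p)%E.
  apply/integrableP; split.
    by apply: (measurableT_comp (measurable_poweR _)); exact: measurableT_comp.
  by under eq_integral do rewrite gee0_abs ?poweR_ge0//.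
have := integrable_ae mO iV; apply: filterS => x /[apply].
case: (V x) => [r| |] //=; by rewrite gt_eqF.
Qed.

Lemma Lnorm_on_sqr (r : R) (h : 'rV[R]_n -> \bar R) (w : 'rV[R]_n -> R) : 0 < r ->
  measurable_fun Omega h -> measurable_fun Omega w ->
  {ae mu, forall x, Omega x -> h x = (w x)%:E} ->
  mu.-integrable Omega (EFin \o (fun x => `|w x| `^ r)) ->
  (Lnorm_on Omega r h ^+ 2 =
   ((\int[mu]_(x in Omega) (`|w x| `^ r)) `^ (2 / r))%:E)%E.
Proof.
move=> r0 mh mw hw iw; rewrite Lnorm_onE ?gt_eqF//.
rewrite (ae_eq_integral (fun x => (`|w x| `^ r)%:E))//.
- rewrite -(EFin_Rintegral mO iw) poweR_EFin -EFin_expe; congr (_%:E).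
  rewrite -(powR_mulrn 2) ?powR_ge0// -powRrM mulrC; congr (_ `^ _).
- by apply: (measurableT_comp (measurable_poweR _)); exact: measurableT_comp.
- exact: measurable_int iw.
- by apply: filterS hw => x /[apply] ->.
Qed.

End energy.

(** * The energy bound *)

Section energy_bound.
Context {R : realType} {n : nat} (n3 : (3 <= n)%N).
Variable (Omega : set 'rV[R]_n) (oO : open Omega).
Local Notation mu := (lebesgue_rV R n).
Let mO : measurable Omega := open_measurable_rV oO.
Variables (p c1 : R) (p1 : 1 < p).
Local Notation q := (2 * p / (p - 1)).
Variables (f : ('rV[R]_n -> R) -> R) (df : dual_W012 Omega f).
Hypothesis nzf : nonzero_dual Omega f.
Variables (v0 : 'rV[R]_n -> R) (hv0 : G_minimizer Omega p f v0).
Hypothesis v0c1 : Lnorm_on Omega q (fun x => (v0 x)%:E) = c1%:E.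
Local Notation V0 := (optimal_potential Omega p v0).
Local Notation S0 := (fine (conj_power_int Omega p v0)).

Let q0 : 0 < q. Proof. exact: lt_trans (conj_exponent_gt2 p1). Qed.

Let conj_powerE : conj_power_int Omega p v0 = (c1 `^ q)%:E.
Proof. by rewrite /conj_power_int Lnorm_on_powR ?gt_eqF// v0c1. Qed.

Let fin_v0 : (conj_power_int Omega p v0 < +oo)%E.
Proof. by rewrite conj_powerE ltry. Qed.

Let S00 : 0 < S0.
Proof. exact: (minimizer_conj_power_gt0 n3 oO p1 df hv0 fin_v0 nzf). Qed.

Lemma minimizer_norm_gt0 : 0 < c1.
Proof.
have c10 : 0 <= c1 by rewrite -lee_fin -v0c1; exact: Lnorm_ge0.
rewrite lt_neqAle c10 andbT eq_sym; apply/eqP => c1E; move: S00.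
by rewrite conj_powerE c1E powR0 ?gt_eqF//= ltxx.
Qed.

Let kappaE : S0 `^ (2 / q) = c1 ^+ 2.
Proof.
rewrite conj_powerE /= -powRrM mulrCA mulfV ?gt_eqF// mulr1.
by rewrite powR_mulrn// ltW// minimizer_norm_gt0.
Qed.

(** [X] stands for the squared distance and M / K for the constant of the stability estimate.
    Testing the energy of [V] with v0 leaves G(v0) minus c1^2 / 2 times the deficit, since c1^2 is
    the squared norm of v0. *)
Lemma energy_stability (V : 'rV[R]_n -> \bar R) (W : 'rV[R]_n -> R) (K M X : R) :
  measurable_fun Omega V -> measurable_fun Omega W ->
  {ae mu, forall x, Omega x -> V x = (W x)%:E} ->
  mu.-integrable Omega (EFin \o (fun x => W x * v0 x ^+ 2)) ->
  0 < K -> 0 < M ->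
  X <= M / K * (1 - (S0 `^ (2 / q))^-1 * \int[mu]_(x in Omega) (W x * v0 x ^+ 2)) ->
  (energy Omega f V <=
   energy Omega f (fun x => (V0 x)%:E) - (c1 ^+ 2 * K / (2 * M))%:E * X%:E)%E.
Proof.
move=> mV mW VW iW K0 M0 XK.
have pv0 := minimizer_pair hv0; have mv0 := sobolev_pair_measurable pv0.
have iv0 := minimizer_integrable hv0 fin_v0.
apply: (@le_trans _ _ (energy_functional Omega f V v0)).
  by apply: ereal_inf_lbound; exists v0 => //; exact: hv0.1.
apply: (@le_trans _ _ (G_functional Omega p f v0 - (c1 ^+ 2 * K / (2 * M))%:E * X%:E)%E);
  last first.
  by apply: leeB => //; exact: energy_optimal_ge.
rewrite (G_functionalE n3 oO p1 f pv0 iv0) /energy_functional (dirichletE n3 oO pv0).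
rewrite (ae_eq_integral (fun x => (W x * v0 x ^+ 2)%:E))//; last 3 first.
- apply: emeasurable_funM => //; apply/measurable_EFinP.
  exact: measurable_funX.
- exact: measurable_int iW.
- by apply: filterS VW => x /[apply] ->; rewrite EFinM.
rewrite -(EFin_Rintegral mO iW).
rewrite -[leLHS]/((2^-1 * ip Omega (weak_gradient Omega v0) (weak_gradient Omega v0) +
  2^-1 * \int[mu]_(x in Omega) (W x * v0 x ^+ 2) - f v0)%:E).
rewrite -EFinM -EFinB lee_fin -[Rintegral _ _ (fun x => _ `^ _)]/S0 kappaE.
rewrite kappaE in XK.
have c0 : 0 < c1 ^+ 2 by rewrite exprn_gt0// minimizer_norm_gt0.
have s0 : 0 <= c1 ^+ 2 * K / (2 * M).
  by apply: divr_ge0; apply: mulr_ge0 => //; exact: ltW.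
have := ler_wpM2l s0 XK.
have -> : c1 ^+ 2 * K / (2 * M) * (M / K * (1 - (c1 ^+ 2)^-1 *
     \int[mu]_(x in Omega) (W x * v0 x ^+ 2))) =
   2^-1 * c1 ^+ 2 - 2^-1 * \int[mu]_(x in Omega) (W x * v0 x ^+ 2).
  by field; rewrite !gt_eqF// minimizer_norm_gt0.
lra.
Qed.

End energy_bound.

Theorem theoremA (R : realType) (p c1 : R) (hp : 1 < p) :
  exists2 sigma1 : R, 0 < sigma1 &
  forall (n : nat) (Omega : set 'rV[R]_n) (f : ('rV[R]_n -> R) -> R)
         (v0 : 'rV[R]_n -> R) (V : 'rV[R]_n -> \bar R),
    (3 <= n)%N -> open Omega ->
    dual_W012 Omega f -> nonzero_dual Omega f ->
    G_minimizer Omega p f v0 ->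
    Lnorm_on Omega (2 * p / (p - 1)) (fun x => (v0 x)%:E) = c1%:E ->
    admissible Omega V ->
    (\int[lebesgue_rV R n]_(x in Omega) (`|V x| `^ p) <= 1)%E ->
    let V0 := optimal_potential Omega p v0 in
    (2 <= p ->
      (energy Omega f V <=
       energy Omega f (fun x => (V0 x)%:E) -
       sigma1%:E *
       Lnorm_on Omega (p / (p - 1))
         (fun x => `|V x| `^ (p - 2) * V x - (V0 x `^ (p - 1))%:E) ^+ 2)%E) /\
    (p < 2 ->
      (energy Omega f V <=
       energy Omega f (fun x => (V0 x)%:E) -
       sigma1%:E *
       Lnorm_on Omega p (fun x => V x - (V0 x)%:E) ^+ 2)%E).
Proof.
have pm1 : 0 < p - 1 by lra.
have p0 : 0 < p by lra.
(* In both cases 1 < r <= 2; the factor r - 1 of the constant is p - 1 or 1 / (p - 1). *)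
pose r := if p < 2 then p else p / (p - 1).
have r1 : 0 < r - 1.
  by rewrite /r; case: ifP => // _; rewrite subr_gt0 ltr_pdivlMr//; lra.
have [M [ME M0]] : exists M : R, M = 648 /\ 0 < M.
  by exists 648; split; [|rewrite ltr0n].
(* The constant is fixed before the dimension, the set and [f]. For c1 <= 0 no v0 satisfies the
   hypotheses, by [minimizer_norm_gt0], and any positive value will do. *)
exists (if 0 < c1 then c1 ^+ 2 * (r - 1) / (2 * M) else 1).
  case: ifP => // c10; apply: divr_gt0; apply: mulr_gt0 => //.
  exact: exprn_gt0.
move=> n Omega f v0 V n3 oO df nzf hv0 v0c1 [mV _ _] V1 V0.
have mO : measurable Omega := open_measurable_rV oO.
rewrite (minimizer_norm_gt0 n3 oO hp df nzf hv0 v0c1).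
have q0 : 0 < 2 * p / (p - 1) by exact: lt_trans (conj_exponent_gt2 hp).
have fin_v0 : (conj_power_int Omega p v0 < +oo)%E.
  by rewrite /conj_power_int Lnorm_on_powR ?gt_eqF// v0c1 ltry.
have S00 := minimizer_conj_power_gt0 n3 oO hp df hv0 fin_v0 nzf.
have mv0 := sobolev_pair_measurable (minimizer_pair hv0).
have iv0 := minimizer_integrable hv0 fin_v0.
have mV0 : measurable_fun Omega V0 by exact: measurable_optimal_potential hv0.
(* [V] may be infinite, but only on a null set by the bound on the integral of |V|^p. The estimates
   are made for the real function [W]. *)
pose W x := fine (V x).
have mW : measurable_fun Omega W by exact: measurableT_comp.
have VW : {ae lebesgue_rV R n, forall x, Omega x -> V x = (W x)%:E}.
  by apply: (powR_integral_ae_fin oO p0 mV); rewrite (le_lt_trans V1)// ltry.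
have IW : (\int[lebesgue_rV R n]_(x in Omega) (`|V x| `^ p) =
    \int[lebesgue_rV R n]_(x in Omega) (`|W x| `^ p)%:E)%E.
  apply: ae_eq_integral => //.
  - by apply: (measurableT_comp (measurable_poweR _)); exact: measurableT_comp.
  - by apply/measurable_EFinP; exact: measurable_normr_powR.
  - by apply: filterS VW => x /[apply] ->.
rewrite IW in V1.
have iW : (lebesgue_rV R n).-integrable Omega (EFin \o (fun x => `|W x| `^ p)).
  apply/integrableP_ge0; first exact: measurable_normr_powR.
    by move=> x _; rewrite powR_ge0.
  by rewrite (le_lt_trans V1)// ltry.
rewrite -(EFin_Rintegral mO iW) lee_fin in V1.
split=> p2.
- have rE : r = p / (p - 1) by rewrite /r ltNge p2.
  have [i1 i2 h] := hoelder_stability_ge2 oO hp mv0 iv0 S00 mW iW V1 p2.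
  rewrite (Lnorm_on_sqr oO _ _ _ _ i2).
  + rewrite rE in r1 *; rewrite -ME in h.
    exact: (energy_stability n3 oO hp df nzf hv0 v0c1 mV mW VW i1 r1 M0 h).
  + by rewrite divr_gt0.
  + apply: emeasurable_funB; last first.
      apply/measurable_EFinP.
      exact: (measurableT_comp (measurable_powR (p - 1))).
    apply: emeasurable_funM => //.
    by apply: (measurableT_comp (measurable_poweR _)); exact: measurableT_comp.
  + apply: measurable_funB; last first.
      exact: (measurableT_comp (measurable_powR (p - 1))).
    by apply: measurable_funM => //; exact: measurable_normr_powR.
  + by apply: filterS VW => x /[apply] ->.
- have rE : r = p by rewrite /r p2.
  have [i1 i2 h] := hoelder_stability_lt2 oO hp mv0 iv0 S00 mW iW V1 p2.
  rewrite (Lnorm_on_sqr oO _ _ _ _ i2)//.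
  + rewrite rE -ME in h *.
    exact: (energy_stability n3 oO hp df nzf hv0 v0c1 mV mW VW i1 pm1 M0 h).
  + by apply: emeasurable_funB => //; exact/measurable_EFinP.
  + exact: measurable_funB.
  + by apply: filterS VW => x /[apply] ->.
Qed.
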